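(* Let $0<\alpha<2$ and let $Z=Z^{(n)}$ be the sparse random matrix $Z_{ij}=X_{ij}Y_{ij}$, where $X$ is the adjacency matrix of the Erdős–Rényi graph $\mathcal G_{n,d/n}$ and $Y$ has i.i.d. Weibull entries with shape parameter $\alpha$ (all as described in the context). Put $\lambda^{\mathrm{heavy}}_\alpha:=(\log n)^{1/\alpha}$, and let $\delta>0$. 1. In the case $1<\alpha<2$, let $\beta>2$ be the conjugate of $\alpha$ (i.e. $\frac1\alpha+\frac1\beta=1$), and for each integer $k\ge2$ define $$\psi_{\alpha,\delta}(k):=\frac{k(k-3)}{2}+\frac12(1+\delta)^\alpha\,\phi_{\beta/2}(k)^{1-\alpha}.$$ Then $$\lim_{n\to\infty}-\frac{\log\mathbb P\left(\lambda_1(Z)\ge(1+\delta)\lambda^{\mathrm{heavy}}_\alpha\right)}{\log n}=\min_{k=2,3,\dots}\psi_{\alpha,\delta}(k).$$ 2. In the case $0<\alpha\le1$, $$\lim_{n\to\infty}-\frac{\log\mathbb P\left(\lambda_1(Z)\ge(1+\delta)\lambda^{\mathrm{heavy}}_\alpha\right)}{\log n}=(1+\delta)^\alpha-1.$$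
   Context: For $\theta>1$ and an integer $k\ge2$, $\phi_\theta(k):=\sup_{v=(v_1,\dots,v_k)\in\mathbb R^k,\ \|v\|_1=1}\ \sum_{i,j\in[k],\,i\ne j}|v_i|^\theta|v_j|^\theta$ (sum over ordered pairs). $d>0$ is a fixed constant. $X=(X_{ij})_{i,j\in[n]}$ is the adjacency matrix of the Erdős–Rényi graph $\mathcal G_{n,p}$ on vertex set $[n]=\{1,\dots,n\}$ with $p=d/n$. $Y=(Y_{ij})_{i,j\in[n]}$ is a random symmetric matrix, independent of $X$, with $Y_{ii}=0$, $Y_{ij}=Y_{ji}$ and $\{Y_{ij}\}_{1\le i<j\le n}$ i.i.d. with a Weibull distribution with shape parameter $\alpha$ (whose law does not depend on $n$). A random variable $W$ has a Weibull distribution with shape parameter $\alpha>0$ if there exist constants $C_1,C_2>0$ such that for all $t>1$, $\frac{C_1}{2}e^{-t^\alpha}\le \mathbb P(W\ge t)\le\frac{C_2}{2}e^{-t^\alpha}$ and $\frac{C_1}{2}e^{-t^\alpha}\le\mathbb P(W\le -t)\le\frac{C_2}{2}e^{-t^\alpha}$. $Z$ is the entrywise product, $Z_{ij}=X_{ij}Y_{ij}$. $\lambda_1(Z)$ denotes the largest eigenvalue of the symmetric matrix $Z$. *)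

(* Defs.v *)
From HB Require Import structures.
From mathcomp Require Export all_boot all_order all_algebra.
From mathcomp Require Export all_classical all_reals all_analysis.

Set Implicit Arguments.
Unset Strict Implicit.
Unset Printing Implicit Defensive.

Export Order.TTheory GRing.Theory Num.Theory.
Export numFieldNormedType.Exports.

Global Open Scope classical_set_scope.
Global Open Scope ring_scope.

Definition norm1 (R : realType) (k : nat) (v : 'rV[R]_k) : R :=
  \sum_(i < k) `|v 0 i|.

Definition phi (R : realType) (theta : R) (k : nat) : R :=
  sup [set \sum_(i < k) \sum_(j < k | i != j)
             `|v 0 i| `^ theta * `|v 0 j| `^ theta
      | v in [set v : 'rV[R]_k | norm1 v = 1]].

(* [k%:R - 3] is computed in [R], so that [k = 2] gives the first term [- 1]. *)
Definition psi (R : realType) (alpha beta delta : R) (k : nat) : R :=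
  k%:R * (k%:R - 3) / 2
  + 2^-1 * (1 + delta) `^ alpha * phi (beta / 2) k `^ (1 - alpha).

Definition heavy_scale (R : realType) (alpha : R) (n : nat) : R :=
  ln n%:R `^ alpha^-1.

(* For symmetric [A] and [0 < n] the set of eigenvalues is finite and nonempty,
   so the supremum is a maximum. *)
Definition lambda1 (R : realType) (n : nat) (A : 'M[R]_n) : R :=
  sup [set a | eigenvalue A a].

Definition mutually_independent d d' (T : measurableType d)
    (E : measurableType d') (R : realType) (P : probability T R)
    (I : finType) (D : {set I}) (V : I -> {RV P >-> E}) : Prop :=
  forall (J : {set I}) (B : I -> set E), J \subset D ->
    (forall i, i \in J -> measurable (B i)) ->
    P (\bigcap_(i in [set` J]) (V i @^-1` B i))
    = (\prod_(i in J) P (V i @^-1` B i))%E.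

Arguments mutually_independent {d d' T E R} P {I} D V.

Definition family_sigma_algebra d d' (T : measurableType d)
    (E : measurableType d') (R : realType) (P : probability T R)
    (I : Type) (V : I -> {RV P >-> E}) : set (set T) :=
  <<s \bigcup_i preimage_set_system setT (V i) measurable >>.

Definition independent_families d d1 d2 (T : measurableType d)
    (E1 : measurableType d1) (E2 : measurableType d2)
    (R : realType) (P : probability T R) (I1 I2 : Type)
    (V : I1 -> {RV P >-> E1}) (W : I2 -> {RV P >-> E2}) : Prop :=
  forall A B : set T, family_sigma_algebra V A -> family_sigma_algebra W B ->
    P (A `&` B) = (P A * P B)%E.

Arguments independent_families {d d1 d2 T E1 E2 R} P {I1 I2} V W.

Definition upper_pairs (n : nat) : {set 'I_n * 'I_n} :=
  [set ij : 'I_n * 'I_n | (ij.1 < ij.2)%N].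

(* [G (i, j) w] tells whether [i] and [j] are joined in the random graph. *)
Record erdos_renyi d (T : measurableType d) (R : realType)
    (P : probability T R) (n : nat) (p : R)
    (G : 'I_n * 'I_n -> {RV P >-> bool}) : Prop := {
  er_irrefl : forall i w, G (i, i) w = false;
  er_sym : forall i j w, G (i, j) w = G (j, i) w;
  er_indep : mutually_independent P (upper_pairs n) G;
  er_prob : forall i j : 'I_n, (i < j)%N -> P [set w | G (i, j) w] = p%:E
}.

Arguments erdos_renyi {d T R} P {n} p G.

(* Stated for the law [mu] of a random variable [W], so that the two rays have
   measure [P (W >= t)] and [P (W <= - t)]. *)
Definition weibull (R : realType) (alpha : R) (mu : probability R R) : Prop :=
  exists C1 C2 : R, [/\ 0 < C1, 0 < C2 & forall t : R, 1 < t ->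
    ((C1 / 2 * expR (- (t `^ alpha)))%:E <= mu `[t, +oo[%classic
                              <= (C2 / 2 * expR (- (t `^ alpha)))%:E)%E /\
    ((C1 / 2 * expR (- (t `^ alpha)))%:E <= mu `]-oo, (- t)%R]%classic
                              <= (C2 / 2 * expR (- (t `^ alpha)))%:E)%E].

Record iid_symmetric d (T : measurableType d) (R : realType)
    (P : probability T R) (n : nat) (mu : probability R R)
    (Y : 'I_n * 'I_n -> {RV P >-> R}) : Prop := {
  iid_diag : forall i w, Y (i, i) w = 0;
  iid_sym : forall i j w, Y (i, j) w = Y (j, i) w;
  iid_indep : mutually_independent P (upper_pairs n) Y;
  iid_law : forall i j : 'I_n, (i < j)%N ->
    forall A : set R, measurable A -> distribution P (Y (i, j)) A = mu A
}.

Arguments iid_symmetric {d T R} P {n} mu Y.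

Definition adjacency_mx d (T : measurableType d) (R : realType)
    (P : probability T R) (n : nat) (G : 'I_n * 'I_n -> {RV P >-> bool})
    (w : T) : 'M[R]_n :=
  \matrix_(i, j) (G (i, j) w)%:R.

Definition sparse_mx d (T : measurableType d) (R : realType)
    (P : probability T R) (n : nat) (G : 'I_n * 'I_n -> {RV P >-> bool})
    (Y : 'I_n * 'I_n -> {RV P >-> R}) (w : T) : 'M[R]_n :=
  \matrix_(i, j) (adjacency_mx G w i j * Y (i, j) w).

(* [lne] is the extended logarithm, with [lne 0 = -oo]. *)
Definition upper_tail_rate d (T : measurableType d) (R : realType)
    (P : probability T R) (alpha delta : R) (n : nat) (Z : T -> 'M[R]_n) :
    \bar R :=
  (- (lne (P [set w | (1 + delta) * heavy_scale alpha n <= lambda1 (Z w)]%R)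
      / (ln n%:R)%:E))%E.

(* Main.v *)
Require Import Defs.
From mathcomp Require Import measurable_realfun ring lra zify.

Set Implicit Arguments.
Unset Strict Implicit.
Unset Printing Implicit Defensive.

(** Write L for ln n.  A large top eigenvalue is produced by a small clique with
    large weights.  The expected number of k-cliques of G(n, d/n) is of order
    n ^ (- k (k - 3) / 2), and weights y_e on the edges of a given one cost
    exp (- \sum_e |y_e| ^ alpha).  To have
    \sum_(i != j) y_ij v_i v_j >= (1 + delta) L ^ (1 / alpha) for a unit vector
    v, Hoelder's inequality makes the cheapest energy
    (1 + delta) ^ alpha / 2 * S ^ (1 - alpha) * L, where
    S = \sum_(i != j) (v_i v_j) ^ beta; maximising S gives phi (beta / 2) k and
    the exponent psi k.  For alpha <= 1 energy is best spent on a single edge.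

    Lower bound (top_event_lower).  Fix a near-optimal v and weights, split the
    vertices into k blocks, and consider the event that one vertex of each block
    can be chosen so that they span a clique with the prescribed weights.  The
    second Bonferroni inequality reduces its probability to the sum over the
    choices, because two choices which share at least two vertices are rarer by
    a factor 1 / n and the others are independent.

    Upper bound (top_event_upper).  Split the matrix at |Y_e| ^ alpha = L ^ a
    with a small power a.
    - The light part has quadratic form at most the threshold times the square
      root of the largest number of paths of length two from a vertex
      (qf_le_two_paths).  This number is O(L) outside an event of negligible
      probability (many_two_paths), and L ^ (a / alpha + 1 / 2) is of smaller
      order than L ^ (1 / alpha) since alpha < 2.
    - The quadratic form of the heavy part can be localised to one connected
      component (localize).  Heavy edges are so rare that components have
      o(L / ln L) vertices.  A component with m vertices, e edges and energy s
      has probability n ^ (m - e) exp (- s) up to factors n ^ o(1)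
      (heavy_union), the energies being discretised so that only finitely many
      events are involved.
    - Deterministically, (e - m) ln n + s is at least the claimed rate times L
      (rate_cost_le1, rate_cost_gt1): Hoelder's inequality bounds s below by
      means of \sum_(i ~ j) |v_i v_j| ^ beta, a Motzkin-Straus argument
      (motzkin_straus) moves the mass of v onto a clique of some size k without
      decreasing this sum, and a connected graph containing a k-clique has
      e - m >= k (k - 3) / 2 (connected_card_edges). *)

(** * Rayleigh quotients *)

Section Rayleigh.
Variable R : realType.
Implicit Types n : nat.

Definition qf n (A : 'M[R]_n) (v : 'I_n -> R) : R :=
  \sum_i \sum_j A i j * v i * v j.
Definition sqn (I : finType) (v : I -> R) : R := \sum_i v i ^+ 2.

Lemma sqn_ge0 (I : finType) (v : I -> R) : 0 <= sqn v.
Proof. by apply: sumr_ge0 => i _; exact: sqr_ge0. Qed.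

Lemma sqn_eq0 (I : finType) (v : I -> R) i : sqn v = 0 -> v i = 0.
Proof.
move=> /eqP; rewrite psumr_eq0; last by move=> j _; exact: sqr_ge0.
by move=> /allP /(_ i (mem_index_enum _)) /=; rewrite sqrf_eq0 => /eqP.
Qed.

Lemma qfZ n (A : 'M[R]_n) c v : qf A (fun i => c * v i) = c ^+ 2 * qf A v.
Proof.
rewrite /qf mulr_sumr; apply: eq_bigr => i _; rewrite mulr_sumr.
by apply: eq_bigr => j _; ring.
Qed.

Lemma sqnZ (I : finType) c (v : I -> R) : sqn (fun i => c * v i) = c ^+ 2 * sqn v.
Proof. by rewrite /sqn mulr_sumr; apply: eq_bigr => i _; ring. Qed.

Lemma continuous_sum (T : topologicalType) (I : Type) (r : seq I) (f : I -> T -> R) :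
  (forall i, continuous (f i)) -> continuous (fun x => \sum_(i <- r) f i x).
Proof.
move=> cf; elim: r => [|i r IH].
  have -> : (fun x : T => \sum_(i <- [::]) f i x) = cst 0.
    by apply/funext => x; rewrite big_nil.
  by move=> x; exact: cvg_cst.
have -> : (fun x : T => \sum_(j <- i :: r) f j x) =
          (fun x => f i x + \sum_(j <- r) f j x).
  by apply/funext => x; rewrite big_cons.
by move=> x; apply: cvgD; [exact: cf | exact: IH].
Qed.

Lemma continuous_rV_qf n (A : 'M[R]_n) : continuous (fun v : 'rV[R]_n => qf A (v 0)).
Proof.
apply: (@continuous_sum 'rV[R]_n) => i; apply: (@continuous_sum 'rV[R]_n) => j v.
have h k : (fun x : 'rV[R]_n => x 0 k) x @[x --> v] --> v 0 k by exact: coord_continuous.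
exact: cvgM (cvgM (cvg_cst _) (h i)) (h j).
Qed.

Lemma continuous_rV_sqn n : continuous (fun v : 'rV[R]_n => sqn (v 0)).
Proof.
apply: (@continuous_sum 'rV[R]_n) => i v.
have h k : (fun x : 'rV[R]_n => x 0 k) x @[x --> v] --> v 0 k by exact: coord_continuous.
exact: cvgM (h i) (h i).
Qed.

Lemma compact_sphere n : compact [set v : 'rV[R]_n | sqn (v 0) = 1].
Proof.
apply: bounded_closed_compact; last first.
  by apply: (closed_comp (f := fun v : 'rV[R]_n => sqn (v 0)) (D := [set 1]));
    [move=> v _; exact: continuous_rV_sqn | exact: closed_eq].
exists 1; split; first exact: num_real.
move=> x x1 v /= hv.
apply: le_trans (ltW x1).
have -> : `|v| = mx_norm v by [].
rewrite mx_normrE; apply: bigmax_le => // ij _.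
rewrite ord1 -(ler_pXn2r (n := 2)) ?nnegrE // expr1n -normrX ger0_norm ?sqr_ge0 //.
by rewrite -hv /sqn (bigD1 ij.2) //= lerDl; apply: sumr_ge0 => k _; exact: sqr_ge0.
Qed.

Definition bf n (A : 'M[R]_n) (u v : 'I_n -> R) : R :=
  \sum_i \sum_j A i j * u i * v j.

Lemma qf_perturb n (A : 'M[R]_n) v u e : A^T = A ->
  qf A (fun i => v i + e * u i) = qf A v + 2 * e * bf A v u + e ^+ 2 * qf A u.
Proof.
move=> As.
have E : bf A u v = bf A v u.
  rewrite /bf exchange_big /=; apply: eq_bigr => i _; apply: eq_bigr => j _.
  by rewrite -{1}As mxE; ring.
have -> : 2 * e * bf A v u = e * bf A u v + e * bf A v u by rewrite E; ring.
rewrite /qf /bf !mulr_sumr -!big_split; apply: eq_bigr => i _ /=.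
by rewrite !mulr_sumr -!big_split /=; apply: eq_bigr => j _; ring.
Qed.

Lemma sqn_perturb (I : finType) (v u : I -> R) e :
  sqn (fun i => v i + e * u i) = sqn v + 2 * e * (\sum_i v i * u i) + e ^+ 2 * sqn u.
Proof.
by rewrite /sqn !mulr_sumr -!big_split /=; apply: eq_bigr => i _; ring.
Qed.

(** First-order condition at a maximum: a quadratic polynomial in [e] without
    constant term which is nowhere positive has no linear term. *)
Lemma le0_perturb (a b : R) :
  (forall e : R, 2 * e * a + e ^+ 2 * b <= 0) -> a = 0.
Proof.
move=> h; apply/eqP; case: eqVneq => // a0; exfalso.
have b1 : 0 < 1 + `|b| by rewrite ltr_pwDl.
(* a small step in the direction of [a], short enough for the quadratic term to be dominated *)
have := h (a / (1 + `|b|)).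
set e := a / _ => he.
have ea : a = e * (1 + `|b|) by rewrite /e divfK // gt_eqF.
have e2 : 0 < e ^+ 2.
  by rewrite exprn_even_gt0 //= /e mulf_neq0 // invr_eq0 gt_eqF.
have : 0 < 2 * e * a + e ^+ 2 * b.
  rewrite [X in 2 * e * X]ea.
  have -> : 2 * e * (e * (1 + `|b|)) + e ^+ 2 * b = e ^+ 2 * (2 + 2 * `|b| + b) by ring.
  apply: mulr_gt0 => //.
  by have := ler_norm (- b); rewrite normrN; have := normr_ge0 b; lra.
by rewrite ltNge he.
Qed.

(** Compactness of the sphere gives a maximiser of the quadratic form, and the
    vanishing of the first variation there makes it an eigenvector. *)
Lemma rayleigh_max n (A : 'M[R]_n.+1) : A^T = A ->
  exists2 v : 'rV[R]_n.+1, sqn (v 0) = 1 &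
    v *m A = qf A (v 0) *: v /\
    forall u : 'I_n.+1 -> R, qf A u <= qf A (v 0) * sqn u.
Proof.
move=> As.
have ne : [set v : 'rV[R]_n.+1 | sqn (v 0) = 1] !=set0.
  exists (delta_mx 0 0) => /=; rewrite /sqn (bigD1 0) //= !mxE !eqxx expr1n.
  by rewrite big1 ?addr0 // => i /negPf i0; rewrite !mxE i0 expr0n.
have cq : {within [set v : 'rV[R]_n.+1 | sqn (v 0) = 1], continuous (fun v : 'rV[R]_n.+1 => qf A (v 0))}.
  by apply: continuous_subspaceT; exact: continuous_rV_qf.
have [v + hv] := compact_EVT_max ne (@compact_sphere n.+1) cq.
rewrite inE /= => v1.
have max u : qf A u <= qf A (v 0) * sqn u.
  case: (eqVneq (sqn u) 0) => [u0|u0].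
    rewrite u0 mulr0 /qf big1 // => i _; rewrite big1 // => j _.
    by rewrite (sqn_eq0 j u0) mulr0.
  have up : 0 < sqn u by rewrite lt_def u0 sqn_ge0.
  pose s := Num.sqrt (sqn u).
  have s0 : s != 0 by rewrite /s gt_eqF // sqrtr_gt0.
  have ss : s ^+ 2 = sqn u by rewrite sqr_sqrtr // sqn_ge0.
  have e0 : (\row_i (s^-1 * u i)) 0 = (fun i => s^-1 * u i).
    by apply/funext => i; rewrite mxE.
  have hs : sqn ((\row_i (s^-1 * u i)) 0) = 1.
    by rewrite e0 sqnZ -ss exprVn mulVf // expf_neq0.
  have := hv (\row_i (s^-1 * u i)); rewrite inE => /(_ hs).
  rewrite e0.
  rewrite qfZ exprVn ss => h.
  by rewrite mulrC -ler_pdivrMl.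
exists v => //; split=> //.
set l := qf A (v 0).
have key u : bf A (v 0) u = l * \sum_i v 0 i * u i.
  apply/eqP; rewrite -subr_eq0; apply/eqP.
  apply: (@le0_perturb _ (qf A u - l * sqn u)) => e.
  have := max (fun i => v 0 i + e * u i).
  rewrite qf_perturb // sqn_perturb v1 -/l => h.
  rewrite -subr_ge0 in h; rewrite -subr_ge0.
  by apply: le_trans h _; rewrite le_eqVlt; apply/orP; left; apply/eqP; ring.
apply/rowP => j; rewrite !mxE.
have dl (x : 'I_n.+1 -> R) : \sum_i x i * (i == j)%:R = x j.
  rewrite (bigD1 j) //= eqxx mulr1 big1 ?addr0 // => i /negPf ->.
  by rewrite mulr0.
have := key (fun i => (i == j)%:R); rewrite dl => <-.
rewrite /bf; apply: eq_bigr => i _.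
by rewrite dl mulrC.
Qed.

(** All later bounds on the top eigenvalue are obtained through this
    characterisation by test vectors. *)
Lemma lambda1_ge n (A : 'M[R]_n) t : (0 < n)%N -> A^T = A ->
  t <= lambda1 A <-> exists2 v, 0 < sqn v & t * sqn v <= qf A v.
Proof.
case: n A => // n A _ As.
have [v v1 [eigv maxv]] := rayleigh_max As.
set l := qf A (v 0) in eigv maxv.
have eigl : eigenvalue A l.
  apply/eigenvalueP; exists v => //; apply/eqP => v0.
  move: v1; rewrite v0 /sqn big1 => [/eqP|i _]; last by rewrite mxE expr0n.
  by rewrite eq_sym oner_eq0.
have ubl : ubound [set a | eigenvalue A a] l.
  move=> a /= /eigenvalueP [u ua u0].
  have up : 0 < sqn (u 0).
    rewrite lt_def sqn_ge0 andbT; apply: contra_neqN u0 => /eqP u0.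
    by apply/rowP => i; rewrite mxE; exact: sqn_eq0.
  rewrite -(ler_pM2r up); apply: le_trans (maxv _).
  rewrite le_eqVlt; apply/orP; left; apply/eqP.
  rewrite /qf /sqn mulr_sumr exchange_big; apply: eq_bigr => j _.
  have /rowP/(_ j) := ua; rewrite !mxE => h.
  rewrite expr2 mulrA -h mulr_suml; apply: eq_bigr => i _; ring.
have -> : lambda1 A = l.
  apply/eqP; rewrite eq_le /lambda1; apply/andP; split.
    by apply: ge_sup => //; exists l.
  by apply: ub_le_sup => //; exists l.
split=> [tl|[u up hu]].
  by exists (v 0); rewrite v1 ?mulr1.
by rewrite -(ler_pM2r up); apply: le_trans hu (maxv _).
Qed.

End Rayleigh.

Section MeasurableTop.
Variable R : realType.

(** A strict Rayleigh inequality is an open condition, so it passes to a nearby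
    rational vector. *)
Lemma rational_rayleigh n (A : 'M[R]_n) (s : R) (v : 'I_n -> R) :
  s * sqn v < qf A v ->
  exists q : {ffun 'I_n -> rat},
    s * sqn (fun i => ratr (q i) : R) < qf A (fun i => ratr (q i)).
Proof.
move=> hv.
pose f (u : 'rV[R]_n) := qf A (u 0) - s * sqn (u 0).
have cf : continuous f.
  move=> u.
  have h1 : (fun v : 'rV[R]_n => qf A (v 0)) x @[x --> u] --> qf A (u 0).
    exact: continuous_rV_qf.
  have h2 : (fun v : 'rV[R]_n => sqn (v 0)) x @[x --> u] --> sqn (u 0).
    exact: continuous_rV_sqn.
  exact: cvgB h1 (cvgM (cvg_cst _) h2).
pose u := \row_i v i : 'rV[R]_n.
have e0 : u 0 = v by apply/funext => i; rewrite mxE.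
have fu : 0 < f u by rewrite /f e0 subr_gt0.
have : nbhs u (f @^-1` [set y | 0 < y]) by apply: cf; apply: open_nbhs_nbhs; split => //; exact: open_gt.
move=> /nbhs_ballP [e /= e_gt0 he].
have hq i : exists q : rat, ratr q \in `]v i - e, v i + e[.
  by apply: rat_in_itvoo; lra.
have [q qP] := choice hq.
exists [ffun i => q i].
pose w := \row_i (ratr (q i)) : 'rV[R]_n.
have e1 : w 0 = (fun i => ratr ([ffun i => q i] i)).
  by apply/funext => i; rewrite mxE ffunE.
have : 0 < f w.
  apply: he; split => // i j; rewrite /ball /= !mxE ?ffunE.
  by have := qP j; rewrite in_itv /= ltr_distlC => /andP[-> ->].
by rewrite /f subr_gt0 e1.
Qed.

(** By density it suffices to test the countably many rational vectors, and for
    each of them the quadratic form is a polynomial in the entries. *)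
Lemma measurable_lambda1_ge d (T : measurableType d) n (Z : T -> 'M[R]_n) (t : R) :
  (0 < n)%N -> (forall w, (Z w)^T = Z w) ->
  (forall i j, measurable_fun setT (fun w => Z w i j)) ->
  measurable [set w | t <= lambda1 (Z w)].
Proof.
move=> n0 Zs mZ.
have -> : [set w | t <= lambda1 (Z w)] =
    \bigcap_(m : nat) \bigcup_(q : {ffun 'I_n -> rat})
      [set w | (t - m.+1%:R^-1) * sqn (fun i => ratr (q i) : R)
               < qf (Z w) (fun i => ratr (q i))].
  apply/seteqP; split => w /=.
    move=> /(lambda1_ge _ n0 (Zs w)) [v v0 hv] m _.
    have [|q hq] := @rational_rayleigh n (Z w) (t - m.+1%:R^-1) v; last by exists q.
    apply: lt_le_trans hv; rewrite mulrBl ltrBlDr ltrDl.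
    by rewrite mulr_gt0 // invr_gt0 ltr0n.
  move=> h; rewrite leNgt; apply/negP => lt.
  have [m hm] := ltr_add_invr lt.
  have [q _ /= hq] := h m I.
  have : t - m.+1%:R^-1 <= lambda1 (Z w).
    apply/(lambda1_ge _ n0 (Zs w)); exists (fun i => ratr (q i)); last exact: ltW.
    rewrite lt_def sqn_ge0 andbT; apply/eqP => q0.
    move: hq; rewrite q0 mulr0 /qf big1 ?ltxx // => i _; rewrite big1 // => j _.
    by rewrite (sqn_eq0 j q0) mulr0.
  by rewrite leNgt ltrBrDr hm.
apply: bigcapT_measurable => m.
apply: countable_bigcupT_measurable; first exact: countableP.
move=> q.
pose f w := qf (Z w) (fun i => ratr (q i)).
have mf : measurable_fun setT f.
  rewrite /f /qf.
  apply: measurable_sum => i; apply: measurable_sum => j.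
  apply: measurable_funM; last exact: measurable_cst.
  by apply: measurable_funM; [exact: mZ | exact: measurable_cst].
rewrite -[X in measurable X]setTI -/f.
have -> : [set w | (t - m.+1%:R^-1) * sqn (fun i => ratr (q i) : R) < f w] =
          f @^-1` `]((t - m.+1%:R^-1) * sqn (fun i => ratr (q i) : R)), +oo[.
  by apply/seteqP; split => w /=; rewrite in_itv /= andbT.
exact: mf.
Qed.

End MeasurableTop.

(** * Probabilities of edge configurations *)

Section RealProb.
Context d (T : measurableType d) (R : realType) (P : probability T R).

(** Real-valued probabilities, so that estimates stay within real arithmetic;
    nothing is lost since a probability is finite. *)
Definition pr (A : set T) : R := fine (P A).

Lemma prE A : measurable A -> P A = (pr A)%:E.
Proof. by move=> mA; rewrite /pr fineK // fin_num_measure. Qed.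

Lemma pr_ge0 A : 0 <= pr A.
Proof. by apply: fine_ge0; exact: measure_ge0. Qed.

Lemma pr_le A B : measurable A -> measurable B -> A `<=` B -> pr A <= pr B.
Proof.
move=> mA mB AB; rewrite -lee_fin -!prE //.
by apply: le_measure => //; rewrite inE.
Qed.

Lemma pr_le1 A : measurable A -> pr A <= 1.
Proof. by move=> mA; rewrite -lee_fin -prE //; exact: probability_le1. Qed.

Lemma pr_setU A B : measurable A -> measurable B -> pr (A `|` B) <= pr A + pr B.
Proof.
move=> mA mB; rewrite -lee_fin EFinD -!prE //; last exact: measurableU.
exact: measureU2.
Qed.

Lemma pr_bigU (I : Type) (r : seq I) (Q : pred I) (A : I -> set T) :
  (forall i, measurable (A i)) ->
  measurable (\big[setU/set0]_(i <- r | Q i) A i) /\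
  pr (\big[setU/set0]_(i <- r | Q i) A i) <= \sum_(i <- r | Q i) pr (A i).
Proof.
move=> mA; elim: r => [|i r [mU IH]].
  by rewrite !big_nil; split => //; rewrite /pr measure0.
rewrite !big_cons; case: ifP => // Qi; split; first exact: measurableU.
by apply: le_trans (pr_setU (mA i) mU) _; rewrite lerD2l.
Qed.

End RealProb.

Section EdgeEvents.
Context d (T : measurableType d) (R : realType) (P : probability T R).
Variables (n : nat) (p : R) (mu : probability R R).
Variables (G : 'I_n * 'I_n -> {RV P >-> bool}) (Y : 'I_n * 'I_n -> {RV P >-> R}).
Hypothesis er : erdos_renyi P p G.
Hypothesis iid : iid_symmetric P mu Y.
Hypothesis ind : independent_families P G Y.

Definition edge_event (W : {set 'I_n * 'I_n}) (B : 'I_n * 'I_n -> set R) : set T :=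
  [set w | forall e, e \in W -> G e w /\ B e (Y e w)].

Lemma edge_eventE W B : edge_event W B =
  (\bigcap_(e in [set` W]) (G e @^-1` [set true])) `&`
  (\bigcap_(e in [set` W]) (Y e @^-1` B e)).
Proof.
apply/seteqP; split => w /=.
  by move=> h; split => e /= eW; have [] := h e eW.
by move=> [h1 h2] e eW; split; [apply: (h1 e eW) | apply: (h2 e eW)].
Qed.

Lemma measurable_edge_event W B :
  (forall e, measurable (B e)) -> measurable (edge_event W B).
Proof.
move=> mB; rewrite edge_eventE; apply: measurableI.
  apply: fin_bigcap_measurable => // e _.
  by rewrite -[X in measurable X]setTI; exact: measurable_funP.
apply: fin_bigcap_measurable => // e _.
by rewrite -[X in measurable X]setTI; exact: measurable_funP.
Qed.

(** Independence of the two families is stated for generated sigma-algebras; finite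
    intersections of preimages belong to them. *)
Lemma family_sigma_algebra_bigcap d' (E : measurableType d') (I : choiceType)
    (V : I -> {RV P >-> E}) (J : set I) (B : I -> set E) :
  finite_set J -> (forall i, measurable (B i)) ->
  family_sigma_algebra V (\bigcap_(i in J) (V i @^-1` B i)).
Proof.
move=> fJ mB.
rewrite /family_sigma_algebra.
set GG := \bigcup_i _.
have : measurable (\bigcap_(i in J) (V i @^-1` B i) : set (g_sigma_algebraType GG)).
  apply: fin_bigcap_measurable => // i _.
  apply: sub_sigma_algebra; exists i => //.
  by exists (B i) => //; rewrite setTI.
by [].
Qed.

(** The graph is independent of the weights and each of them is independent
    across edges, so the probability of a configuration factorises over its
    edges. *)
Lemma pr_edge_event (W : {set 'I_n * 'I_n}) (B : 'I_n * 'I_n -> set R) :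
  W \subset upper_pairs n -> (forall e, measurable (B e)) ->
  pr P (edge_event W B) = \prod_(e in W) (p * fine (mu (B e))).
Proof.
move=> WU mB; rewrite /pr edge_eventE ind; first last.
- exact: family_sigma_algebra_bigcap.
- by apply: (@family_sigma_algebra_bigcap _ _ _ _ _ (fun=> [set true])).
rewrite (er_indep er WU (B := fun=> [set true])) //.
rewrite (iid_indep iid WU) // big_split /=.
have -> : (\prod_(i in W) P (G i @^-1` [set true]) = (\prod_(i in W) p)%:E)%E.
  rewrite -prodEFin; apply: eq_bigr => -[i j] /(fintype.subsetP WU); rewrite inE /= => ij.
  by rewrite -(er_prob er ij).
have -> : (\prod_(i in W) P (Y i @^-1` B i) = (\prod_(i in W) fine (mu (B i)))%:E)%E.
  rewrite -prodEFin; apply: eq_bigr => -[i j] /(fintype.subsetP WU); rewrite inE /= => ij.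
  by rewrite fineK ?fin_num_measure // -(iid_law iid ij (mB _)).
by rewrite -EFinM.
Qed.

End EdgeEvents.

(** * Counting subsets and Weibull tails *)

Section Counting.
Variable R : realType.

Lemma sum_subsets_card (I : finType) (U : {set I}) k (x : R) :
  \sum_(W : {set I} | (W \subset U) && (#|W| == k)) x = 'C(#|U|, k)%:R * x.
Proof.
rewrite -cards_draws sumr_const mulr_natl.
by congr (_ *+ _); apply: eq_card => W; rewrite inE.
Qed.

Lemma sum_subsets (I : finType) (U : {set I}) (x : R) :
  \sum_(W : {set I} | W \subset U) x ^+ #|W| = (1 + x) ^+ #|U|.
Proof.
rewrite exprDn.
rewrite (partition_big (fun W : {set I} => inord #|W| : 'I_#|U|.+1) predT) //=.
apply: eq_bigr => k _.
rewrite expr1n mul1r -[RHS]mulr_natl -sum_subsets_card.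
rewrite (eq_bigl (fun W : {set I} => (W \subset U) && (#|W| == k))); last first.
  move=> W; case: (boolP (W \subset U)) => //= WU.
  by rewrite -val_eqE /= inordK // ltnS subset_leq_card.
by apply: eq_bigr => W /andP[_ /eqP ->].
Qed.

Lemma sum_subsets_le (I : finType) (U : {set I}) (x : R) : 0 <= x ->
  \sum_(W : {set I} | W \subset U) x ^+ #|W| <= expR (#|U|%:R * x).
Proof.
move=> x0; rewrite sum_subsets expRM_natl lerXn2r ?nnegrE ?addr_ge0 ?expR_ge0 //.
exact: expR_ge1Dx.
Qed.

(** Exponential Markov inequality in combinatorial form: giving the weight
    [expR 1 ^+ #|W|] to each subset turns the constraint [#|W| = k] into a
    factor [expR (- k)]. *)
Lemma sum_subsets_card_le (I : finType) (U : {set I}) k (x : R) : 0 <= x ->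
  \sum_(W : {set I} | (W \subset U) && (#|W| == k)) x ^+ #|W|
    <= expR (#|U|%:R * (expR 1 * x) - k%:R).
Proof.
move=> x0.
have e0 : 0 <= expR 1 * x :> R by rewrite mulr_ge0 ?expR_ge0.
rewrite expRB ler_pdivlMr ?expR_gt0 //.
apply: le_trans _ (sum_subsets_le U e0).
rewrite mulr_suml big_mkcondr /=; apply: ler_sum => W _.
case: eqP => [<-|_]; last by rewrite exprn_ge0.
by rewrite exprMn [X in _ <= X]mulrC -expRM_natl mulr1.
Qed.

Lemma bin_le_expn n k : ('C(n, k) <= n ^ k)%N.
Proof.
have h : (n ^_ k <= n ^ k)%N.
  elim: k n => [|k IH] n; first by rewrite ffactn0.
  case: n => [|n]; first by rewrite ffactnS mul0n.
  rewrite ffactSS expnS leq_mul2l /=; apply: leq_trans (IH n) _.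
  by case: k {IH} => // k; rewrite leq_exp2r.
by apply: leq_trans h; rewrite -bin_ffact leq_pmulr ?fact_gt0.
Qed.

End Counting.

Lemma subset_of_card (I : finType) (A : {set I}) k : (k <= #|A|)%N ->
  exists2 B : {set I}, B \subset A & #|B| = k.
Proof.
move=> /card_geqP [s [us <- sA]]; exists [set x in s].
  by apply/fintype.subsetP => x; rewrite inE; exact: sA.
by rewrite cardsE; apply/card_uniqP.
Qed.

Section Tail.
Variable R : realType.
Variables (alpha : R) (mu : probability R R).
Hypothesis alpha0 : 0 < alpha.
Hypothesis wb : weibull alpha mu.

Definition pow_ge (l : R) : set R := [set y | l <= `|y| `^ alpha].

Lemma measurable_pow_ge l : measurable (pow_ge l).
Proof.
have mf : measurable_fun setT (fun y : R => `|y| `^ alpha).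
  exact: (measurableT_comp (measurable_powR alpha) (@normr_measurable R setT)).
rewrite -[X in measurable X]setTI.
have -> : pow_ge l = (fun y : R => `|y| `^ alpha) @^-1` `[l, +oo[.
  by apply/seteqP; split => y /=; rewrite in_itv /= andbT.
exact: mf.
Qed.

(** The constant [expR 1] covers the levels [l <= 1], for which the definition
    of a Weibull law says nothing. *)
Lemma weibull_tail_le : exists2 C0 : R, 0 < C0 &
  forall l, fine (mu (pow_ge l)) <= C0 * expR (- l).
Proof.
have [C1 [C2 [C10 C20 hC]]] := wb.
exists (C2 + expR 1); first by rewrite addr_gt0 ?expR_gt0.
move=> l; have [l1|l1] := leP l 1.
  apply: le_trans (pr_le1 mu (measurable_pow_ge l)) _.
  rewrite mulrDl -expRD; apply: le_trans (_ : expR (1 - l) <= _).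
    by rewrite -[X in X <= _]expR0 ler_expR; lra.
  by rewrite lerDr mulr_ge0 ?expR_ge0 // ltW.
pose s := l `^ alpha^-1.
have sl : s `^ alpha = l by rewrite /s -powRrM mulVf ?powRr1 ?gt_eqF //; lra.
have s1 : 1 < s.
  rewrite ltNge; apply/negP => s1.
  have : s `^ alpha <= 1.
    rewrite -[X in _ <= X](congr1 (fun f => f alpha) (powR1 R)) ge0_ler_powR ?nnegrE ?powR_ge0 //; exact: ltW.
  by rewrite sl leNgt l1.
have [/andP[_ h1] /andP[_ h2]] := hC s s1.
have m1 : measurable `[s, +oo[%classic by exact: measurable_itv.
have m2 : measurable `]-oo, (- s)%R]%classic by exact: measurable_itv.
have sub : pow_ge l `<=` `[s, +oo[ `|` `]-oo, (- s)%R].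
  move=> y /= hy.
  have : s <= `|y|.
    rewrite leNgt; apply/negP => ys.
    move: hy; rewrite /pow_ge /= leNgt => /negP; apply.
    by rewrite -sl gt0_ltr_powR ?nnegrE ?powR_ge0.
  rewrite !in_itv /= andbT ler_normr => /orP[|] h; [by left|right].
  by rewrite lerNr.
have := pr_le mu (measurable_pow_ge l) (measurableU _ _ m1 m2) sub.
move=> /le_trans; apply.
apply: le_trans (pr_setU mu m1 m2) _.
rewrite (prE mu m1) lee_fin sl in h1; rewrite (prE mu m2) lee_fin sl in h2.
apply: le_trans (lerD h1 h2) _.
by have := mulr_ge0 (expR_ge0 (1 : R)) (expR_ge0 (- l)); lra.
Qed.

(** Below 2 the tail is at least the tail at 2, which only changes the constant. *)
Lemma weibull_tail_ge : exists2 c0 : R, 0 < c0 &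
  forall s, 0 <= s -> c0 * expR (- (s `^ alpha)) <= fine (mu `[s, +oo[%classic).
Proof.
have [C1 [C2 [C10 C20 hC]]] := wb.
have m1 (s : R) : measurable `[s, +oo[%classic by exact: measurable_itv.
exists (C1 / 2 * expR (- (2 `^ alpha))); first by rewrite mulr_gt0 ?expR_gt0 ?divr_gt0.
move=> s s0.
have hs (u : R) : 2 <= u -> C1 / 2 * expR (- (u `^ alpha)) <= fine (mu `[u, +oo[%classic).
  move=> u2; have u1 : 1 < u by lra.
  have [/andP[+ _] _] := hC u u1.
  by rewrite (prE mu (m1 u)) lee_fin.
have [s2|s2] := leP 2 s.
  apply: le_trans _ (hs _ s2).
  by rewrite -mulrA ler_pM2l ?divr_gt0 // ger_pMl ?expR_gt0 //.
apply: le_trans (_ : fine (mu `[2, +oo[%classic) <= _); last first.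
  apply: (pr_le mu) => // y /=; rewrite !in_itv /= !andbT; lra.
apply: le_trans _ (hs 2 (lexx _)).
rewrite ger_pMr ?mulr_gt0 ?divr_gt0 ?expR_gt0 //.
by rewrite -[X in _ <= X]expR0 ler_expR oppr_le0 powR_ge0.
Qed.

End Tail.

(** * Paths of length two and the light part *)

Definition upair n (i j : 'I_n) : 'I_n * 'I_n := if (i < j)%N then (i, j) else (j, i).

Definition star n (i : 'I_n) (S : {set 'I_n}) : {set 'I_n * 'I_n} :=
  [set upair i j | j in S].

(** Pairs through [i] are excluded so that the presence of these pairs is
    independent of the star of [i]. *)
Definition touching n (i : 'I_n) (S : {set 'I_n}) : {set 'I_n * 'I_n} :=
  [set e in upper_pairs n | [&& (e.1 \in S) || (e.2 \in S), e.1 != i & e.2 != i]].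

Section TwoPaths.
Variable n : nat.
Implicit Types (i j k : 'I_n) (S : {set 'I_n}).

Lemma upair_inj i : injective (upair i).
Proof.
by move=> j k; rewrite /upair; do 2 case: ifP => _; move=> [] // -> ->.
Qed.

Lemma upair_upper i j : i != j -> upair i j \in upper_pairs n.
Proof.
rewrite inE /upair; case: ifP => //= ij; rewrite ltn_neqAle leqNgt ij andbT.
by rewrite eq_sym.
Qed.

Lemma card_star i S : #|star i S| = #|S|.
Proof. by rewrite card_imset //; exact: upair_inj. Qed.

Lemma star_upper i S : i \notin S -> star i S \subset upper_pairs n.
Proof.
move=> iS; apply/fintype.subsetP => e /imsetP [j jS ->]; apply: upair_upper.
by apply: contraNneq iS => ->.
Qed.

Lemma touching_upper i S : touching i S \subset upper_pairs n.
Proof. by apply/fintype.subsetP => e; rewrite inE => /andP[]. Qed.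

Lemma card_touching i S : (#|touching i S| <= #|S| * n)%N.
Proof.
have -> : (#|S| * n = #|finset.setX S [set: 'I_n]%SET|)%N by rewrite cardsX cardsT card_ord.
have sub : touching i S \subset [set upair e.1 e.2 | e in finset.setX S [set: 'I_n]]%SET.
  apply/fintype.subsetP => -[a b]; rewrite !inE /= => /andP[ab /and3P[/orP[h|h] _ _]].
    by apply/imsetP; exists (a, b); rewrite ?inE ?h //= /upair ab.
  apply/imsetP; exists (b, a); rewrite ?inE ?h //= /upair.
  by rewrite ltnNge (ltnW ab).
by apply: leq_trans (subset_leq_card sub) _; exact: leq_imset_card.
Qed.

Lemma star_touching_disjoint i S S' : star i S :&: touching i S' = finset.set0.
Proof.
apply/finset.setP => e; rewrite !inE; apply/negP => /andP[/imsetP [j _ ->]].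
by rewrite /upair; case: ifP => _ /=; rewrite eqxx ?andbF.
Qed.

Lemma sum_card_pairs (S : {set 'I_n}) (F : rel 'I_n) :
  (\sum_(j in S) #|[set k | F j k]%SET| = #|[set e | (e.1 \in S) && F e.1 e.2]%SET|)%N.
Proof.
transitivity (\sum_(j in S) \sum_(k | F j k) 1)%N.
  by apply: eq_bigr => j _; rewrite sum1_card; apply: eq_card => k; rewrite inE.
rewrite pair_big_dep /= -sum1_card.
by apply: eq_bigl => e; rewrite inE.
Qed.

(** Apart from the step back to [i], a path of length two from [i] uses an edge
    touching the neighbourhood of [i], and each such edge is used at most twice,
    once in each direction. *)
Lemma two_paths_le (g : rel 'I_n) i : symmetric g -> irreflexive g ->
  (\sum_(j | g i j) #|[set k | g j k]%SET|
   <= #|[set j | g i j]%SET| +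
      2 * #|[set e in touching i [set j | g i j] | g e.1 e.2]%SET|)%N.
Proof.
move=> gs gi; set S := [set j | g i j]%SET.
set C := [set e in touching i S | g e.1 e.2]%SET.
rewrite (eq_bigl (fun j => j \in S)); last by move=> j; rewrite inE.
have deg j : j \in S -> (#|[set k | g j k]%SET| = 1 + (#|[set k | [&& k != i, g j k & j < k]]%SET| +
     #|[set k | [&& k != i, g j k & k < j]]%SET|))%N.
  rewrite inE => gij.
  rewrite (cardsD1 i) inE gs gij; congr (_ + _)%N.
  rewrite -(cardsID [set k : 'I_n | (j < k)%N]%SET); congr (_ + _)%N; apply: eq_card => k; rewrite !inE.
    by rewrite -andbA.
  rewrite -leqNgt leq_eqVlt; case: (eqVneq (val k) (val j)) => [/val_inj ->|_] //=.
    by rewrite gi ltnn !andbF.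
  by rewrite andbC -andbA.
rewrite (eq_bigr _ deg) big_split /= sum1_card leq_add2l big_split /= mul2n -addnn.
apply: leq_add; rewrite sum_card_pairs.
  apply: subset_leq_card; apply/fintype.subsetP => -[a b]; rewrite !inE /=.
  move=> /andP[ia /and3P[bi gab ab]]; rewrite ab gab ia /= bi !andbT.
  by apply: contraTneq ia => ->; rewrite gi.
have sw : injective (fun e : 'I_n * 'I_n => (e.2, e.1)) by move=> [a b] [a' b'] [-> ->].
rewrite -(card_imset _ sw); apply: subset_leq_card.
apply/fintype.subsetP => e /imsetP [[a b]]; rewrite !inE /=.
move=> /andP[ia /and3P[bi gab ba]] -> /=; rewrite ba (gs b) gab ia /= bi orbT !andbT /=.
by apply: contraTneq ia => ->; rewrite gi.
Qed.

End TwoPaths.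

Section LightNorm.
Variable R : realType.

(** By Cauchy-Schwarz [qf A v] is at most the product of the norms of [v] and
    [A v], and the latter is controlled by the row sums of the square of the
    adjacency matrix, which count paths of length two. *)
Lemma qf_le_two_paths n (A : 'M[R]_n) (g : rel 'I_n) (h c : R) :
  symmetric g -> 0 < c -> 0 <= h ->
  (forall i j, `|A i j| <= h * (g i j)%:R) ->
  (forall i, (\sum_(j | g i j) #|[set k | g j k]%SET|)%:R <= c ^+ 2) ->
  forall v, qf A v <= h * c * sqn v.
Proof.
move=> gs c0 h0 Ah N v.
pose X i j : R := (g i j)%:R.
have X0 i j : 0 <= X i j by rewrite ler0n.
have Xs i j : X i j = X j i by rewrite /X gs.
pose y i := \sum_j X i j * `|v j|.
have h1 : qf A v <= h * \sum_i `|v i| * y i.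
  rewrite /qf mulr_sumr; apply: ler_sum => i _.
  rewrite /y mulr_sumr mulr_sumr; apply: ler_sum => j _.
  apply: le_trans (ler_norm _) _; rewrite !normrM.
  have := ler_wpM2r (mulr_ge0 (normr_ge0 (v i)) (normr_ge0 (v j))) (Ah i j).
  by rewrite -/(X i j); lra.
have h2 : \sum_i y i ^+ 2 <= c ^+ 2 * sqn v.
  have e1 i : y i ^+ 2 <= \sum_j \sum_k X i j * X i k * ((v j ^+ 2 + v k ^+ 2) / 2).
    rewrite expr2 {1}/y mulr_suml; apply: ler_sum => j _.
    rewrite /y mulr_sumr; apply: ler_sum => k _.
    have -> : X i j * `|v j| * (X i k * `|v k|) = X i j * X i k * (`|v j| * `|v k|) by ring.
    apply: ler_wpM2l; first exact: mulr_ge0.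
    have := sqr_ge0 (`|v j| - `|v k|).
    rewrite -(real_normK (num_real (v j))) -(real_normK (num_real (v k))); lra.
  apply: le_trans (ler_sum _ (fun i _ => e1 i)) _.
  have -> : \sum_i \sum_j \sum_k X i j * X i k * ((v j ^+ 2 + v k ^+ 2) / 2)
     = \sum_i \sum_j \sum_k X i j * X i k * v j ^+ 2.
    pose F i j k := X i j * X i k * v j ^+ 2 / 2.
    transitivity (\sum_i (\sum_j \sum_k F i j k + \sum_j \sum_k F i k j)).
      apply: eq_bigr => i _; rewrite -big_split; apply: eq_bigr => j _ /=.
      by rewrite -big_split; apply: eq_bigr => k _ /=; rewrite /F; ring.
    apply: eq_bigr => i _; rewrite [X in _ + X]exchange_big /= -big_split.
    apply: eq_bigr => j _ /=; rewrite -big_split; apply: eq_bigr => k _ /=.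
    by rewrite /F; lra.
  rewrite exchange_big /sqn mulr_sumr; apply: ler_sum => j _ /=.
  have -> : \sum_i \sum_k X i j * X i k * v j ^+ 2 =
            (\sum_i X j i * \sum_k X i k) * v j ^+ 2.
    rewrite mulr_suml; apply: eq_bigr => i _.
    by rewrite mulr_sumr mulr_suml; apply: eq_bigr => k _; rewrite Xs.
  apply: ler_wpM2r; first exact: sqr_ge0.
  apply: le_trans _ (N j); rewrite natr_sum [X in _ <= X]big_mkcond /=.
  rewrite le_eqVlt; apply/orP; left; apply/eqP; apply: eq_bigr => i _.
  rewrite /X; case: (g j i); rewrite ?mul0r // mul1r -natr_sum; congr _%:R.
  rewrite -sum1_card [RHS]big_mkcond; apply: eq_bigr => k _; rewrite inE.
  by case: (g i k).
have h3 : \sum_i `|v i| * y i <= c * sqn v.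
  have e2 i : `|v i| * y i <= (c * v i ^+ 2 + c^-1 * y i ^+ 2) / 2.
    have cc : c * c^-1 = 1 by rewrite divff // gt_eqF.
    have cv : 0 <= c^-1 by rewrite invr_ge0 ltW.
    have := mulr_ge0 cv (sqr_ge0 (c * `|v i| - y i)).
    have -> : c^-1 * (c * `|v i| - y i) ^+ 2 =
      (c * c^-1) * c * `|v i| ^+ 2 - 2 * (c * c^-1) * (`|v i| * y i) + c^-1 * y i ^+ 2 by ring.
    by rewrite cc real_normK ?num_real //; lra.
  apply: le_trans (ler_sum _ (fun i _ => e2 i)) _.
  rewrite -mulr_suml big_split /= -!mulr_sumr -/(sqn v).
  have := ler_wpM2l (_ : 0 <= c^-1) h2; rewrite invr_ge0 (ltW c0) => /(_ isT).
  have -> : c^-1 * (c ^+ 2 * sqn v) = c * sqn v.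
    by rewrite mulrA expr2 mulrA mulVf ?gt_eqF // mul1r.
  lra.
by apply: le_trans h1 _; rewrite -mulrA ler_wpM2l.
Qed.

End LightNorm.

Section LightProb.
Context d (T : measurableType d) (R : realType) (P : probability T R).
Variables (n : nat) (p : R) (mu : probability R R).
Variables (G : 'I_n * 'I_n -> {RV P >-> bool}) (Y : 'I_n * 'I_n -> {RV P >-> R}).
Hypothesis er : erdos_renyi P p G.
Hypothesis iid : iid_symmetric P mu Y.
Hypothesis ind : independent_families P G Y.
Hypothesis p0 : 0 <= p.

Definition present (W : {set 'I_n * 'I_n}) : set T := edge_event G Y W (fun=> setT).

Lemma measurable_present W : measurable (present W).
Proof. exact: measurable_edge_event. Qed.

Lemma pr_present (W : {set 'I_n * 'I_n}) : W \subset upper_pairs n -> pr P (present W) = p ^+ #|W|.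
Proof.
move=> WU; rewrite (pr_edge_event er iid ind) //.
by rewrite -prodr_const; apply: eq_bigr => e _; rewrite probability_setT mulr1.
Qed.

Lemma presentP (W : {set 'I_n * 'I_n}) (w : T) : present W w <-> (forall e, e \in W -> G e w).
Proof. by split => [h e /h[]|h e eW] //; split => //; exact: h. Qed.

Lemma er_symE i j w : G (upair i j) w = G (i, j) w.
Proof. by rewrite /upair; case: ifP => // _; rewrite (er_sym er). Qed.

(** Many paths of length two from [i] force either [a0] neighbours, or fewer
    neighbours which meet at least [b] further edges.  Both are unions over
    configurations of prescribed distinct edges.  The exceptional set is returned
    explicitly, as a finite union of such configurations, which makes it
    measurable. *)
Lemma many_two_paths a0 b : exists2 L : set T,
  measurable L /\
  pr P L <= n%:R * (expR (n%:R * (expR 1 * p) - a0%:R)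
     + expR (n%:R * p) * expR ((a0 * n)%:R * (expR 1 * p) - b%:R)) &
  forall w, ~ L w -> forall i,
    (\sum_(j | G (i, j) w) #|[set k | G (j, k) w]%SET| <= a0 + 2 * b)%N.
Proof.
(* [Q1]: a star with [a0] leaves; [Q2]: the exact neighbourhood and [b] further edges *)
pose Q1 (x : 'I_n * {set 'I_n}) := (x.1 \notin x.2) && (#|x.2| == a0).
pose A1 (x : 'I_n * {set 'I_n}) := present (star x.1 x.2).
pose Q2 (x : 'I_n * ({set 'I_n} * {set 'I_n * 'I_n})) :=
  ((x.1 \notin x.2.1) && (#|x.2.1| < a0)%N) &&
  ((x.2.2 \subset touching x.1 x.2.1) && (#|x.2.2| == b)).
pose A2 (x : 'I_n * ({set 'I_n} * {set 'I_n * 'I_n})) := present (star x.1 x.2.1 :|: x.2.2).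
have [m1 b1] := pr_bigU P (index_enum _) Q1 (fun x => measurable_present (star x.1 x.2)).
have [m2 b2] := pr_bigU P (index_enum _) Q2 (fun x => measurable_present (star x.1 x.2.1 :|: x.2.2)).
exists ((\big[setU/set0]_(x | Q1 x) A1 x) `|` (\big[setU/set0]_(x | Q2 x) A2 x)).
  split; first exact: measurableU.
  apply: le_trans (pr_setU P m1 m2) _.
  rewrite mulrDr; apply: lerD.
    apply: le_trans b1 _.
    rewrite (eq_bigr (fun x : 'I_n * {set 'I_n} => p ^+ #|x.2|)); last first.
      by move=> x /andP[x1 _]; rewrite pr_present ?star_upper // card_star.
    rewrite -(pair_big_dep predT (fun (i : 'I_n) (S : {set 'I_n}) => (i \notin S) && (#|S| == a0))
       (fun i (S : {set 'I_n}) => p ^+ #|S|)) /=.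
    rewrite mulr_natl -[n in _ *+ n]card_ord -sumr_const; apply: ler_sum => i _.
    have := @sum_subsets_card_le R _ [set: 'I_n]%SET a0 p p0.
    rewrite cardsT card_ord; apply: le_trans.
    rewrite [X in X <= _]big_mkcond [X in _ <= X]big_mkcond /=; apply: ler_sum => S _.
    rewrite finset.subsetT /=; case: ifP => [/andP[_ ->]//|_].
    by case: ifP => // _; rewrite exprn_ge0.
  apply: le_trans b2 _.
  rewrite (eq_bigr (fun x : 'I_n * ({set 'I_n} * {set 'I_n * 'I_n}) => p ^+ #|x.2.1| * p ^+ #|x.2.2|)); last first.
    move=> x /andP[/andP[x1 _] /andP[x2 _]]; rewrite pr_present; last first.
      rewrite finset.subUset star_upper //=; apply: fintype.subset_trans x2 _.
      exact: touching_upper.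
    rewrite cardsU (_ : _ :&: _ = finset.set0) ?cards0 ?subn0 ?card_star ?exprD //.
    apply/eqP; rewrite -finset.subset0 -(star_touching_disjoint x.1 x.2.1 x.2.1).
    exact: finset.setIS.
  rewrite -(pair_big_dep predT (fun i y => Q2 (i, y))
     (fun i (y : {set 'I_n} * {set 'I_n * 'I_n}) => p ^+ #|y.1| * p ^+ #|y.2|)) /=.
  rewrite mulr_natl -[n in _ *+ n]card_ord -sumr_const; apply: ler_sum => i _.
  rewrite -(pair_big_dep (fun S : {set 'I_n} => (i \notin S) && (#|S| < a0)%N)
     (fun (S : {set 'I_n}) (W : {set 'I_n * 'I_n}) => (W \subset touching i S) && (#|W| == b))
     (fun (S : {set 'I_n}) (W : {set 'I_n * 'I_n}) => p ^+ #|S| * p ^+ #|W|)) /=.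
  have := @sum_subsets_le R _ [set: 'I_n]%SET p p0.
  rewrite cardsT card_ord => /(ler_wpM2r (expR_ge0 ((a0 * n)%:R * (expR 1 * p) - b%:R))).
  apply: le_trans.
  rewrite mulr_suml [X in X <= _]big_mkcond [X in _ <= X]big_mkcond /=; apply: ler_sum => S _.
  rewrite finset.subsetT /=; case: ifP => [/andP[_ Sa]|_]; last first.
    by rewrite mulr_ge0 ?expR_ge0 ?exprn_ge0.
  rewrite -mulr_sumr; apply: ler_wpM2l; first by rewrite exprn_ge0.
  apply: le_trans (sum_subsets_card_le _ _ p0) _.
  rewrite ler_expR lerB // ler_wpM2r ?mulr_ge0 ?expR_ge0 // ler_nat.
  by apply: leq_trans (card_touching _ _) _; rewrite leq_mul2r (ltnW Sa) orbT.
move=> w nL i; rewrite leqNgt; apply/negP => big; apply: nL.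
pose g : rel 'I_n := fun i j => G (i, j) w.
have gs : symmetric g by move=> x y; exact: (er_sym er).
have gi : irreflexive g by move=> x; exact: (er_irrefl er).
pose S := [set j | g i j]%SET.
have iS : i \notin S by rewrite inE gi.
have Sg e : e \in star i S -> G e w.
  by move=> /imsetP [j]; rewrite inE => gij ->; rewrite er_symE.
have [Sa|Sa] := leqP a0 #|S|.
  have [S' S'S S'c] := subset_of_card Sa.
  left; rewrite (bigD1 (i, S')) /=; last first.
    by rewrite /Q1 /= S'c eqxx andbT; apply: contra iS; apply: (fintype.subsetP S'S).
  left; apply/presentP => e /imsetP [j jS' ->]; rewrite er_symE.
  by have := fintype.subsetP S'S _ jS'; rewrite inE.
have := two_paths_le i gs gi; rewrite -/S => h.
have cb : (b <= #|[set e in touching i S | g e.1 e.2]%SET|)%N.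
  by move: (leq_trans big h) Sa; lia.
have [W Wsub Wc] := subset_of_card cb.
have Wt : W \subset touching i S.
  by apply: fintype.subset_trans Wsub _; apply/fintype.subsetP => e; rewrite inE => /andP[].
right; rewrite (bigD1 (i, (S, W))) /=; last by rewrite /Q2 /= iS Sa Wt Wc eqxx.
left; apply/presentP => e; rewrite inE => /orP[|eW]; first exact: Sg.
have := fintype.subsetP Wsub _ eW; rewrite inE => /andP[_].
by rewrite /g -surjective_pairing.
Qed.

End LightProb.

(** * Connected vertex sets *)

Section Connected.
Variables (n : nat) (g : rel 'I_n).
Implicit Types (C K S : {set 'I_n}).

Definition gedges S : {set 'I_n * 'I_n} :=
  [set e in upper_pairs n | [&& e.1 \in S, e.2 \in S & g e.1 e.2]].

(** Connectivity as the absence of an empty cut, the form needed to enlarge a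
    vertex set one vertex at a time. *)
Definition connected_set C := forall S, S \subset C -> S != finset.set0 -> S != C ->
  exists x y, [/\ x \in S, y \in C :\: S & g x y].

Lemma gedgesS S S' : S \subset S' -> gedges S \subset gedges S'.
Proof.
move=> /fintype.subsetP SS; apply/fintype.subsetP => e; rewrite !inE.
by move=> /and4P[-> /SS -> /SS -> ->].
Qed.

Hypothesis gs : symmetric g.

Lemma gedgesU1 S x y : x \in S -> y \notin S -> g x y ->
  (#|gedges S| < #|gedges (y |: S)|)%N.
Proof.
move=> xS yS gxy; apply: proper_card; apply/properP; split.
  by apply: gedgesS; exact: finset.subsetUr.
have xy : x != y by apply: contraNneq yS => <-.
exists (upair x y); rewrite inE ?upair_upper //=.
  by rewrite /upair; case: ifP => _ /=; rewrite !inE xS eqxx ?orbT //= gs.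
by rewrite /upair; case: ifP => _ /=; rewrite (negPf yS) ?andbF.
Qed.

(** Every vertex added along the cut brings at least one new edge. *)
Lemma connected_grow C K j : connected_set C -> K \subset C -> K != finset.set0 ->
  (#|K| + j <= #|C|)%N ->
  exists S, [/\ K \subset S, S \subset C, #|S| = (#|K| + j)%N &
                (#|gedges K| + j <= #|gedges S|)%N].
Proof.
move=> cC KC K0; elim: j => [|j IH] hj.
  by exists K; rewrite !addn0.
have [|S [KS SC cS eS]] := IH; first by apply: leq_trans hj; rewrite addnS.
have S0 : S != finset.set0.
  by apply: contraNneq K0 => S0; rewrite -finset.subset0 -S0.
have SneC : S != C by apply: contraTneq hj => <-; rewrite cS addnS ltnn.
have [x [y [xS]]] := cC S SC S0 SneC.
rewrite inE => /andP[yS yC gxy].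
exists (y |: S); split.
- by apply: fintype.subset_trans KS _; exact: finset.subsetUr.
- by rewrite finset.subUset finset.sub1set yC SC.
- by rewrite cardsU1 yS cS addnS.
- by rewrite addnS; apply: leq_ltn_trans eS (gedgesU1 xS yS gxy).
Qed.

(** The excess of edges over vertices does not decrease from [K] to [C].  For a
    single vertex this is the edge count of a spanning tree; for a clique on k
    vertices it gives an excess of at least k (k - 3) / 2. *)
Lemma connected_card_edges C K : connected_set C -> K \subset C -> K != finset.set0 ->
  (#|gedges K| + #|C| <= #|gedges C| + #|K|)%N.
Proof.
move=> cC KC K0; have hK := subset_leq_card KC.
have [|S [KS SC cS eS]] := @connected_grow C K (#|C| - #|K|) cC KC K0; first by rewrite subnKC.
have -> : C = S.
  by apply/eqP; rewrite eq_sym eqEcard SC cS subnKC //=.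
by move: eS cS; lia.
Qed.

Lemma connected_root r : connected_set [set j | fingraph.root g j == r]%SET.
Proof.
have cs : connect_sym g by exact: sym_connect_sym.
move=> S SC /set0Pn [x xS] SneC.
have /fintype.subsetPn [y yC yS] : ~~ ([set j | fingraph.root g j == r]%SET \subset S).
  by apply: contra SneC => CS; rewrite finset.eqEsubset SC.
apply/not_existsP => noedge.
have cl : fingraph.closed g (mem S).
  apply: intro_closed => // u v guv uS; apply/negPn/negP => vS.
  apply: (noedge u); exists v; split=> //; rewrite inE vS inE.
  have /(fintype.subsetP SC) : u \in S by [].
  rewrite inE => /eqP <-; rewrite eq_sym; rewrite root_connect //; exact: connect1.
have xC := fintype.subsetP SC _ xS.
have cxy : connect g x y.
  by rewrite -root_connect //; move: xC yC; rewrite !inE => /eqP -> /eqP ->.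
have h : (x \in S) = (y \in S) := closed_connect cl cxy.
by move: h; rewrite xS (negPf yS).
Qed.

End Connected.

Section Localize.
Variable R : realType.

(** Both the quadratic form and the squared norm split over the connected
    components, so some component must do at least as well as the whole. *)
Lemma localize n (B : 'M[R]_n) (g : rel 'I_n) (t : R) (v : 'I_n -> R) :
  symmetric g -> (forall i j, ~~ g i j -> B i j = 0) ->
  0 < sqn v -> t * sqn v <= qf B v ->
  exists C : {set 'I_n}, connected_set g C /\
  exists u, [/\ sqn u = 1, forall i, i \notin C -> u i = 0 & t <= qf B u].
Proof.
move=> gs Bg v0 hv.
pose rt := fingraph.root g.
have cs : connect_sym g by exact: sym_connect_sym.
(* the restriction of [v] to the component with root [r] *)
pose ur r i := if rt i == r then v i else 0.
have sE : sqn v = \sum_r sqn (ur r).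
  rewrite /sqn /ur [RHS]exchange_big /=; apply: eq_bigr => i _.
  rewrite (bigD1 (rt i)) //= big1 ?addr0 ?eqxx // => r /negPf.
  by rewrite (eq_sym r) => ->; rewrite expr0n.
have qE : qf B v = \sum_r qf B (ur r).
  rewrite /qf /ur [RHS]exchange_big /=; apply: eq_bigr => i _.
  rewrite [RHS]exchange_big /=; apply: eq_bigr => j _.
  rewrite (bigD1 (rt i)) //= big1 ?addr0 ?eqxx; last first.
    by move=> r /negPf; rewrite (eq_sym r) => ->; rewrite mulr0 mul0r.
  case: eqP => // /eqP ij; rewrite Bg ?mul0r //.
  apply: contra ij => gij; rewrite eq_sym /rt root_connect //; exact: connect1.
have [r [r0 hr]] : exists r, 0 < sqn (ur r) /\ t * sqn (ur r) <= qf B (ur r).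
  apply/not_existsP => no.
  have lt r : 0 < sqn (ur r) -> qf B (ur r) < t * sqn (ur r).
    by move=> h; rewrite ltNge; apply/negP => h2; apply: (no r).
  have le r : qf B (ur r) <= t * sqn (ur r).
    have [h|h] := ltP 0 (sqn (ur r)); first exact/ltW/lt.
    have e0 : sqn (ur r) = 0 by apply/eqP; rewrite eq_le h sqn_ge0.
    rewrite e0 mulr0 /qf big1 // => i _; rewrite big1 // => j _.
    by rewrite (sqn_eq0 j e0) mulr0.
  have [r r0] : exists r, 0 < sqn (ur r).
    apply/not_existsP => no2; move: v0; rewrite sE big1 ?ltxx // => r _.
    by apply/eqP; rewrite eq_le sqn_ge0 leNgt andbT; apply/negP => /no2.
  move: hv; rewrite leNgt => /negP; apply.
  rewrite sE qE mulr_sumr (bigD1 r) //= [X in _ < X](bigD1 r) //=.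
  by apply: ltr_leD; [exact: lt | apply: ler_sum => k _; exact: le].
exists [set j | rt j == r]%SET; split; first exact: connected_root.
pose c := (Num.sqrt (sqn (ur r)))^-1.
have c2 : c ^+ 2 * sqn (ur r) = 1.
  by rewrite exprVn sqr_sqrtr ?sqn_ge0 // mulVf // gt_eqF.
exists (fun i => c * ur r i); split.
- by rewrite sqnZ c2.
- by move=> i; rewrite inE /ur => /negPf ->; rewrite mulr0.
- rewrite qfZ; have := ler_wpM2l (sqr_ge0 c) hr.
  by rewrite mulrCA c2 mulr1.
Qed.

End Localize.

(** * Sums of powers and sums over edges *)

Section PowerSums.
Variable R : realType.

Lemma powR_superadd (x y th : R) : 0 <= x -> 0 <= y -> 1 <= th ->
  x `^ th + y `^ th <= (x + y) `^ th.
Proof.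
move=> x0 y0 th1; have th0 : 0 < th by lra.
have th2 : 0 <= th - 1 by lra.
rewrite -(mulr_powRB1 x0 th0) -(mulr_powRB1 y0 th0) -(mulr_powRB1 (addr_ge0 x0 y0) th0).
rewrite mulrDl; apply: lerD; apply: ler_wpM2l => //; apply: ge0_ler_powR => //.
- by rewrite nnegrE addr_ge0.
- by rewrite lerDl.
- by rewrite nnegrE addr_ge0.
- by rewrite lerDr.
Qed.

(** After normalising the sum to 1 every term is at most 1, hence at most its
    power. *)
Lemma powR_sum_le (I : finType) (Q : pred I) (x : I -> R) (al : R) :
  0 < al -> al <= 1 -> (forall i, 0 <= x i) ->
  (\sum_(i | Q i) x i) `^ al <= \sum_(i | Q i) x i `^ al.
Proof.
move=> al0 al1 x0; set s := \sum_(i | Q i) x i.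
have s0 : 0 <= s by apply: sumr_ge0.
have [sE|sN] := eqVneq s 0.
  by rewrite sE powR0 ?gt_eqF //; apply: sumr_ge0 => i _; exact: powR_ge0.
have sp : 0 < s by rewrite lt_def sN.
have -> : s `^ al = \sum_(i | Q i) (x i / s) * s `^ al.
  by rewrite -!mulr_suml divff // mul1r.
apply: ler_sum => i Qi.
have xs : x i <= s by rewrite /s (bigD1 i) //= lerDl; apply: sumr_ge0.
have [xE|xN] := eqVneq (x i) 0; first by rewrite xE mul0r mul0r powR_ge0.
have xp : 0 < x i by rewrite lt_def xN x0.
rewrite -{2}(divfK sN (x i)) powRM ?divr_ge0 //.
apply: ler_wpM2r; first exact: powR_ge0.
by apply: ger1_powR => //; rewrite divr_gt0 //= ler_pdivrMr // mul1r.
Qed.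

Lemma powRV_gt0 (z r : R) : 0 < z -> z^-1 `^ r = (z `^ r)^-1.
Proof.
move=> z0; apply: (mulIf (lt0r_neq0 (powR_gt0 r z0))).
rewrite -powRM ?invr_ge0 ?(ltW z0) // mulVf ?gt_eqF // mulVf ?gt_eqF ?powR_gt0 //.
by rewrite powR1.
Qed.

(** Young's inequality applied to the normalised terms. *)
Lemma hoelder_sum (I : finType) (Q : pred I) (a b : I -> R) (p q : R) :
  0 < p -> 0 < q -> p^-1 + q^-1 = 1 ->
  (forall i, 0 <= a i) -> (forall i, 0 <= b i) ->
  \sum_(i | Q i) a i * b i <=
  (\sum_(i | Q i) a i `^ p) `^ p^-1 * (\sum_(i | Q i) b i `^ q) `^ q^-1.
Proof.
move=> p0 q0 pq a0 b0.
set A := \sum_(i | Q i) a i `^ p; set B := \sum_(i | Q i) b i `^ q.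
have A0 : 0 <= A by apply: sumr_ge0 => i _; exact: powR_ge0.
have B0 : 0 <= B by apply: sumr_ge0 => i _; exact: powR_ge0.
have zero (c : I -> R) r : \sum_(i | Q i) c i `^ r = 0 -> forall i, Q i -> c i = 0.
  move=> /eqP; rewrite psumr_eq0 => [|i _]; last exact: powR_ge0.
  move=> /allP h i Qi; have := h i (mem_index_enum _); rewrite Qi /=.
  by move=> /eqP; exact: powR_eq0_eq0.
have [AE|AN] := eqVneq A 0.
  rewrite big1 ?mulr_ge0 ?powR_ge0 // => i Qi.
  by rewrite (zero _ _ AE i Qi) mul0r.
have [BE|BN] := eqVneq B 0.
  rewrite big1 ?mulr_ge0 ?powR_ge0 // => i Qi.
  by rewrite (zero _ _ BE i Qi) mulr0.
have Ap : 0 < A by rewrite lt_def AN.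
have Bp : 0 < B by rewrite lt_def BN.
set x := A `^ p^-1; set y := B `^ q^-1.
have xp : 0 < x by exact: powR_gt0.
have yp : 0 < y by exact: powR_gt0.
have xA : x `^ p = A by rewrite /x -powRrM mulVf ?gt_eqF // powRr1.
have yB : y `^ q = B by rewrite /y -powRrM mulVf ?gt_eqF // powRr1.
clearbody x y.
have young i : a i * b i <= x * y * (a i `^ p / A / p + b i `^ q / B / q).
  have := conjugate_powR (divr_ge0 (a0 i) (ltW xp)) (divr_ge0 (b0 i) (ltW yp)) p0 q0 pq.
  rewrite (powRM _ (a0 i)) ?invr_ge0 ?(ltW xp) // powRV_gt0 // xA.
  rewrite (powRM _ (b0 i)) ?invr_ge0 ?(ltW yp) // powRV_gt0 // yB => h.
  have := ler_wpM2l (mulr_ge0 (ltW xp) (ltW yp)) h.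
  apply: le_trans; rewrite le_eqVlt; apply/orP; left; apply/eqP.
  by field; rewrite !gt_eqF.
apply: le_trans (ler_sum _ (fun i _ => young i)) _.
rewrite -mulr_sumr ger_pMr ?mulr_gt0 // big_split /= -!mulr_suml -/A -/B.
by rewrite !divff // !mul1r pq.
Qed.

End PowerSums.

Section SymmetricSums.
Variables (R : realType) (n : nat).

Lemma sum_sym_pairs (F : 'I_n -> 'I_n -> R) :
  (forall i j, F i j = F j i) -> (forall i, F i i = 0) ->
  \sum_i \sum_j F i j = 2 * \sum_(e in upper_pairs n) F e.1 e.2.
Proof.
move=> Fs F0; rewrite pair_big /=.
rewrite (bigID (fun e : 'I_n * 'I_n => (e.1 < e.2)%N)) /=.
have -> : \sum_(e : 'I_n * 'I_n | ~~ (e.1 < e.2)%N) F e.1 e.2 =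
    \sum_(e : 'I_n * 'I_n | (e.1 < e.2)%N) F e.1 e.2.
  rewrite (bigID (fun e : 'I_n * 'I_n => e.1 == e.2)) /= big1 ?add0r; last first.
    by move=> e /andP[_ /eqP ->].
  rewrite (reindex_inj (h := fun e : 'I_n * 'I_n => (e.2, e.1))) /=; last first.
    by move=> [a b] [a' b'] [-> ->].
  apply: eq_big => [e|e _]; last by rewrite Fs.
  by rewrite -leqNgt ltn_neqAle eq_sym andbC.
rewrite mulrDl mul1r; congr (_ + _); apply: eq_bigl => e; by rewrite inE.
Qed.

(** Symmetry folds the double sum onto upper pairs, which is how the edges of the
    graph are indexed. *)
Lemma sum_edges (F : 'I_n -> 'I_n -> R) (g : rel 'I_n) (C : {set 'I_n}) :
  (forall i j, F i j = F j i) -> irreflexive g ->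
  (forall i j, ~~ [&& i \in C, j \in C & g i j] -> F i j = 0) ->
  \sum_i \sum_j F i j = 2 * \sum_(e in gedges g C) F e.1 e.2.
Proof.
move=> Fs gi F0; rewrite sum_sym_pairs // => [|i]; last by rewrite F0 // gi !andbF.
congr (2 * _); rewrite [RHS](eq_bigl (fun e => (e \in upper_pairs n) &&
  [&& e.1 \in C, e.2 \in C & g e.1 e.2])); last by move=> e; rewrite inE.
rewrite [RHS]big_mkcondr; apply: eq_bigr => e _.
by case: ifPn => // /F0.
Qed.

Lemma card_clique_edges (g : rel 'I_n) (K : {set 'I_n}) :
  symmetric g -> irreflexive g ->
  (forall i j, i \in K -> j \in K -> i != j -> g i j) ->
  2 * #|gedges g K|%:R = #|K|%:R * (#|K|%:R - 1) :> R.
Proof.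
move=> gs gi cl.
pose F (i j : 'I_n) : R := [&& i \in K, j \in K & g i j]%:R.
have := @sum_edges F g K; rewrite /F.
rewrite [X in 2 * X](eq_bigr (fun=> 1)); last by move=> e; rewrite inE => /andP[_ ->].
rewrite sumr_const => <- //; last first.
- by move=> i j /negPf ->.
- by move=> i j; rewrite gs; case: (i \in K); case: (j \in K).
transitivity (\sum_(i in K) \sum_(j in K) (i != j)%:R : R).
  rewrite [RHS]big_mkcond; apply: eq_bigr => i _ /=.
  case: ifPn => iK; last by rewrite big1 // => j _.
  rewrite [RHS]big_mkcond; apply: eq_bigr => j _ /=.
  case: ifPn => // jK; case: eqVneq => [->|ij]; first by rewrite gi.
  by rewrite cl.
rewrite (eq_bigr (fun=> #|K|%:R - 1)) => [|i iK].
  by rewrite sumr_const mulr_natl.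
rewrite (bigD1 i) //= eqxx add0r (eq_bigr (fun=> 1)); last first.
  by move=> j /andP[_]; rewrite eq_sym => ->.
rewrite sumr_const.
have := cardsD1 i K; rewrite iK => ->; rewrite natrD [X in _ = X - _]addrC addrK.
by congr _%:R; apply: eq_card => j; rewrite !inE andbC.
Qed.

End SymmetricSums.

(** * Pair sums on the simplex and cliques *)

Section Phi.
Variable R : realType.

(** The function whose supremum over the unit sphere of the l1 norm is [phi]. *)
Definition pairsum (th : R) (k : nat) (v : 'rV[R]_k) : R :=
  \sum_(i < k) \sum_(j < k | i != j) `|v 0 i| `^ th * `|v 0 j| `^ th.

Lemma pairsum_le1 (th : R) k (v : 'rV[R]_k) : 1 <= th -> norm1 v = 1 -> pairsum th v <= 1.
Proof.
move=> th1 v1.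
have vi i : `|v 0 i| <= 1.
  by rewrite -v1 /norm1 (bigD1 i) //= lerDl sumr_ge0.
have pw i : `|v 0 i| `^ th <= `|v 0 i|.
  have [->|vN] := eqVneq `|v 0 i| 0; first by rewrite powR0 //; lra.
  by apply: ge1r_powR => //; rewrite vi lt_def vN normr_ge0.
have -> : 1 = \sum_i \sum_j `|v 0 i| * `|v 0 j|.
  rewrite -[LHS](mulr1 1) -{1}v1 -v1 /norm1 mulr_suml.
  by apply: eq_bigr => i _; rewrite mulr_sumr.
apply: ler_sum => i _; rewrite big_mkcond /=; apply: ler_sum => j _.
case: ifP => _; last by rewrite mulr_ge0.
by apply: ler_pM => //; exact: powR_ge0.
Qed.

Lemma pairsum_le_phi (th : R) k (v : 'rV[R]_k) : 1 <= th -> norm1 v = 1 ->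
  pairsum th v <= phi th k.
Proof.
move=> th1 v1; apply: ub_le_sup; last by exists v.
by exists 1 => _ [u /= u1 <-]; exact: pairsum_le1.
Qed.

Lemma phi_approx (th : R) k (x : R) : (0 < k)%N -> 1 <= th -> x < phi th k ->
  exists2 v : 'rV[R]_k, norm1 v = 1 & x < pairsum th v.
Proof.
move=> k0 th1 /(@sup_gt R).
have ne : [set v : 'rV[R]_k | norm1 v = 1] !=set0.
  exists (delta_mx 0 (Ordinal k0)) => /=.
  rewrite /norm1 (bigD1 (Ordinal k0)) //= !mxE !eqxx normr1.
  by rewrite big1 ?addr0 // => i /negPf i0; rewrite !mxE i0 andbF normr0.
have [v v1] := ne.
have ne2 : [set \sum_(i < k) \sum_(j < k | i != j) `|v 0 i| `^ th * `|v 0 j| `^ th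
      | v in [set v : 'rV[R]_k | norm1 v = 1]] !=set0.
  by exists (pairsum th v); exists v.
by move=> /(_ ne2) [_ [u u1 <-] h]; exists u.
Qed.

Lemma phi_gt0 (th : R) k : (2 <= k)%N -> 1 <= th -> 0 < phi th k.
Proof.
move=> k2 th1; have k0 : (0 < k)%N by apply: leq_trans k2.
have kR : (0 : R) < k%:R by rewrite ltr0n.
have v1 : norm1 (const_mx (k%:R^-1) : 'rV[R]_k) = 1.
  rewrite /norm1 (eq_bigr (fun=> k%:R^-1)) => [|i _].
    by rewrite sumr_const card_ord -[LHS]mulr_natl divff // gt_eqF.
  by rewrite mxE ger0_norm // invr_ge0 ltW.
apply: lt_le_trans (pairsum_le_phi th1 v1).
rewrite /pairsum (bigD1 (Ordinal k0)) //= (bigD1 (Ordinal k2)) //=.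
rewrite -addrA ltr_pwDl //.
  by rewrite !mxE mulr_gt0 // powR_gt0 // normr_gt0 invr_eq0 gt_eqF.
apply: addr_ge0; apply: sumr_ge0 => i _; first by rewrite mulr_ge0 ?powR_ge0.
by apply: sumr_ge0 => j _; rewrite mulr_ge0 ?powR_ge0.
Qed.

End Phi.

Section MotzkinStraus.
Variables (R : realType) (n : nat) (g : rel 'I_n) (th : R).
Hypotheses (gs : symmetric g) (gi : irreflexive g) (th1 : 1 <= th).

Definition adj : 'M[R]_n := \matrix_(i, j) (g i j)%:R.

Lemma adj_sym : adj^T = adj.
Proof. by apply/matrixP => i j; rewrite !mxE gs. Qed.

(** The sum of [(w i * w j) `^ th] over ordered adjacent pairs, written as a
    quadratic form in the powers so that it can be expanded by [qf_perturb]. *)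
Definition edge_power_sum (w : 'I_n -> R) : R := qf adj (fun i => w i `^ th).

(** For non-adjacent [i] and [j] no term of the sum involves both, so it is convex
    along transfers of mass between them and the mass of both may be put on the
    one whose neighbourhood weighs more. *)
Lemma shift_mass (w : 'I_n -> R) i j :
  (forall k, 0 <= w k) -> i != j -> ~~ g i j ->
  \sum_k adj k j * w k `^ th <= \sum_k adj k i * w k `^ th ->
  edge_power_sum w <= edge_power_sum
    (fun k => if k == i then w i + w j else if k == j then 0 else w k).
Proof.
move=> w0 ij gij PQ.
have th0 : th != 0 by rewrite gt_eqF // (lt_le_trans ltr01 th1).
set w' := fun k => _.
pose dl k : R := if k == i then (w i + w j) `^ th - w i `^ th
              else if k == j then - w j `^ th else 0.
have -> : edge_power_sum w' = qf adj (fun k => w k `^ th + 1 * dl k).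
  congr (qf adj _); apply/funext => k; rewrite /w' /dl mul1r.
  case: eqVneq => [->|ki]; first by ring.
  by case: eqVneq => [->|kj]; rewrite ?addr0 // powR0 // subrr.
rewrite qf_perturb ?adj_sym // expr1n mul1r mulr1.
set P := \sum_k adj k i * _ in PQ; set Q := \sum_k adj k j * _ in PQ.
have sumdl (F : 'I_n -> R) : \sum_k F k * dl k =
    F i * ((w i + w j) `^ th - w i `^ th) + F j * (- w j `^ th).
  rewrite (bigD1 i) //= (bigD1 j) /=; last by rewrite eq_sym.
  rewrite big1 => [|k /andP[/negPf ki /negPf kj]]; last by rewrite /dl ki kj mulr0.
  by rewrite addr0 /dl eqxx eq_sym (negPf ij) eqxx.
have -> : qf adj dl = 0.
  rewrite /qf (eq_bigr (fun k => (\sum_l adj k l * dl l) * dl k)); last first.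
    by move=> k _; rewrite mulr_suml; apply: eq_bigr => l _; ring.
  rewrite sumdl !sumdl !mxE !gi (gs j i) (negPf gij) !mulr0n; ring.
have -> : bf adj (fun k => w k `^ th) dl =
    P * ((w i + w j) `^ th - w i `^ th) - Q * w j `^ th.
  rewrite /bf exchange_big /= (eq_bigr (fun l => (\sum_k adj k l * w k `^ th) * dl l)).
    by rewrite sumdl -/P -/Q mulrN.
  by move=> l _; rewrite mulr_suml.
have sup := powR_superadd (w0 i) (w0 j) th1.
have P0 : 0 <= P.
  by apply: sumr_ge0 => k _; rewrite mulr_ge0 ?powR_ge0 // mxE ler0n.
have h1 : P * w j `^ th <= P * ((w i + w j) `^ th - w i `^ th).
  by apply: ler_wpM2l => //; lra.
have h2 : Q * w j `^ th <= P * w j `^ th by apply: ler_wpM2r => //; exact: powR_ge0.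
by rewrite -/(edge_power_sum w); lra.
Qed.

(** Transfers between non-adjacent vertices shrink the support until it is a
    clique.  This is the Motzkin-Straus argument with exponents [th >= 1] in
    place of 1. *)
Lemma motzkin_straus (w : 'I_n -> R) :
  (forall k, 0 <= w k) -> \sum_k w k = 1 ->
  exists w' : 'I_n -> R, [/\ forall k, 0 <= w' k, \sum_k w' k = 1,
    forall k, w k = 0 -> w' k = 0,
    forall i j, w' i != 0 -> w' j != 0 -> i != j -> g i j &
    edge_power_sum w <= edge_power_sum w'].
Proof.
have [m] := ubnP #|[set k | w k != 0]%SET|.
elim: m w => // m IH w; rewrite ltnS => hm w0 w1.
case: (boolP [forall i, forall j, [&& w i != 0, w j != 0 & i != j] ==> g i j]).
  move=> /forallP h; exists w; split=> // i j wi wj ij.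
  by have /forallP/(_ j) := h i; rewrite wi wj ij.
rewrite negb_forall => /existsP [i]; rewrite negb_forall => /existsP [j].
rewrite negb_imply => /andP[/and3P[wi wj ij] gij].
wlog PQ : i j wi wj ij gij / \sum_k adj k j * w k `^ th <= \sum_k adj k i * w k `^ th.
  move=> H; case/orP: (le_total (\sum_k adj k j * w k `^ th) (\sum_k adj k i * w k `^ th)).
    exact: H.
  by apply: (H j i) => //; [rewrite eq_sym | rewrite gs].
have := shift_mass w0 ij gij PQ.
set u := fun k => _ => hu.
have u0 k : 0 <= u k by rewrite /u; case: ifP => _; [exact: addr_ge0 | case: ifP].
have uw k : w k = 0 -> u k = 0.
  rewrite /u; case: eqVneq => [-> wi0|_]; first by rewrite wi0 eqxx in wi.
  by case: ifP.
have u1 : \sum_k u k = 1.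
  rewrite -w1 (bigD1 i) //= [RHS](bigD1 i) //= (bigD1 j) /=; last by rewrite eq_sym.
  rewrite [in RHS](bigD1 j) /=; last by rewrite eq_sym.
  rewrite addrA [RHS]addrA; congr (_ + _).
    by rewrite /u eqxx eq_sym (negPf ij) eqxx addr0.
  by apply: eq_bigr => k /andP[/negPf ki /negPf kj]; rewrite /u ki kj.
have [|w' [w'0 w'1 w'u w'cl w'le]] := IH u _ u0 u1.
  apply: leq_trans hm; apply: proper_card; apply/properP; split.
    apply/fintype.subsetP => k; rewrite !inE; apply: contra => /eqP wk.
    by rewrite uw.
  by exists j; rewrite !inE // negbK /u (eq_sym j) (negPf ij) eqxx.
exists w'; split=> //.
  by move=> k wk; apply: w'u; exact: uw.
exact: le_trans hu w'le.
Qed.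

Lemma edge_power_sum_clique (w : 'I_n -> R) :
  (forall k, 0 <= w k) -> \sum_k w k = 1 ->
  (forall i j, w i != 0 -> w j != 0 -> i != j -> g i j) ->
  edge_power_sum w <= phi th #|[set k | w k != 0]%SET|.
Proof.
move=> w0 w1 cl; set K := [set k | w k != 0]%SET.
have th0 : th != 0 by rewrite gt_eqF // (lt_le_trans ltr01 th1).
pose v : 'rV[R]_#|K| := \row_i w (enum_val i).
have v1 : norm1 v = 1.
  rewrite /norm1 (eq_bigr (fun i => w (enum_val i))); last by move=> i _; rewrite mxE ger0_norm.
  rewrite -(big_enum_val (fun k => w k)) -w1 big_mkcond; apply: eq_bigr => k _ /=.
  by rewrite inE; case: eqP.
apply: le_trans (pairsum_le_phi th1 v1).
rewrite /edge_power_sum /qf /pairsum.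
have z k : k \notin K -> w k `^ th = 0.
  by rewrite inE negbK => /eqP ->; rewrite powR0.
rewrite (bigID (mem K)) /= [X in _ + X]big1 ?addr0; last first.
  by move=> k kK; rewrite big1 // => l _; rewrite (z k) // mulr0 mul0r.
rewrite big_enum_val /=; apply: ler_sum => i _.
rewrite (bigID (mem K)) /= [X in _ + X]big1 ?addr0; last first.
  by move=> k kK; rewrite (z k) // mulr0.
rewrite big_enum_val /= [X in _ <= X]big_mkcond /=; apply: ler_sum => j _.
rewrite !mxE !ger0_norm //; case: eqVneq => [->|ij]; first by rewrite gi !mul0r.
rewrite -mulrA ger_pMl ?lern1 ?leq_b1 //.
have := enum_valP i; have := enum_valP j; rewrite !inE => wj wi.
by rewrite mulr_gt0 // powR_gt0 // lt_def w0 ?wi ?wj.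
Qed.

End MotzkinStraus.

(** * Energy of a large quadratic form *)

(** The duality step: [c] is the energy, [U] the sum of the conjugate powers over
    unordered pairs, hence the factors 2. *)
Lemma hoelder_cost (R : realType) (al be t c U ph : R) :
  1 < al -> al^-1 + be^-1 = 1 -> 0 < t -> 0 <= c -> 0 < U ->
  t <= 2 * (c `^ al^-1 * U `^ be^-1) -> 2 * U <= ph ->
  2^-1 * t `^ al * ph `^ (1 - al) <= c.
Proof.
move=> al1 conj t0 c0 Up h1 h2.
have al0 : 0 < al by lra.
have a1 : be^-1 * al = al - 1.
  have -> : be^-1 = 1 - al^-1 by rewrite -conj addrAC subrr add0r.
  by rewrite mulrBl mul1r mulVf // gt_eqF.
have php : 0 < ph by apply: lt_le_trans h2; rewrite mulr_gt0.
have h3 : t `^ al <= 2 `^ al * (c * U `^ (al - 1)).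
  have n2 : 0 <= c `^ al^-1 * U `^ be^-1 by rewrite mulr_ge0 ?powR_ge0.
  have := ge0_ler_powR (ltW al0) (ltW t0 : t \in Num.nneg) (mulr_ge0 (ler0n R 2) n2 : _ \in Num.nneg) h1.
  move/le_trans; apply.
  rewrite (powRM _ (ler0n R 2) n2) (powRM _ (powR_ge0 _ _) (powR_ge0 _ _)).
  by rewrite -!powRrM mulVf ?gt_eqF // (powRr1 c0) a1.
have e2 (x : R) : 0 < x -> x `^ (al - 1) * x `^ (1 - al) = 1.
  move=> x0; rewrite -powRD; last by rewrite (gt_eqF x0) implybT.
  have -> : al - 1 + (1 - al) = 0 by ring.
  exact: powRr0.
have e3 : 2 `^ al = 2 * 2 `^ (al - 1) :> R by rewrite mulr_powRB1.
have h4 : 2 `^ (al - 1) * U `^ (al - 1) <= ph `^ (al - 1).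
  rewrite -powRM ?(ltW Up) //; apply: ge0_ler_powR => //.
  - by rewrite subr_ge0 ltW.
  - by rewrite nnegrE mulr_ge0 // ltW.
  - by rewrite nnegrE ltW.
have h5 : t `^ al <= 2 * c * ph `^ (al - 1).
  apply: le_trans h3 _; rewrite e3.
  have -> : 2 * 2 `^ (al - 1) * (c * U `^ (al - 1)) =
    2 * c * (2 `^ (al - 1) * U `^ (al - 1)) by ring.
  by apply: ler_wpM2l => //; rewrite mulr_ge0.
have := ler_wpM2r (powR_ge0 ph (1 - al)) h5.
by rewrite -(mulrA (2 * c)) e2 // mulr1 -(mulrA 2^-1) ler_pdivrMl.
Qed.

Section Cost.
Variables (R : realType) (n : nat) (g : rel 'I_n) (C : {set 'I_n}) (B : 'M[R]_n).
Variables (u : 'I_n -> R) (t al : R).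
Hypotheses (gs : symmetric g) (gi : irreflexive g).
Hypotheses (Bs : forall i j, B i j = B j i) (Bg : forall i j, ~~ g i j -> B i j = 0).
Hypotheses (uC : forall i, i \notin C -> u i = 0) (u1 : sqn u = 1).
Hypotheses (t0 : 0 < t) (tq : t <= qf B u) (al0 : 0 < al).

Definition cost : R := \sum_(e in gedges g C) `|B e.1 e.2| `^ al.

Lemma qf_edges_le :
  t <= 2 * \sum_(e in gedges g C) `|B e.1 e.2| * (`|u e.1| * `|u e.2|).
Proof.
apply: le_trans tq _.
rewrite -(sum_edges (F := fun i j => `|B i j| * (`|u i| * `|u j|)) _ gi).
- rewrite /qf; apply: ler_sum => i _; apply: ler_sum => j _.
  by rewrite mulrA -!normrM ler_norm.
- by move=> i j; rewrite Bs; ring.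
- move=> i j; rewrite !negb_and => /or3P[/uC ->|/uC ->|/Bg ->];
    by rewrite !(normr0, mulr0, mul0r).
Qed.

Lemma connected_excess (K : {set 'I_n}) : connected_set g C -> K \subset C ->
  K != finset.set0 ->
  (#|gedges g K|%:R - #|K|%:R <= #|gedges g C|%:R - #|C|%:R :> R).
Proof.
move=> cC KC K0; have := connected_card_edges gs cC KC K0.
rewrite -(ler_nat R) !natrD; lra.
Qed.

Lemma support_neq0 : exists2 i, i \in C & u i != 0.
Proof.
apply/not_exists2P => h.
have u0 i : u i = 0.
  case: (h i) => [/negP /uC //|/negP]; by rewrite negbK => /eqP.
move: u1; rewrite /sqn big1 => [/eqP|i _]; last by rewrite u0 expr0n.
by rewrite eq_sym oner_eq0.
Qed.

(** A single edge carries at most half of the squared norm in the product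
    [`|u i| * `|u j|], so the sum of the weights is at least [t]; for exponents at
    most 1 the sum of powers dominates the power of the sum. *)
Lemma cost_ge_le1 : al <= 1 -> t `^ al <= cost.
Proof.
move=> al1.
apply: le_trans _ (powR_sum_le _ al0 al1 (fun e => normr_ge0 (B e.1 e.2))).
apply: ge0_ler_powR; rewrite ?nnegrE ?(ltW al0) ?(ltW t0) ?sumr_ge0 //.
apply: le_trans qf_edges_le _; rewrite mulr_sumr; apply: ler_sum => -[i j] /=.
rewrite !inE /= => /and4P[ij _ _ _].
rewrite mulrCA ler_piMr //.
have : u i ^+ 2 + u j ^+ 2 <= 1.
  rewrite -u1 /sqn (bigD1 i) //= (bigD1 j) /=; last first.
    by apply: contraTneq ij => ->; rewrite ltnn.
  by rewrite addrA lerDl sumr_ge0 // => k _; rewrite sqr_ge0.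
have := sqr_ge0 (`|u i| - `|u j|).
rewrite -(real_normK (num_real (u i))) -(real_normK (num_real (u j))); lra.
Qed.

(** Balance between excess and energy.  A connected graph has excess at least -1,
    so the energy has to pay for the whole rate and one more unit. *)
Lemma rate_cost_le1 (de : R) : connected_set g C -> al <= 1 -> 0 < de ->
  ((1 + de) `^ al - 1 - (#|gedges g C|%:R - #|C|%:R)) * (t / (1 + de)) `^ al <= cost.
Proof.
move=> cC al1 de0; have [i iC _] := support_neq0.
have d1 : 0 < 1 + de by rewrite addr_gt0.
apply: le_trans (cost_ge_le1 al1).
have := @connected_excess [set i]%SET cC.
rewrite finset.sub1set iC => /(_ isT); rewrite cards1.
have -> : ([set i] != finset.set0)%SET by apply/set0Pn; exists i; rewrite inE.
move=> /(_ isT) h.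
have := ler0n R #|gedges g [set i]%SET| => h2.
rewrite -[X in _ <= X `^ _](divfK (lt0r_neq0 d1) t).
rewrite (powRM _ (divr_ge0 (ltW t0) (ltW d1)) (ltW d1)) [X in _ <= X]mulrC.
apply: ler_wpM2r; first exact: powR_ge0.
lra.
Qed.

(** Hoelder's inequality bounds the energy below by the edge power sum of the
    squared entries of [u], and the latter is at most its value on a clique. *)
Lemma cost_ge_clique (be : R) : 2 < be -> 1 < al -> al^-1 + be^-1 = 1 ->
  exists K : {set 'I_n}, [/\ K \subset C, (2 <= #|K|)%N,
    (forall i j, i \in K -> j \in K -> i != j -> g i j) &
    2^-1 * t `^ al * phi (be / 2) #|K| `^ (1 - al) <= cost].
Proof.
move=> be2 al1 conj.
have be0 : 0 < be by lra.
pose th := be / 2.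
have th1 : 1 <= th by rewrite /th; lra.
have th0 : th != 0 by rewrite gt_eqF //; lra.
pose w i := u i ^+ 2.
have w0 k : 0 <= w k by exact: sqr_ge0.
have [w' [w'0 w'1 w'w cl SS]] := motzkin_straus gs gi th1 w0 u1.
set S := edge_power_sum g th w in SS.
pose K := [set k | w' k != 0]%SET.
have := edge_power_sum_clique gi th1 w'0 w'1 cl; rewrite -/K => Sphi.
have wth i : w i `^ th = `|u i| `^ be.
  rewrite /w -(real_normK (num_real (u i))) -powR_mulrn // -powRrM /th.
  by congr (_ `^ _); field.
have SE : S = 2 * \sum_(e in gedges g C) (`|u e.1| * `|u e.2|) `^ be.
  transitivity (\sum_i \sum_j (g i j)%:R * (`|u i| * `|u j|) `^ be).
    rewrite /S /edge_power_sum /qf; apply: eq_bigr => i _; apply: eq_bigr => j _.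
    by rewrite !mxE !wth powRM // mulrA.
  rewrite (@sum_edges _ _ _ g C _ gi).
  - congr (2 * _); apply: eq_bigr => e; rewrite inE => /and4P[_ _ _ ->].
    by rewrite mul1r.
  - by move=> i j; rewrite gs [X in X `^ _]mulrC.
  - move=> i j; rewrite !negb_and => /or3P[/uC ->|/uC ->|/negPf ->];
      by rewrite !(normr0, mulr0, mul0r) ?powR0 ?mulr0 // gt_eqF.
have hol := @hoelder_sum R _ (mem (gedges g C)) (fun e => `|B e.1 e.2|)
  (fun e => `|u e.1| * `|u e.2|) al be al0 be0 conj (fun e => normr_ge0 _)
  (fun e => mulr_ge0 (normr_ge0 _) (normr_ge0 _)).
rewrite -/cost in hol.
set U := \sum_(e in gedges g C) (`|u e.1| * `|u e.2|) `^ be in SE hol.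
have U0 : 0 <= U by apply: sumr_ge0 => e _; exact: powR_ge0.
have c0 : 0 <= cost by apply: sumr_ge0 => e _; exact: powR_ge0.
have h1 : t <= 2 * (cost `^ al^-1 * U `^ be^-1).
  by apply: le_trans qf_edges_le _; rewrite ler_pM2l.
have Up : 0 < U.
  rewrite lt_def U0 andbT; apply/eqP => UE; move: h1.
  by rewrite UE powR0 ?mulr0 ?leNgt ?t0 // invr_eq0 gt_eqF.
have phip : 0 < phi th #|K| by apply: lt_le_trans (le_trans SS Sphi); rewrite SE mulr_gt0.
exists K; split.
- apply/fintype.subsetP => k; rewrite inE; apply: contraR => kC.
  by apply/eqP; apply: w'w; rewrite /w uC // expr0n.
- rewrite leqNgt; apply/negP => K1.
  move: Sphi; rewrite leNgt => /negP; apply.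
  have Sp : 0 < S by rewrite SE mulr_gt0.
  apply: le_lt_trans _ (lt_le_trans Sp SS).
  have K1' : (#|K| <= 1)%N by [].
  have z (i : 'I_#|K|) : val i = 0%N.
    by apply/eqP; rewrite -leqn0 -ltnS; exact: leq_trans (ltn_ord i) K1'.
  (* With at most one coordinate the off-diagonal sum is empty and [phi] vanishes. *)
  rewrite /phi.
  have : forall x, [set \sum_(i < #|K|) \sum_(j < #|K| | i != j) `|v 0 i| `^ th * `|v 0 j| `^ th
      | v in [set v : 'rV[R]_#|K| | norm1 v = 1]] x -> x = 0.
    move=> _ [v _ <-]; rewrite big1 // => i _; rewrite big1 // => j /eqP []; apply/val_inj.
    by rewrite !z.
  move=> hx; apply: ge_sup.
    exists 0; have [v v1] : exists v : 'rV[R]_#|K|, norm1 v = 1.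
      exists (\row_i w' (enum_val i)).
      rewrite /norm1 (eq_bigr (fun i => w' (enum_val i))); last by move=> i _; rewrite mxE ger0_norm.
      rewrite -(big_enum_val (fun k => w' k)) -w'1 big_mkcond; apply: eq_bigr => k _ /=.
      by rewrite inE; case: eqP.
    have := hx (pairsum th v); rewrite /pairsum => hx2.
    by exists v => //; apply: hx; exists v.
  by move=> x /hx ->.
- by move=> i j; rewrite !inE => wi wj ij; apply: cl.
apply: hoelder_cost h1 _ => //.
by have := le_trans SS Sphi; rewrite SE.
Qed.

(** Balance between excess and energy.  The clique found by [cost_ge_clique]
    bounds the excess below and the energy below, and the two bounds add up to
    [psi] at its size. *)
Lemma rate_cost_gt1 (be de r : R) : connected_set g C -> 2 < be -> 1 < al ->
  al^-1 + be^-1 = 1 -> 0 < de ->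
  (forall k, (2 <= k)%N -> r <= psi al be de k) ->
  (r - (#|gedges g C|%:R - #|C|%:R)) * (t / (1 + de)) `^ al <= cost.
Proof.
move=> cC be2 al1 conj de0 hr.
have d1 : 0 < 1 + de by rewrite addr_gt0.
have [K [KC K2 cl hc]] := cost_ge_clique be2 al1 conj.
apply: le_trans hc.
have K0 : K != finset.set0 by rewrite -card_gt0 (leq_trans _ K2).
have ex := connected_excess cC KC K0.
have ce := @card_clique_edges R n g K gs gi cl.
have := hr _ K2; rewrite /psi => hpsi.
rewrite -[X in _ <= _ * X `^ _ * _](divfK (lt0r_neq0 d1) t).
rewrite (powRM _ (divr_ge0 (ltW t0) (ltW d1)) (ltW d1)).
set ph := phi _ _ `^ _ in hpsi *.
have -> : 2^-1 * ((t / (1 + de)) `^ al * (1 + de) `^ al) * ph =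
  (2^-1 * (1 + de) `^ al * ph) * (t / (1 + de)) `^ al by ring.
apply: ler_wpM2r; first exact: powR_ge0.
have := ex; rewrite -subr_ge0; move: ce hpsi.
set kk := #|K|%:R; set ek := #|gedges g K|%:R => ce hpsi h.
have : kk * (kk - 3) / 2 = ek - kk.
  have : 2 * ek - 2 * kk = kk * (kk - 3) by rewrite ce; ring.
  lra.
lra.
Qed.

End Cost.

(** * Union bounds over heavy configurations *)

Section HeavyProb.
Context d (T : measurableType d) (R : realType) (P : probability T R).
Variables (n : nat) (p : R) (mu : probability R R).
Variables (G : 'I_n * 'I_n -> {RV P >-> bool}) (Y : 'I_n * 'I_n -> {RV P >-> R}).
Hypothesis er : erdos_renyi P p G.
Hypothesis iid : iid_symmetric P mu Y.
Hypothesis ind : independent_families P G Y.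
Hypothesis p0 : 0 <= p.
Variables (al C0 : R).
Hypothesis C00 : 0 < C0.
Hypothesis tail : forall l, fine (mu (pow_ge al l)) <= C0 * expR (- l).

Definition pairs_in (C : {set 'I_n}) : {set 'I_n * 'I_n} :=
  finset.setX C C :&: upper_pairs n.

Lemma card_pairs_in C : (#|pairs_in C| <= #|C| ^ 2)%N.
Proof.
by rewrite expnS expn1 -cardsX subset_leq_card // finset.subsetIl.
Qed.

Definition level_event (W : {set 'I_n * 'I_n}) (l : 'I_n * 'I_n -> R) : set T :=
  edge_event G Y W (fun e => pow_ge al (l e)).

Lemma measurable_level_event W l : measurable (level_event W l).
Proof. by apply: measurable_edge_event => e; exact: measurable_pow_ge. Qed.

Lemma pr_level_event (W : {set 'I_n * 'I_n}) l : W \subset upper_pairs n ->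
  pr P (level_event W l) <= (p * C0) ^+ #|W| * expR (- \sum_(e in W) l e).
Proof.
move=> WU; rewrite (pr_edge_event er iid ind) //; last first.
  by move=> e; exact: measurable_pow_ge.
rewrite -sumrN expR_sum -prodr_const -big_split /=.
apply: ler_prod => e _; rewrite mulr_ge0 ?fine_ge0 //=.
by rewrite -mulrA ler_wpM2l.
Qed.

(** First moment bound for configurations with [m] vertices, [k] edges and total
    level at least [s].  The levels take values in the image of [{0, ..., S}]
    under [lev], which covers both integer levels and a single real level. *)
Lemma heavy_union (m k S : nat) (lev : nat -> R) (s : R) : exists2 H : set T,
  measurable H /\
  pr P H <= n%:R ^+ m * (m%:R ^+ 2) ^+ k * S.+1%:R ^+ k * ((p * C0) ^+ k * expR (- s)) &
  forall w, ~ H w -> forall (C : {set 'I_n}) (W : {set 'I_n * 'I_n}) (l : 'I_n * 'I_n -> nat),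
    #|C| = m -> #|W| = k -> W \subset pairs_in C ->
    (forall e, e \in W -> (l e <= S)%N) ->
    s <= \sum_(e in W) lev (l e) -> ~ level_event W (fun e => lev (l e)) w.
Proof.
pose QW (C : {set 'I_n}) (W : {set 'I_n * 'I_n}) := (W \subset pairs_in C) && (#|W| == k).
pose Ql (W : {set 'I_n * 'I_n}) (l : {ffun 'I_n * 'I_n -> 'I_S.+1}) :=
  (l \in pffun_on ord0 (mem W) predT) && (s <= \sum_(e in W) lev (l e)).
pose QWl C (y : {set 'I_n * 'I_n} * {ffun 'I_n * 'I_n -> 'I_S.+1}) :=
  QW C y.1 && Ql y.1 y.2.
pose Q (x : {set 'I_n} * ({set 'I_n * 'I_n} * {ffun 'I_n * 'I_n -> 'I_S.+1})) :=
  (#|x.1| == m) && QWl x.1 x.2.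
pose A (x : {set 'I_n} * ({set 'I_n * 'I_n} * {ffun 'I_n * 'I_n -> 'I_S.+1})) :=
  level_event x.2.1 (fun e => lev (x.2.2 e)).
have [mH bH] := pr_bigU P (index_enum _) Q (fun x =>
   measurable_level_event x.2.1 (fun e => lev (x.2.2 e))).
set K := (p * C0) ^+ k * expR (- s).
have K0 : 0 <= K by rewrite mulr_ge0 ?expR_ge0 // exprn_ge0 // mulr_ge0 // ltW.
exists (\big[setU/set0]_(x | Q x) A x).
  split=> //; apply: le_trans bH _.
  apply: le_trans (_ : \sum_(x | Q x) K <= _).
    apply: ler_sum => -[C [W l]] /andP[_ /andP[/andP[/= WC /eqP Wk] /andP[/= _ hs]]].
    apply: le_trans (pr_level_event _ _) _.
      by apply: fintype.subset_trans WC _; exact: finset.subsetIr.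
    by rewrite /K Wk ler_wpM2l ?ler_expR ?lerN2 // exprn_ge0 // mulr_ge0 // ltW.
  have -> : \sum_(x | Q x) K = \sum_(C : {set 'I_n} | #|C| == m) \sum_(y | QWl C y) K.
    by rewrite pair_big_dep.
  have hl (W : {set 'I_n * 'I_n}) : #|W| = k -> \sum_(l | Ql W l) K <= S.+1%:R ^+ k * K.
    move=> Wk; rewrite sumr_const -[_ *+ _]mulr_natl ler_wpM2r // -natrX ler_nat.
    have -> : (S.+1 ^ k = #|pffun_on (ord0 : 'I_S.+1) (mem W) predT|)%N.
      by rewrite card_pffun_on card_ord Wk.
    by apply: subset_leq_card; apply/fintype.subsetP => l /andP[].
  have hW (C : {set 'I_n}) : #|C| = m -> \sum_(y | QWl C y) K <= (m%:R ^+ 2) ^+ k * (S.+1%:R ^+ k * K).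
    move=> Cm; have -> : \sum_(y | QWl C y) K = \sum_(W | QW C W) \sum_(l | Ql W l) K.
      by rewrite pair_big_dep.
    apply: le_trans (_ : \sum_(W | QW C W) S.+1%:R ^+ k * K <= _).
      by apply: ler_sum => W /andP[_ /eqP]; exact: hl.
    rewrite sum_subsets_card; apply: ler_wpM2r.
      by rewrite mulr_ge0 ?exprn_ge0 ?ler0n.
    rewrite -!natrX ler_nat; apply: leq_trans (bin_le_expn _ _) _.
    by case: k {QW Ql QWl Q A mH K K0 hl} => // k; rewrite leq_exp2r // -Cm card_pairs_in.
  apply: le_trans (_ : \sum_(C : {set 'I_n} | #|C| == m) (m%:R ^+ 2) ^+ k * (S.+1%:R ^+ k * K) <= _).
    by apply: ler_sum => C /eqP; exact: hW.
  rewrite -!mulrA (eq_bigl (fun C : {set 'I_n} => (C \subset [set: 'I_n]%SET) && (#|C| == m))); last first.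
    by move=> C; rewrite finset.subsetT.
  rewrite sum_subsets_card; apply: ler_wpM2r.
    by rewrite mulr_ge0 ?exprn_ge0 ?ler0n // mulr_ge0 ?exprn_ge0 ?ler0n.
  by rewrite -natrX ler_nat cardsT card_ord bin_le_expn.
move=> w nH C W l Cm Wk WC lS hs hlev; apply: nH.
pose l' : {ffun 'I_n * 'I_n -> 'I_S.+1} := [ffun e => if e \in W then inord (l e) else ord0].
have l'E e : e \in W -> val (l' e) = l e.
  by move=> eW; rewrite ffunE eW /= inordK // ltnS lS.
have sE : \sum_(e in W) lev (l' e) = \sum_(e in W) lev (l e).
  by apply: eq_bigr => e eW; rewrite l'E.
rewrite (bigD1 (C, (W, l'))) /=.
  by left; move=> e eW /=; rewrite l'E //; exact: hlev.
rewrite /Q /QWl /QW /Ql /= Cm Wk !eqxx WC /= sE hs andbT.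
apply/pffun_onP; split=> //; apply/fintype.subsetP => e; apply: contraR => eW.
by rewrite ffunE (negPf eW).
Qed.

End HeavyProb.

Section Rounding.
Variable R : realType.

(** Rounding the energies down to integers loses at most one per edge, and
    truncating them at a value which already exceeds the target loses nothing. *)
Lemma rounded_levels (I : finType) (W : {set I}) (x : I -> R) (S : nat) (s : R) :
  (forall i, 0 <= x i) -> s <= S%:R -> s + #|W|%:R <= \sum_(i in W) x i ->
  exists l : I -> nat, [/\ forall i, (l i <= S)%N, forall i, (l i)%:R <= x i &
    s <= \sum_(i in W) (l i)%:R].
Proof.
move=> x0 sS hs; pose l i := minn (Num.truncn (x i)) S.
have lx i : (l i)%:R <= x i.
  have /andP[h _] := truncn_itv (x0 i).
  by apply: le_trans h; rewrite ler_nat geq_minl.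
exists l; split=> // [i|]; first exact: geq_minr.
case: (boolP [exists i in W, (S <= Num.truncn (x i))%N]).
  move=> /existsP [i /andP[iW iS]]; apply: le_trans sS _.
  rewrite (bigD1 i) //= /l (minn_idPr iS) lerDl.
  by apply: sumr_ge0 => j _; rewrite ler0n.
rewrite negb_exists => /forallP h.
rewrite -(lerD2r #|W|%:R); apply: le_trans hs _.
rewrite -sumr_const -big_split; apply: ler_sum => i iW /=.
have := h i; rewrite iW -ltnNge /= => /ltnW hi.
rewrite /l (minn_idPl hi).
have /andP[_ /ltW] := truncn_itv (x0 i).
by rewrite -natr1.
Qed.

End Rounding.

Section FiniteUpperBound.
Context d (T : measurableType d) (R : realType) (P : probability T R).
Variables (n : nat) (p : R) (mu : probability R R).
Variables (G : 'I_n * 'I_n -> {RV P >-> bool}) (Y : 'I_n * 'I_n -> {RV P >-> R}).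
Hypothesis er : erdos_renyi P p G.
Hypothesis iid : iid_symmetric P mu Y.
Hypothesis ind : independent_families P G Y.

Let Z := sparse_mx G Y.

Lemma sparse_mxE w i j : Z w i j = if G (i, j) w then Y (i, j) w else 0.
Proof. by rewrite !mxE; case: (G _ w); rewrite ?mul1r ?mul0r. Qed.

Lemma sparse_mx_sym w : (Z w)^T = Z w.
Proof.
by apply/matrixP => i j; rewrite mxE !sparse_mxE (er_sym er) (iid_sym iid).
Qed.

Lemma measurable_sparse_top t : (0 < n)%N -> measurable [set w | t <= lambda1 (Z w)].
Proof.
move=> n0; apply: measurable_lambda1_ge => // [|i j]; first exact: sparse_mx_sym.
have -> : (fun w => Z w i j) = (fun w => if G (i, j) w then Y (i, j) w else 0).
  by apply/funext => w; exact: sparse_mxE.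
apply: measurable_fun_ifT; [exact: measurable_funP|exact: measurable_funP|exact: measurable_cst].
Qed.

Hypothesis n0 : (0 < n)%N.
Hypothesis p0 : 0 <= p.
Variables (al C0 r de : R).
Hypothesis al0 : 0 < al.
Hypothesis C00 : 0 < C0.
Hypothesis tail : forall l, fine (mu (pow_ge al l)) <= C0 * expR (- l).
Hypothesis rate_cost : forall (g : rel 'I_n) (C : {set 'I_n}) (B : 'M[R]_n) u t,
  symmetric g -> irreflexive g -> (forall i j, B i j = B j i) ->
  (forall i j, ~~ g i j -> B i j = 0) -> (forall i, i \notin C -> u i = 0) ->
  sqn u = 1 -> 0 < t -> t <= qf B u -> connected_set g C ->
  (r - (#|gedges g C|%:R - #|C|%:R)) * (t / (1 + de)) `^ al <= cost g C B al.
Hypothesis de0 : 0 < de.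

Variables (a0 b M S : nat) (ell c t2 : R).
Hypotheses (ell0 : 0 < ell) (c0 : 0 < c) (t20 : 0 < t2).
Hypothesis abc : (a0 + 2 * b)%:R <= c ^+ 2.
Hypothesis SB : (r + 1) * (t2 / (1 + de)) `^ al <= S%:R.
Hypothesis r0 : 0 <= r.

(** The total level forced on a component with [m] vertices and [k] edges, after
    the loss of one unit per edge in the rounding. *)
Definition heavy_s (m k : nat) : R := (r - (k%:R - m%:R)) * (t2 / (1 + de)) `^ al - k%:R.

(** The three terms bound, in this order, the probability that some vertex starts
    many paths of length two, that some heavy component has more than [M]
    vertices, and that a smaller heavy component has the required energy. *)
Lemma sparse_top_upper :
  pr P [set w | ell `^ al^-1 * c + t2 <= lambda1 (Z w)] <=
    n%:R * (expR (n%:R * (expR 1 * p) - a0%:R)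
     + expR (n%:R * p) * expR ((a0 * n)%:R * (expR 1 * p) - b%:R))
  + n%:R ^+ M.+1 * (M.+1%:R ^+ 2) ^+ M * ((p * C0) ^+ M * expR (- (M%:R * ell)))
  + \sum_(m < M.+1) \sum_(k < (M ^ 2).+1 | (m <= k.+1)%N)
      n%:R ^+ m * (m%:R ^+ 2) ^+ k * S.+1%:R ^+ k * ((p * C0) ^+ k * expR (- heavy_s m k)).
Proof.
have [L [mL pL] hL] := many_two_paths er iid ind p0 a0 b.
(* All edges have the same level [ell], hence the range [0] of levels. *)
have [Tr [mTr pTr] hTr] := heavy_union er iid ind p0 C00 tail M.+1 M 0 (fun=> ell) (M%:R * ell).
have hH (x : 'I_M.+1 * 'I_(M ^ 2).+1) := heavy_union er iid ind p0 C00 tail x.1 x.2 S (fun l => l%:R) (heavy_s x.1 x.2).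
have /choice [H HP] : forall x : 'I_M.+1 * 'I_(M ^ 2).+1, exists H : set T,
  [/\ measurable H,
   pr P H <= n%:R ^+ x.1 * (x.1%:R ^+ 2) ^+ x.2 * S.+1%:R ^+ x.2 *
      ((p * C0) ^+ x.2 * expR (- heavy_s x.1 x.2)) &
   forall w, ~ H w -> forall (C : {set 'I_n}) (W : {set 'I_n * 'I_n}) (l : 'I_n * 'I_n -> nat),
    #|C| = x.1 -> #|W| = x.2 -> W \subset pairs_in C ->
    (forall e, e \in W -> (l e <= S)%N) ->
    heavy_s x.1 x.2 <= \sum_(e in W) (l e)%:R -> ~ level_event G Y al W (fun e => (l e)%:R) w].
  by move=> x; have [H [mH pH] h] := hH x; exists H.
have {}hH : forall x, measurable (H x) by move=> x; have [] := HP x.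
pose Q (x : 'I_M.+1 * 'I_(M ^ 2).+1) := (x.1 <= x.2.+1)%N.
have [mU bU] := pr_bigU P (index_enum _) Q hH.
set U := \big[setU/set0]_(x | Q x) H x in mU bU.
have bU2 : pr P U <= \sum_(m < M.+1) \sum_(k < (M ^ 2).+1 | (m <= k.+1)%N)
      n%:R ^+ m * (m%:R ^+ 2) ^+ k * S.+1%:R ^+ k * ((p * C0) ^+ k * expR (- heavy_s m k)).
  rewrite pair_big_dep; apply: le_trans bU _.
  by apply: ler_sum => x _; have [] := HP x.
have mLT := measurableU _ _ mL mTr.
apply: le_trans (_ : pr P ((L `|` Tr) `|` U) <= _); last first.
  apply: le_trans (pr_setU P mLT mU) _; apply: lerD => //.
  apply: le_trans (pr_setU P mL mTr) _; apply: lerD => //.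
  apply: le_trans pTr _.
  by rewrite expr1n mulr1.
apply: (pr_le P (measurable_sparse_top _ n0) (measurableU _ _ mLT mU)) => w /= tw.
apply/not_notP => nE; have nL : ~ L w by move=> h; apply: nE; left; left.
have nT : ~ Tr w by move=> h; apply: nE; left; right.
have nU : ~ U w by move=> h; apply: nE; right.
have {nE} nH x : Q x -> ~ H x w.
  by move=> Qx h; apply: nU; rewrite /U (bigD1 x) //=; left.
(* [B] is the heavy part of the matrix; [g0] supports its complement. *)
pose g0 : rel 'I_n := fun i j => G (i, j) w.
pose g : rel 'I_n := fun i j => G (i, j) w && (ell <= `|Y (i, j) w| `^ al).
have g0s : symmetric g0 by move=> i j; exact: (er_sym er).
have gs : symmetric g by move=> i j; rewrite /g (er_sym er) (iid_sym iid).
have gi : irreflexive g by move=> i; rewrite /g (er_irrefl er).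
pose B : 'M[R]_n := \matrix_(i, j) (if g i j then Y (i, j) w else 0).
have Bs i j : B i j = B j i by rewrite !mxE gs (iid_sym iid).
have Bg i j : ~~ g i j -> B i j = 0 by rewrite mxE => /negPf ->.
have [v v0 hv] := (lambda1_ge (ell `^ al^-1 * c + t2) n0 (sparse_mx_sym w)).1 tw.
have light : qf (Z w - B) v <= ell `^ al^-1 * c * sqn v.
  apply: (qf_le_two_paths (g := g0)) => //; first exact: powR_ge0.
    move=> i j; rewrite !mxE /g0 /g.
    case Gij : (G (i, j) w) => /=; last by rewrite !mul0r subr0 normr0 mulr0.
    rewrite mul1r mulr1; case: (leP ell (`|Y (i, j) w| `^ al)) => hl; first by rewrite subrr normr0 powR_ge0.
    rewrite subr0 -[X in X <= _]powRr1 // -(mulfV (lt0r_neq0 al0)) powRrM.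
    apply: ge0_ler_powR; rewrite ?invr_ge0 ?nnegrE ?powR_ge0 ?(ltW al0) ?(ltW ell0) //.
    exact: ltW.
  move=> i; apply: le_trans abc; rewrite ler_nat; exact: hL.
have heavy : t2 * sqn v <= qf B v.
  have e : qf (Z w) v = qf (Z w - B) v + qf B v.
    rewrite /qf -big_split; apply: eq_bigr => i _; rewrite -big_split.
    by apply: eq_bigr => j _ /=; rewrite !mxE; ring.
  by move: hv light; rewrite e mulrDl => h1 h2; lra.
have [C [cC [u [u1 uC tu]]]] := localize gs Bg v0 heavy.
have levW (W : {set 'I_n * 'I_n}) (l : 'I_n * 'I_n -> R) : W \subset gedges g C ->
    (forall e, e \in W -> l e <= `|Y e w| `^ al) -> level_event G Y al W l w.
  move=> /fintype.subsetP WC hl e eW; split; last exact: hl.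
  by move: (WC e eW); rewrite inE => /and4P[_ _ _ /andP[]]; rewrite -surjective_pairing.
have geY e : e \in gedges g C -> ell <= `|Y e w| `^ al.
  by rewrite inE => /and4P[_ _ _ /andP[_]]; rewrite -surjective_pairing.
have gpairs C' : gedges g C' \subset pairs_in C'.
  by apply/fintype.subsetP => e; rewrite !inE => /and4P[-> -> -> _].
have [x xC _] := support_neq0 uC u1.
have x0 : [set x]%SET != finset.set0 by apply/set0Pn; exists x; rewrite inE.
have xsub : [set x]%SET \subset C by rewrite finset.sub1set.
have [MC|CM] := ltnP M #|C|.
  (* Growing from a vertex yields a set of [M + 1] vertices with [M] heavy edges. *)
  have [|S' [_ S'C S'c S'e]] := @connected_grow _ g gs C [set x]%SET M cC xsub x0.
    by rewrite cards1.
  have [W Wsub Wc] := subset_of_card (leq_trans (leq_addl _ _) S'e : (M <= _)%N).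
  have WC := fintype.subset_trans Wsub (gedgesS g S'C).
  apply: (hTr w nT S' W (fun=> 0%N)) => //.
  - by rewrite S'c cards1 add1n.
  - by apply: fintype.subset_trans Wsub _.
  - by rewrite sumr_const Wc -[X in _ <= X]mulr_natl.
  - by apply: levW => // e eW; apply: geY; exact: (fintype.subsetP WC).
have kM : (#|gedges g C| < (M ^ 2).+1)%N.
  rewrite ltnS; apply: leq_trans (subset_leq_card (gpairs C)) _.
  by apply: leq_trans (card_pairs_in C) _; rewrite leq_exp2r.
have mk : (#|C| <= #|gedges g C|.+1)%N.
  have := connected_card_edges gs cC xsub x0; rewrite cards1 addn1 => h.
  by apply: leq_trans h; exact: leq_addl.
pose X : 'I_M.+1 * 'I_(M ^ 2).+1 := (Ordinal (CM : (#|C| < M.+1)%N), Ordinal kM).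
have [_ _ hX] := HP X.
have hc := rate_cost gs gi Bs Bg uC u1 t20 tu cC.
have SBx := SB; set xx := (t2 / (1 + de)) `^ al in hc SBx.
have xx0 : 0 <= xx by exact: powR_ge0.
have mkR : #|C|%:R <= #|gedges g C|%:R + 1 :> R by rewrite natr1 ler_nat.
have [|||l [lS lx ls]] := @rounded_levels R _ (gedges g C) (fun e => `|Y e w| `^ al) S
   (heavy_s #|C| #|gedges g C|).
- by move=> e; exact: powR_ge0.
- apply: le_trans SBx; rewrite /heavy_s -/xx.
  apply: le_trans (_ : (r - (#|gedges g C|%:R - #|C|%:R)) * xx <= _).
    by rewrite lerBlDr lerDl ler0n.
  by apply: ler_wpM2r => //; lra.
- rewrite /heavy_s -/xx subrK; apply: le_trans hc _.
  rewrite le_eqVlt; apply/orP; left; apply/eqP; apply: eq_bigr => e.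
  rewrite inE => /and4P[_ _ _ ge]; rewrite mxE ge.
  by rewrite -surjective_pairing.
have lev : level_event G Y al (gedges g C) (fun e => (l e)%:R) w.
  by apply: levW => // e _.
exact: (hX w (nH X mk) C (gedges g C) l erefl erefl (gpairs C) (fun e _ => lS e) ls lev).
Qed.

End FiniteUpperBound.

(** * Asymptotics of the upper bound *)

Section Growth.
Variable R : realType.

Lemma expR_ge_pow (x : R) k : 0 <= x -> x ^+ k / k`!%:R <= expR x.
Proof.
case: k => [|k] x0; first by rewrite expr0 fact0 divr1 -expR0 ler_expR.
by apply: le_trans (expR_ge1Dxn k x0); rewrite lerDr.
Qed.

(** Polynomials in L = ln n are n ^ o(1), even after raising them to a power of
    order L ^ (1 - a). *)
Lemma poly_le_exp_powR (A kap a : R) N : 0 < kap -> 0 < a ->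
  \forall L \near +oo, A * L ^+ N <= expR (kap * L `^ a).
Proof.
move=> kap0 a0.
(* With [a * k >= N + 1] the k-th Taylor term outgrows the monomial. *)
pose k := (Num.truncn (N.+1%:R / a)).+1.
have ak : N.+1%:R <= a * k%:R.
  rewrite -ler_pdivrMl // mulrC.
  by have /andP[_ /ltW] := truncn_itv (divr_ge0 (ler0n R N.+1) (ltW a0)).
pose D := kap ^+ k / k`!%:R.
have D0 : 0 < D by rewrite divr_gt0 ?exprn_gt0 // ltr0n fact_gt0.
near=> L.
have L1 : 1 <= L by near: L; exact: nbhs_pinfty_ge.
have LA : A / D <= L by near: L; apply: nbhs_pinfty_ge; exact: num_real.
have L0 : 0 <= L by lra.
apply: le_trans (expR_ge_pow k _); last by rewrite mulr_ge0 ?powR_ge0 // ltW.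
rewrite exprMn mulrAC -/D.
have h : L ^+ N.+1 <= (L `^ a) ^+ k.
  rewrite -!powR_mulrn ?powR_ge0 // -powRrM; exact: ler_powR.
apply: le_trans (_ : D * L ^+ N.+1 <= _); last by rewrite ler_pM2l.
rewrite exprS mulrA ler_wpM2r ?exprn_ge0 //.
by rewrite mulrC -ler_pdivrMr.
Unshelve. all: by end_near. Qed.

Lemma powR_lt_powR (K eps a b : R) : 0 < eps -> a < b ->
  \forall L \near +oo, K * L `^ a <= eps * L `^ b.
Proof.
move=> eps0 ab; have ba : 0 < b - a by rewrite subr_gt0.
near=> L.
have L1 : 1 <= L by near: L; exact: nbhs_pinfty_ge.
have L0 : 0 < L by lra.
have LK : (`|K| / eps) `^ (b - a)^-1 <= L by near: L; apply: nbhs_pinfty_ge; exact: num_real.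
have h : `|K| / eps <= L `^ (b - a).
  have := ge0_ler_powR (ltW ba) (powR_ge0 _ _) (ltW L0) LK.
  by rewrite -powRrM mulVf ?gt_eqF // powRr1 // divr_ge0 // ltW.
have -> : L `^ b = L `^ (b - a) * L `^ a.
  by rewrite -powRD ?subrK // (gt_eqF L0) implybT.
rewrite mulrA ler_wpM2r ?powR_ge0 //.
apply: le_trans (ler_norm K) _.
by rewrite mulrC -ler_pdivrMr.
Unshelve. all: by end_near. Qed.

End Growth.

Section Terms.
Variable R : realType.

(** The exponents of n add up to the excess and the polynomial factors are
    collected in [expR q]; since [q <= L - x] the worst case is the excess -1,
    that is, a tree. *)
Lemma heavy_term_le (L r x d C0 q : R) (m k M S : nat) : 0 <= d -> 0 <= C0 ->
  (m <= M)%N -> (m <= k.+1)%N -> 0 <= q -> q <= L - x ->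
  M%:R ^+ 2 * S.+1%:R * d * C0 * expR 1 <= expR q ->
  expR L ^+ m * (m%:R ^+ 2) ^+ k * S.+1%:R ^+ k *
    ((d / expR L * C0) ^+ k * expR (- ((r - (k%:R - m%:R)) * x - k%:R)))
  <= expR (- (r * x) + (L - x) + M%:R * q).
Proof.
move=> d0 C00 mM mk q0 qL hQ.
have eL : 0 < expR L by exact: expR_gt0.
have -> : expR L ^+ m * (m%:R ^+ 2) ^+ k * S.+1%:R ^+ k *
    ((d / expR L * C0) ^+ k * expR (- ((r - (k%:R - m%:R)) * x - k%:R))) =
  (m%:R ^+ 2 * S.+1%:R * d * C0 * expR 1) ^+ k *
  expR (m%:R * L - k%:R * L - (r - (k%:R - m%:R)) * x).
  have ek : expR (k%:R : R) = expR 1 ^+ k by rewrite -expRM_natl mulr1.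
  rewrite opprB (expRD k%:R) ek (expRD (m%:R * L - k%:R * L)) expRB !expRM_natl !exprMn exprVn.
  ring.
have mR : m%:R <= M%:R :> R by rewrite ler_nat.
have kR : m%:R <= k%:R + 1 :> R by rewrite natr1 ler_nat.
have m0 : 0 <= m%:R :> R by [].
have k0 : 0 <= k%:R :> R by [].
have h1 : (m%:R ^+ 2 * S.+1%:R * d * C0 * expR 1) ^+ k <= expR (k%:R * q).
  rewrite expRM_natl lerXn2r ?nnegrE ?expR_ge0 //.
    by rewrite !mulr_ge0 ?expR_ge0 ?exprn_ge0.
  apply: le_trans _ hQ; do 4! (apply: ler_wpM2r => //).
  by rewrite lerXn2r ?nnegrE.
apply: le_trans (ler_wpM2r (expR_ge0 _) h1) _.
rewrite -expRD ler_expR.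
have h2 : 0 <= (k%:R - m%:R + 1) * (L - x - q) by apply: mulr_ge0; lra.
have h3 : 0 <= (M%:R - m%:R) * q by apply: mulr_ge0; lra.
lra.
Qed.

(** A tree on [M + 1] vertices gains only one factor n, against a factor
    [expR (- ell)] per edge. *)
Lemma tree_term_le (L d C0 q ell : R) (M : nat) : 0 <= d -> 0 <= C0 ->
  M.+1%:R ^+ 2 * d * C0 <= expR q ->
  expR L ^+ M.+1 * (M.+1%:R ^+ 2) ^+ M *
    ((d / expR L * C0) ^+ M * expR (- (M%:R * ell)))
  <= expR (L - M%:R * (ell - q)).
Proof.
move=> d0 C00 hQ.
have eL : 0 < expR L by exact: expR_gt0.
have -> : expR L ^+ M.+1 * (M.+1%:R ^+ 2) ^+ M *
    ((d / expR L * C0) ^+ M * expR (- (M%:R * ell))) =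
  (M.+1%:R ^+ 2 * d * C0) ^+ M * expR (L - M%:R * ell).
  rewrite exprS !exprMn exprVn expRB expRN.
  have : expR L ^+ M != 0 by rewrite expf_neq0 // gt_eqF.
  have : expR (M%:R * ell) != 0 by rewrite gt_eqF ?expR_gt0.
  move: (expR L ^+ M) => y hz hy; field; exact/andP.
have h1 : (M.+1%:R ^+ 2 * d * C0) ^+ M <= expR (M%:R * q).
  by rewrite expRM_natl lerXn2r ?nnegrE ?expR_ge0 // !mulr_ge0 ?exprn_ge0.
apply: le_trans (ler_wpM2r (expR_ge0 _) h1) _.
by rewrite -expRD ler_expR; lra.
Qed.

Lemma truncn_bounds (y : R) : 0 <= y ->
  y <= (Num.truncn y).+1%:R <= y + 1.
Proof.
move=> y0; have /andP[h1 h2] := truncn_itv y0.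
by rewrite (ltW h2) -natr1 lerD2r.
Qed.

End Terms.

Section UpperParams.
Variable R : realType.

Definition light_bound (d L : R) (a0 b : nat) : R :=
  expR L * (expR (d * expR 1 - a0%:R) + expR d * expR (a0%:R * (d * expR 1) - b%:R)).

Lemma light_bound_le (d r L : R) (a0 b : nat) : 0 <= r -> expR (d * expR 1) + expR d <= expR L ->
  (r + 2) * L <= a0%:R -> a0%:R * (d * expR 1) + (r + 2) * L <= b%:R ->
  light_bound d L a0 b <= expR (- (r * L)).
Proof.
move=> r0 hL ha hb; rewrite /light_bound.
have h1 : expR (d * expR 1 - a0%:R) <= expR (d * expR 1) * expR (- ((r + 2) * L)).
  by rewrite -expRD ler_expR; lra.
have h2 : expR d * expR (a0%:R * (d * expR 1) - b%:R) <= expR d * expR (- ((r + 2) * L)).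
  by rewrite ler_pM2l ?expR_gt0 // ler_expR; lra.
have h3 := lerD h1 h2; rewrite -mulrDl in h3.
apply: le_trans (ler_wpM2l (expR_ge0 L) h3) _.
apply: le_trans (_ : expR L * (expR L * expR (- ((r + 2) * L))) <= _).
  by rewrite ler_pM2l ?expR_gt0 // ler_pM2r ?expR_gt0.
by rewrite -!expRD ler_expR; lra.
Qed.

(** The bound of [sparse_top_upper] at [n = expR L] and [p = d / expR L]; the first
    term is [light_bound]. *)
Definition total_bound (d C0 r L x ell : R) (a0 b M S : nat) : R :=
  light_bound d L a0 b
  + expR L ^+ M.+1 * (M.+1%:R ^+ 2) ^+ M * ((d / expR L * C0) ^+ M * expR (- (M%:R * ell)))
  + \sum_(m < M.+1) \sum_(k < (M ^ 2).+1 | (m <= k.+1)%N)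
      expR L ^+ m * (m%:R ^+ 2) ^+ k * S.+1%:R ^+ k *
      ((d / expR L * C0) ^+ k * expR (- ((r - (k%:R - m%:R)) * x - k%:R))).

Lemma exists_natural (y : R) : 0 <= y -> exists N : nat, y <= N.+1%:R <= y + 1.
Proof. by move=> y0; exists (Num.truncn y); exact: truncn_bounds. Qed.

(** The parameters at a given L = ln n: [a0] and [b] of order L make the light
    exceptional event negligible, [ell = L `^ a] separates light from heavy
    weights, [M] of order [L `^ (1 - a)] makes trees on [M + 1] vertices
    negligible, and [t2] is chosen so that [(t2 / (1 + de)) `^ al = gam * L]
    with [gam] close to 1. *)
Lemma upper_params_at (d al de C0 r eps a gam kb K1 kap L : R) :
  0 < d -> 0 < al -> 0 < de -> 0 < C0 -> 0 <= r -> 0 < eps ->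
  0 < a -> a < 1 -> 0 < gam -> gam < 1 -> (r + 1) * (1 - gam) = eps / 4 ->
  kb = (r + 3) * (d * expR 1) + r + 2 -> K1 = r + 3 + 2 * (kb + 1) ->
  kap = eps / (4 * (2 * r + 3)) -> 1 <= L ->
  ((2 * r + 4) ^+ 2 * d * C0) * L ^+ 2 <= expR (2^-1 * L `^ a) ->
  ((2 * r + 3) ^+ 2 * (r + 3) * d * C0 * expR 1) * L ^+ 3 <= expR (kap * L `^ a) ->
  ((2 * r + 4) * ((2 * r + 3) ^+ 2 + 1)) * L ^+ 3 <= expR (eps / 4 * L) ->
  3 <= expR (eps / 4 * L) ->
  kap * L `^ a <= (1 - gam) * L ->
  K1 `^ (2^-1) * L `^ (a / al + 2^-1) <= ((1 + de) * (1 - gam `^ al^-1)) * L `^ al^-1 ->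
  expR (d * expR 1) + expR d <= expR L ->
  exists a0 b M S : nat, exists ell c t2 : R,
  [/\ [/\ 0 < ell, 0 < c & 0 < t2], (a0 + 2 * b)%:R <= c ^+ 2,
      (r + 1) * (t2 / (1 + de)) `^ al <= S%:R,
      ell `^ al^-1 * c + t2 <= (1 + de) * L `^ al^-1 &
      total_bound d C0 r L ((t2 / (1 + de)) `^ al) ell a0 b M S <= expR ((- r + eps) * L)].
Proof.
move=> d0 al0 de0 C00 r0 eps0 a0_gt a1_lt gam0 gam1 eps_gam kbE K1E kapE L1.
have L0 : 0 < L by lra.
have r1 : 0 <= r + 1 by lra.
have r2 : 0 <= r + 2 by lra.
have r3 : 0 <= r + 3 by lra.
have r23 : 0 <= 2 * r + 3 by lra.
have r24 : 0 <= 2 * r + 4 by lra.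
have n23 : 2 * r + 3 != 0 by rewrite gt_eqF //; lra.
have n23L : 0 <= (2 * r + 3) * L by rewrite mulr_ge0 // ltW.
have n24L : 0 <= (2 * r + 4) * L by rewrite mulr_ge0 // ltW.
have n33L : 0 <= (r + 3) * L by rewrite mulr_ge0 // ltW.
have gL1 : 0 <= (r + 1) * ((1 - gam) * L).
  by rewrite !mulr_ge0 ?subr_ge0 ?(ltW gam1) ?(ltW L0).
have d1 : 0 < 1 + de by rewrite addr_gt0.
have de1 : 0 < d * expR 1 by rewrite mulr_gt0 ?expR_gt0.
have rde : 0 < (r + 3) * (d * expR 1) by rewrite mulr_gt0 //; lra.
have kb0 : 0 < kb by lra.
have K10 : 0 < K1 by lra.
have kap0 : 0 < kap by rewrite kapE divr_gt0 // mulr_gt0 //; lra.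
have [a0 /andP[a01 a02]] : exists N : nat, (r + 2) * L <= N.+1%:R <= (r + 2) * L + 1.
  by apply: exists_natural; rewrite mulr_ge0 // ltW.
have [b /andP[b1 b2]] : exists N : nat, kb * L <= N.+1%:R <= kb * L + 1.
  by apply: exists_natural; rewrite mulr_ge0 // ltW.
have [S /andP[S1 S2]] : exists N : nat, (r + 1) * L <= N.+1%:R <= (r + 1) * L + 1.
  by apply: exists_natural; rewrite mulr_ge0 // ltW.
have La : 1 <= L `^ (1 - a).
  by rewrite -[X in X <= _](powRr0 L) ler_powR // subr_ge0 ltW.
have LaL : L `^ (1 - a) <= L.
  by rewrite -[X in _ <= X]powRr1 ?(ltW L0) // ler_powR // gerBl ltW.
have LL : L `^ (1 - a) * L `^ a = L.
  by rewrite -powRD ?subrK ?powRr1 ?(ltW L0) // (gt_eqF L0) implybT.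
have Lap : 0 < L `^ a by exact: powR_gt0.
have [M /andP[M1 M2]] : exists N : nat,
    2 * (r + 1) * L `^ (1 - a) <= N.+1%:R <= 2 * (r + 1) * L `^ (1 - a) + 1.
  by apply: exists_natural; rewrite !mulr_ge0 ?powR_ge0.
pose c := (K1 * L) `^ (2^-1).
have c0 : 0 < c by rewrite powR_gt0 // mulr_gt0.
have c2 : c ^+ 2 = K1 * L.
  by rewrite -powR_mulrn ?powR_ge0 // -powRrM mulVf // powRr1 // mulr_ge0 // ltW.
have cE : (L `^ a) `^ al^-1 * c = K1 `^ (2^-1) * L `^ (a / al + 2^-1).
  rewrite /c powRM ?(ltW K10) ?(ltW L0) // -powRrM.
  by rewrite powRD ?(gt_eqF L0) ?implybT //; ring.
have gL : 0 < gam * L by rewrite mulr_gt0.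
pose t2 := (1 + de) * (gam * L) `^ al^-1.
have t20 : 0 < t2 by rewrite mulr_gt0 // powR_gt0.
have t2x : (t2 / (1 + de)) `^ al = gam * L.
  rewrite /t2 mulrAC divff ?gt_eqF // mul1r -powRrM mulVf ?gt_eqF // powRr1 //; exact: ltW.
have t2E : t2 = (1 + de) * (gam `^ al^-1 * L `^ al^-1).
  by rewrite /t2 powRM // ltW.
clearbody c t2.
have M3 : M.+1%:R <= (2 * r + 3) * L `^ (1 - a) by move: M2 La; clear; lra.
have rL : 0 <= r * L by rewrite mulr_ge0 // ltW.
have rLa : 0 <= (2 * r + 3) * (L - L `^ (1 - a)) by rewrite mulr_ge0 // subr_ge0.
have M4 : M.+1%:R <= (2 * r + 3) * L by move: M3 rLa; clear; lra.
have M5 : M.+2%:R <= (2 * r + 4) * L by rewrite -natr1; move: M4 L1; clear; lra.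
have S3 : S.+2%:R <= (r + 3) * L by rewrite -natr1; move: S2 L1; clear; lra.
have abc : (a0.+1 + 2 * b.+1)%:R <= c ^+ 2 by rewrite c2 natrD natrM K1E; move: a02 b2 L1; clear; lra.
have SB : (r + 1) * (gam * L) <= S.+1%:R by move: S1 gL1; clear; lra.
have kbb : a0.+1%:R * (d * expR 1) + (r + 2) * L <= b.+1%:R.
  apply: le_trans b1; rewrite kbE.
  have h : 0 <= (d * expR 1) * ((r + 2) * L + L - a0.+1%:R).
    by apply: mulr_ge0; [exact: ltW | move: a02 L1; clear; lra].
  by move: h; clear; lra.
have Mell : (r + 1) * L <= M.+1%:R * (2^-1 * L `^ a).
  have h := ler_wpM2r (ltW Lap) M1.
  have e : 2 * (r + 1) * L `^ (1 - a) * L `^ a = 2 * (r + 1) * L by rewrite -mulrA LL.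
  by rewrite e in h; move: h; clear; lra.
have fin1 : (r + 1) * (1 - gam) * L = eps / 4 * L by rewrite eps_gam.
have [q qE] : {q | q = kap * L `^ a} by exists (kap * L `^ a).
have q0 : 0 <= q by rewrite qE mulr_ge0 ?powR_ge0 // ltW.
have Mq : M.+1%:R * q <= eps / 4 * L.
  apply: le_trans (ler_wpM2r q0 M3) _.
  have -> : (2 * r + 3) * L `^ (1 - a) * q = eps / 4 * (L `^ (1 - a) * L `^ a).
    by rewrite qE kapE; field.
  by rewrite LL.
rewrite -qE => q1 q2 q3 q4 q5 q6 q7.
exists a0.+1, b.+1, M.+1, S.+1, (L `^ a), c, t2.
rewrite t2x /total_bound.
move: a0.+1 b.+1 S.+1 M.+1 a01 abc kbb SB S3 M4 M5 Mell Mq.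
move=> {a02 b1 b2 S1 S2 M1 M2 M3 a0 b S M} a0 b S M a01 abc kbb SB S3 M4 M5 Mell Mq.
split=> //.
- rewrite cE t2E; move: q6; clear; set u := L `^ al^-1; set v := gam `^ al^-1; lra.
have T1 : light_bound d L a0 b <= expR (- (r * L)).
  exact: light_bound_le.
have T2 : expR L ^+ M.+1 * (M.+1%:R ^+ 2) ^+ M *
    ((d / expR L * C0) ^+ M * expR (- (M%:R * L `^ a))) <= expR (- (r * L)).
  apply: le_trans (_ : expR (L - M%:R * (L `^ a - 2^-1 * L `^ a)) <= _).
    apply: tree_term_le; rewrite ?(ltW d0) ?(ltW C00) //.
    apply: le_trans q1.
    have -> : (2 * r + 4) ^+ 2 * d * C0 * L ^+ 2 = ((2 * r + 4) * L) ^+ 2 * d * C0 by ring.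
    do 2! (apply: ler_wpM2r; first exact: ltW).
    by rewrite lerXn2r ?nnegrE.
  by rewrite ler_expR; move: Mell; clear; lra.
have T3 : \sum_(m < M.+1) \sum_(k < (M ^ 2).+1 | (m <= k.+1)%N)
      expR L ^+ m * (m%:R ^+ 2) ^+ k * S.+1%:R ^+ k *
      ((d / expR L * C0) ^+ k * expR (- ((r - (k%:R - m%:R)) * (gam * L) - k%:R)))
   <= expR (eps / 4 * L) * expR (- (r * (gam * L)) + (L - gam * L) + M%:R * q).
  apply: le_trans (_ : \sum_(m < M.+1) \sum_(k < (M ^ 2).+1)
    expR (- (r * (gam * L)) + (L - gam * L) + M%:R * q) <= _).
    apply: ler_sum => m _; rewrite big_mkcond /=; apply: ler_sum => k _.
    case: ifP => // mk; apply: heavy_term_le; rewrite ?(ltW d0) ?(ltW C00) //.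
    - by rewrite -ltnS.
    - by move: q5; clear; lra.
    - apply: le_trans q2.
      have -> : (2 * r + 3) ^+ 2 * (r + 3) * d * C0 * expR 1 * L ^+ 3 =
        ((2 * r + 3) * L) ^+ 2 * ((r + 3) * L) * d * C0 * expR 1 by ring.
      do 3! (apply: ler_wpM2r; first by rewrite ?expR_ge0 // ltW).
      apply: ler_pM; rewrite ?exprn_ge0 //.
      by rewrite lerXn2r ?nnegrE.
  rewrite !sumr_const !card_ord -[X in X *+ _]mulr_natl -[X in X <= _]mulr_natl mulrA.
  apply: ler_wpM2r; first exact: expR_ge0.
  apply: le_trans q3.
  have -> : (2 * r + 4) * ((2 * r + 3) ^+ 2 + 1) * L ^+ 3 =
     ((2 * r + 4) * L) * (((2 * r + 3) ^+ 2 + 1) * L ^+ 2) by ring.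
  apply: ler_pM => //.
  rewrite -natr1 natrX mulrDl mul1r -exprMn lerD //.
    by rewrite lerXn2r ?nnegrE.
  by rewrite exprn_ege1.
have T4 : expR (eps / 4 * L) * expR (- (r * (gam * L)) + (L - gam * L) + M%:R * q)
    <= expR (- (r * L) + 3 / 4 * eps * L).
  rewrite -expRD ler_expR.
  by move: fin1 Mq; clear; lra.
have T5 : expR (- (r * L)) <= expR (- (r * L) + 3 / 4 * eps * L).
  by rewrite ler_expR lerDl !mulr_ge0 // ltW.
have -> : (- r + eps) * L = eps / 4 * L + (- (r * L) + 3 / 4 * eps * L) by clear; lra.
rewrite expRD.
apply: le_trans (_ : 3 * expR (- (r * L) + 3 / 4 * eps * L) <= _); last first.
  by rewrite ler_wpM2r ?expR_ge0.
have := le_trans T3 T4; move: (le_trans T1 T5) (le_trans T2 T5); clear.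
move: (light_bound _ _ _ _) (_ * expR (- (M%:R * _))) => z1 z2.
set zz := \sum_(m < M.+1) _; set yy := expR (_ + _); move: zz yy => zz yy.
lra.
Qed.

(** [a = (2 - al) / 4] makes [a / al + 1 / 2 < 1 / al], so that the light part is
    negligible; [gam] and [kap] share the error [eps * L] between the loss in the
    threshold and the polynomial factors. *)
Lemma upper_params (d al de C0 r eps : R) :
  0 < d -> 0 < al -> al < 2 -> 0 < de -> 0 < C0 -> 0 <= r -> 0 < eps -> eps <= 1 ->
  \forall L \near +oo, exists a0 b M S : nat, exists ell c t2 : R,
  [/\ [/\ 0 < ell, 0 < c & 0 < t2], (a0 + 2 * b)%:R <= c ^+ 2,
      (r + 1) * (t2 / (1 + de)) `^ al <= S%:R,
      ell `^ al^-1 * c + t2 <= (1 + de) * L `^ al^-1 &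
      total_bound d C0 r L ((t2 / (1 + de)) `^ al) ell a0 b M S <= expR ((- r + eps) * L)].
Proof.
move=> d0 al0 al2 de0 C00 r0 eps0 eps1.
have d1 : 0 < 1 + de by rewrite addr_gt0.
have [a aE] : {a | a = (2 - al) / 4} by exists ((2 - al) / 4).
have [gam gamE] : {x | x = 1 - eps / (4 * (r + 1))} by exists (1 - eps / (4 * (r + 1))).
have [kb kbE] : {x | x = (r + 3) * (d * expR 1) + r + 2}.
  by exists ((r + 3) * (d * expR 1) + r + 2).
have [K1 K1E] : {x | x = r + 3 + 2 * (kb + 1)} by exists (r + 3 + 2 * (kb + 1)).
have [kap kapE] : {x | x = eps / (4 * (2 * r + 3))} by exists (eps / (4 * (2 * r + 3))).
have [E EE] : {E | E = expR (d * expR 1) + expR d} by exists (expR (d * expR 1) + expR d).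
have a_gt0 : 0 < a by lra.
have a_lt1 : a < 1 by lra.
have kap0 : 0 < kap by rewrite kapE divr_gt0 // mulr_gt0 //; lra.
have r4 : 0 < 4 * (r + 1) by lra.
have gam1 : gam < 1 by rewrite gamE gtrBl divr_gt0.
have gam0 : 0 < gam by rewrite gamE subr_gt0 ltr_pdivrMr //; lra.
have eps_gam : (r + 1) * (1 - gam) = eps / 4 by rewrite gamE; field; lra.
have gal1 : gam `^ al^-1 < 1.
  have := @gt0_ltr_powR R al^-1; rewrite invr_gt0 => /(_ al0 gam 1).
  rewrite !nnegrE (ltW gam0) ler01 => /(_ isT isT gam1).
  by rewrite powR1.
have eps4 : 0 < eps / 4 by rewrite divr_gt0.
have [A1 A1E] : {x | x = (2 * r + 4) ^+ 2 * d * C0} by exists ((2 * r + 4) ^+ 2 * d * C0).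
have [A2 A2E] : {x | x = (2 * r + 3) ^+ 2 * (r + 3) * d * C0 * expR 1}.
  by exists ((2 * r + 3) ^+ 2 * (r + 3) * d * C0 * expR 1).
have Q1 := @poly_le_exp_powR R A1 2^-1 a 2 (ltac:(by [])) a_gt0.
have Q2 := @poly_le_exp_powR R A2 kap a 3 kap0 a_gt0.
have Q3 := @poly_le_exp_powR R ((2 * r + 4) * ((2 * r + 3) ^+ 2 + 1)) (eps / 4) 1 3 eps4 ltr01.
have Q4 := @poly_le_exp_powR R 3 (eps / 4) 1 0 eps4 ltr01.
have Q5 := @powR_lt_powR R kap (1 - gam) a 1 (ltac:(by rewrite subr_gt0)) a_lt1.
have alc : a / al + 2^-1 < al^-1.
  by rewrite -(ltr_pM2r al0) mulVf ?gt_eqF // mulrDl divfK ?gt_eqF //; lra.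
have Q6 := @powR_lt_powR R (K1 `^ (2^-1)) ((1 + de) * (1 - gam `^ al^-1)) _ _
  (ltac:(by rewrite mulr_gt0 // subr_gt0)) alc.
have Q7 := nbhs_pinfty_ge (num_real (1 : R)).
have Q8 := nbhs_pinfty_ge (num_real E).
apply: filterS (filterI (filterI (filterI Q1 Q2) (filterI Q3 Q4))
  (filterI (filterI Q5 Q6) (filterI Q7 Q8))) => L /=.
move=> [[[q1 q2] [q3 q4]] [[q5 q6] [L1 LE]]].
have L0 : 0 <= L by lra.
rewrite powRr1 // in q3 q4 q5; rewrite expr0 mulr1 in q4.
rewrite A1E in q1; rewrite A2E in q2.
apply: (@upper_params_at d al de C0 r eps a gam kb K1 kap L) => //.
by rewrite -EE; apply: le_trans LE _; apply: le_trans (expR_ge1Dx L); rewrite lerDr.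
Qed.

End UpperParams.

(** Transfers asymptotics in the real variable L to L = ln n. *)
Lemma near_ln (R : realType) (Q : R -> Prop) :
  (\forall L \near +oo, Q L) -> \forall n \near \oo, Q (ln (n%:R : R)).
Proof.
move=> [M [_ hM]]; near=> n; apply: hM.
have h : expR M < n%:R by near: n; exact: nbhs_infty_gtr.
by rewrite -ltr_expR lnK // posrE; apply: lt_trans h; exact: expR_gt0.
Unshelve. all: by end_near. Qed.

Section UpperProbability.
Context (R : realType) (disp : nat -> measure_display)
  (T : forall n : nat, measurableType (disp n))
  (P : forall n : nat, probability (T n) R)
  (d al de : R) (mu : probability R R)
  (G : forall n : nat, 'I_n * 'I_n -> {RV (P n) >-> bool})
  (Y : forall n : nat, 'I_n * 'I_n -> {RV (P n) >-> R}).
Hypotheses (d0 : 0 < d) (al0 : 0 < al) (al2 : al < 2) (de0 : 0 < de).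
Hypothesis wb : weibull al mu.
Hypothesis model : forall n : nat, d <= n%:R ->
    [/\ erdos_renyi (P n) (d / n%:R) (@G n),
        iid_symmetric (P n) mu (@Y n) &
        independent_families (P n) (@G n) (@Y n)].

Definition top_event (n : nat) : set (T n) :=
  [set w | (1 + de) * heavy_scale al n <= lambda1 (sparse_mx (@G n) (@Y n) w)].

Lemma top_event_upper (r eps : R) : 0 <= r -> 0 < eps -> eps <= 1 ->
  (forall n (g : rel 'I_n) (C : {set 'I_n}) (B : 'M[R]_n) u t,
    symmetric g -> irreflexive g -> (forall i j, B i j = B j i) ->
    (forall i j, ~~ g i j -> B i j = 0) -> (forall i, i \notin C -> u i = 0) ->
    sqn u = 1 -> 0 < t -> t <= qf B u -> connected_set g C ->
    (r - (#|gedges g C|%:R - #|C|%:R)) * (t / (1 + de)) `^ al <= cost g C B al) ->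
  \forall n \near \oo, pr (P n) (@top_event n) <= expR ((- r + eps) * ln n%:R).
Proof.
move=> r0 eps0 eps1 rate_cost.
have [C0 C00 tail] := weibull_tail_le al0 wb.
have par := near_ln (upper_params d0 al0 al2 de0 C00 r0 eps0 eps1).
near=> n.
have n0 : (0 < n)%N by near: n; exact: nbhs_infty_gt.
have nR : 0 < n%:R :> R by rewrite ltr0n.
have dn : d <= n%:R by near: n; exact: nbhs_infty_ger.
have [er iid ind] := model dn.
have [a0 [b [M [S [ell [c [t2 [[ell0 c0 t20] abc SB tt hb]]]]]]]] :
  exists a0 b M S : nat, exists ell c t2 : R,
  [/\ [/\ 0 < ell, 0 < c & 0 < t2], (a0 + 2 * b)%:R <= c ^+ 2,
      (r + 1) * (t2 / (1 + de)) `^ al <= S%:R,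
      ell `^ al^-1 * c + t2 <= (1 + de) * (ln n%:R) `^ al^-1 &
      total_bound d C0 r (ln n%:R) ((t2 / (1 + de)) `^ al) ell a0 b M S
        <= expR ((- r + eps) * ln n%:R)].
  by near: n; exact: par.
have p0 : 0 <= d / n%:R by rewrite divr_ge0 // ltW.
have up := sparse_top_upper er iid ind n0 p0 al0 C00 tail (rate_cost n) M ell0 c0 t20 abc SB.
apply: le_trans hb; apply: le_trans (le_trans _ up) _.
  apply: pr_le; [exact: (measurable_sparse_top er iid)|exact: (measurable_sparse_top er iid)|].
  by move=> w; exact: le_trans.
rewrite /total_bound /light_bound /heavy_s lnK ?posrE //.
rewrite natrM ![n%:R * (expR 1 * _)]mulrCA ![n%:R * (d / _)]mulrCA divff ?gt_eqF // mulr1.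
have -> : a0%:R * n%:R * (expR 1 * (d / n%:R)) = a0%:R * (d * expR 1).
  by field; rewrite gt_eqF.
by rewrite (mulrC (expR 1)).
Unshelve. all: by end_near. Qed.

End UpperProbability.

(** * Families of cliques *)

Section Bonferroni.
Context d (T : measurableType d) (R : realType) (P : probability T R).

Lemma pr_setU_ge (A B : set T) : measurable A -> measurable B ->
  pr P A + pr P B - pr P (A `&` B) <= pr P (A `|` B).
Proof.
move=> mA mB.
have mAB : measurable (A `&` B) by exact: measurableI.
have mU : measurable (A `|` B) by exact: measurableU.
have h : (P (A `|` B) = P A + P B - P (A `&` B))%E.
  by apply: measureUfinl => //; rewrite (le_lt_trans (probability_le1 _ mA)) // ltry.
by move: h; rewrite !prE // => -[->].
Qed.

(** Second Bonferroni inequality, by induction on the list of events. *)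
Lemma bonferroni_seq (I : eqType) (r : seq I) (A : I -> set T) :
  (forall i, measurable (A i)) -> uniq r ->
  \sum_(i <- r) (pr P (A i) - \sum_(j <- r | j != i) pr P (A i `&` A j)) <=
  pr P (\big[setU/set0]_(i <- r) A i).
Proof.
move=> mA; elim: r => [|i r IH] /=.
  by rewrite !big_nil pr_ge0.
move=> /andP[ir ur]; have {IH} h := IH ur.
have [mU _] := pr_bigU P r predT mA.
rewrite [X in _ <= pr P X]big_cons.
apply: le_trans (pr_setU_ge (mA i) mU).
have hI : pr P (A i `&` \big[setU/set0]_(j <- r) A j) <= \sum_(j <- r) pr P (A i `&` A j).
  have [_ hb] := pr_bigU P r predT (fun j => measurableI _ _ (mA i) (mA j)).
  by apply: le_trans hb; rewrite big_distrr.
rewrite big_cons big_cons eqxx /=.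
have e1 : \sum_(j <- r | j != i) pr P (A i `&` A j) = \sum_(j <- r) pr P (A i `&` A j).
  rewrite big_seq_cond [RHS]big_seq; apply: eq_bigl => j.
  by case: (boolP (j \in r)) => //= jr; apply: contraTneq jr => ->.
have e2 : \sum_(i0 <- r) (pr P (A i0) - \sum_(j <- i :: r | j != i0) pr P (A i0 `&` A j)) <=
  \sum_(i0 <- r) (pr P (A i0) - \sum_(j <- r | j != i0) pr P (A i0 `&` A j)).
  apply: ler_sum => i0 _; rewrite lerD2l lerN2 big_cons.
  by case: ifP => // _; rewrite lerDr pr_ge0.
rewrite e1; lra.
Qed.

(** If each event overlaps the others by at most half of its probability, the
    union has at least half of the total. *)
Lemma half_union_bound (I : finType) (A : I -> set T) :
  (forall i, measurable (A i)) ->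
  (forall i, \sum_(j | j != i) pr P (A i `&` A j) <= 2^-1 * pr P (A i)) ->
  2^-1 * \sum_i pr P (A i) <= pr P (\big[setU/set0]_i A i).
Proof.
move=> mA h; apply: le_trans (bonferroni_seq mA (index_enum_uniq I)).
rewrite mulr_sumr; apply: ler_sum => i _; have := h i; lra.
Qed.

End Bonferroni.

Section CliqueFamily.
Variables (n k m : nat).
Hypothesis kmn : (k * m <= n)%N.
Hypothesis m0 : (0 < m)%N.

Lemma block_lt (i : 'I_k) (y : 'I_m) : (i * m + y < n)%N.
Proof.
apply: leq_trans kmn; apply: (@leq_trans (i.+1 * m)).
  by rewrite mulSn addnC ltn_add2r.
by rewrite leq_mul2r ltn_ord orbT.
Qed.

(** The vertex chosen in block [i], the blocks being consecutive intervals of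
    length [m].  The map is increasing, so edges between chosen vertices are
    upper pairs, and the block of a vertex is recovered by a division. *)
Definition place (y : {ffun 'I_k -> 'I_m}) (i : 'I_k) : 'I_n := Ordinal (block_lt i (y i)).

Lemma place_div y i : (place y i %/ m)%N = i.
Proof. by rewrite /= divnMDl // divn_small // addn0. Qed.

Lemma place_eq y y' i j : place y i = place y' j -> i = j /\ y i = y' j.
Proof.
move=> e; have ij : i = j.
  by apply/val_inj; rewrite /= -(place_div y) -(place_div y') e.
split=> //; move/(congr1 val): e; rewrite /= ij => /addnI h.
exact: val_inj.
Qed.

Lemma place_inj y : injective (place y).
Proof. by move=> i j /place_eq[]. Qed.

Lemma place_lt y (i j : 'I_k) : (i < j)%N -> (place y i < place y j)%N.
Proof.
move=> ij /=; apply: (@leq_trans (i.+1 * m)); first by rewrite mulSn addnC ltn_add2r.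
by apply: leq_trans (leq_addr _ _); rewrite leq_mul2r ij orbT.
Qed.

Definition place2 y (e : 'I_k * 'I_k) : 'I_n * 'I_n := (place y e.1, place y e.2).

Lemma place2_inj y : injective (place2 y).
Proof.
move=> [a b] [a' b'] e.
have /place_eq[/= -> _] := congr1 fst e.
by have /place_eq[/= -> _] := congr1 snd e.
Qed.

Definition clique_edges y : {set 'I_n * 'I_n} := [set place2 y e | e in upper_pairs k].

Lemma clique_edges_upper y : clique_edges y \subset upper_pairs n.
Proof.
apply/fintype.subsetP => f /imsetP [e]; rewrite inE => ij ->.
by rewrite inE /=; exact: (place_lt y ij).
Qed.

Definition agree (y y' : {ffun 'I_k -> 'I_m}) : {set 'I_k} := [set i | y i == y' i].

(** A pair determines the blocks of its endpoints, so common edges of two cliques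
    lie over pairs of blocks on which the two choices agree. *)
Lemma clique_edgesI y y' : clique_edges y' :&: clique_edges y =
  [set place2 y' e | e in gedges (fun _ _ => true) (agree y y')]%SET.
Proof.
apply/finset.setP => f; rewrite inE; apply/andP/imsetP.
  move=> [/imsetP [[i j] ij ->] /imsetP [[a b] _ e]].
  have /place_eq[/= ia yi] := congr1 fst e; have /place_eq[/= jb yj] := congr1 snd e.
  exists (i, j) => //; rewrite inE ij !inE /= yi yj -ia -jb !eqxx //.
move=> [[i j]]; rewrite !inE /= => /and4P[ij /eqP yi /eqP yj _] ->.
split; first by apply/imsetP; exists (i, j) => //; rewrite inE.
apply/imsetP; exists (i, j); first by rewrite inE.
by rewrite /place2; congr pair; apply/val_inj => /=; rewrite ?yi ?yj.
Qed.

Lemma card_new_edges y y' :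
  (#|gedges (fun _ _ => true) (agree y y')| + #|clique_edges y' :\: clique_edges y|
   = #|upper_pairs k|)%N.
Proof.
have <- : #|clique_edges y'| = #|upper_pairs k| by rewrite card_imset //; exact: place2_inj.
by rewrite -(cardsID (clique_edges y) (clique_edges y')) clique_edgesI card_imset //; exact: place2_inj.
Qed.

(** Once fixed on [J], a choice is free in the remaining blocks only. *)
Lemma card_agree (y : {ffun 'I_k -> 'I_m}) (J : {set 'I_k}) :
  (#|[set y' | agree y y' == J]%SET| <= m ^ (k - #|J|))%N.
Proof.
pose F (i : 'I_k) : {pred 'I_m} := if i \in J then pred1 (y i) else predT.
apply: (@leq_trans #|family F|).
  apply: subset_leq_card; apply/fintype.subsetP => y'; rewrite inE => /eqP yJ.
  apply/familyP => i; rewrite /F; case: ifP => // iJ.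
  by move: iJ; rewrite -yJ inE inE => /eqP ->.
rewrite card_family foldrE big_map big_enum /=.
rewrite (bigID (mem J)) /= big1 ?mul1n; last by move=> i iJ; rewrite /F iJ card1.
rewrite (eq_bigr (fun=> m)) => [|i /negPf iJ]; last by rewrite /F iJ card_ord.
rewrite prod_nat_const (_ : #|_| = (k - #|J|)%N) //.
have := cardsC J; rewrite card_ord => h.
rewrite -[X in (X - _)%N]h addKn; apply: eq_card => i; by rewrite !inE.
Qed.

End CliqueFamily.

Lemma card_gedges_complete (R : realType) k (J : {set 'I_k}) :
  2 * #|gedges (fun _ _ => true) J|%:R = #|J|%:R * (#|J|%:R - 1) :> R.
Proof.
have -> : gedges (fun _ _ => true) J = gedges (fun i j : 'I_k => i != j) J.
  apply/finset.setP => e; rewrite !inE; case: (boolP (e.1 < e.2)%N) => //= ij.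
  by congr [&& _, _ & _]; apply/esym; apply: contraTneq ij => ->; rewrite ltnn.
apply: card_clique_edges => // [i j|i]; first by rewrite eq_sym.
by rewrite eqxx.
Qed.

Lemma card_upper_pairs (R : realType) k :
  2 * #|upper_pairs k|%:R = k%:R * (k%:R - 1) :> R.
Proof.
have := card_gedges_complete R [set: 'I_k]%SET; rewrite cardsT card_ord => <-.
by congr (2 * _%:R); apply: eq_card => e; rewrite !inE /= andbT.
Qed.

Section CliqueEvents.
Context d (T : measurableType d) (R : realType) (P : probability T R).
Variables (n : nat) (p : R) (mu : probability R R).
Variables (G : 'I_n * 'I_n -> {RV P >-> bool}) (Y : 'I_n * 'I_n -> {RV P >-> R}).
Hypothesis er : erdos_renyi P p G.
Hypothesis iid : iid_symmetric P mu Y.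
Hypothesis ind : independent_families P G Y.
Hypothesis p0 : 0 <= p.
Variables (k m : nat) (s : nat -> nat -> R).
Hypothesis kmn : (k * m <= n)%N.
Hypothesis m0 : (0 < m)%N.

(** The threshold on an edge depends only on the blocks of its endpoints; hence it
    is the same for all cliques of the family which contain the edge. *)
Definition above (e : 'I_n * 'I_n) : set R :=
  `[s (e.1 %/ m)%N (e.2 %/ m)%N, +oo[%classic.

Definition clique_event y : set T := edge_event G Y (clique_edges kmn y) above.

Definition clique_prob : R :=
  \prod_(e in upper_pairs k) (p * fine (mu `[s e.1 e.2, +oo[%classic)).

Lemma measurable_above e : measurable (above e).
Proof. exact: measurable_itv. Qed.

Lemma measurable_clique_event y : measurable (clique_event y).
Proof. by apply: measurable_edge_event; exact: measurable_above. Qed.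

Lemma edge_factor_ge0 (B : set R) : 0 <= p * fine (mu B).
Proof. by rewrite mulr_ge0 // fine_ge0. Qed.

Lemma clique_prob_ge0 : 0 <= clique_prob.
Proof. by apply: prodr_ge0 => e _; exact: edge_factor_ge0. Qed.

Lemma prod_clique_edges y :
  \prod_(e in clique_edges kmn y) (p * fine (mu (above e))) = clique_prob.
Proof.
rewrite big_imset /=; last by move=> e e' _ _; exact: (place2_inj m0).
by apply: eq_bigr => e _; rewrite /above !(place_div kmn m0).
Qed.

Lemma pr_clique_event y : pr P (clique_event y) = clique_prob.
Proof.
rewrite (pr_edge_event er iid ind) ?prod_clique_edges //; last exact: measurable_above.
exact: clique_edges_upper.
Qed.

Lemma pr_two_cliques y y' : pr P (clique_event y `&` clique_event y') =
  clique_prob * \prod_(e in clique_edges kmn y' :\: clique_edges kmn y) (p * fine (mu (above e))).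
Proof.
have -> : clique_event y `&` clique_event y' =
    edge_event G Y (clique_edges kmn y :|: clique_edges kmn y') above.
  apply/seteqP; split => w /=.
    by move=> [h h'] e; rewrite inE => /orP[/h|/h'].
  by move=> h; split => e he; apply: h; rewrite inE he ?orbT.
rewrite (pr_edge_event er iid ind); first last.
- exact: measurable_above.
- by rewrite finset.subUset !clique_edges_upper.
rewrite (big_setID (clique_edges kmn y)) /= -(prod_clique_edges y).
congr (_ * _); apply: eq_bigl => e; rewrite !inE; first by case: (e \in _); rewrite ?andbF ?orbT.
by case: (e \in clique_edges kmn y).
Qed.

(** For the new edges of the second clique only their presence is used. *)
Lemma pr_two_cliques_le y y' : p <= 1 ->
  pr P (clique_event y `&` clique_event y') <=
  clique_prob * p ^+ #|clique_edges kmn y' :\: clique_edges kmn y|.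
Proof.
move=> p1; rewrite pr_two_cliques; apply: ler_wpM2l; first exact: clique_prob_ge0.
rewrite -prodr_const; apply: ler_prod => e _; rewrite edge_factor_ge0 /=.
by rewrite ler_piMr // (pr_le1 mu (measurable_above e)).
Qed.

(** Two choices which agree in at most one block share no edge. *)
Lemma pr_two_cliques_small y y' : (#|agree y y'| <= 1)%N ->
  pr P (clique_event y `&` clique_event y') = clique_prob * clique_prob.
Proof.
move=> J1; rewrite pr_two_cliques; congr (_ * _); rewrite -(prod_clique_edges y').
apply: eq_bigl => e; rewrite inE; case: (boolP (e \in clique_edges kmn y')); last by rewrite andbF.
move=> e'; rewrite andbT; apply/negP => ey.
have : e \in clique_edges kmn y' :&: clique_edges kmn y by rewrite inE e' ey.
rewrite clique_edgesI // => /imsetP [[i j]]; rewrite inE /= => /and4P[+ iJ jJ _] _.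
move: J1; rewrite inE /= => J1 ij.
have : [set i; j]%SET \subset agree y y' by rewrite finset.subUset !finset.sub1set iJ jJ.
move=> /subset_leq_card; rewrite cards2.
have -> : i != j by apply: contraTneq ij => ->; rewrite ltnn.
by move=> h; have := leq_trans h J1.
Qed.

Variable D : R.
Hypothesis p1 : p <= 1.
Hypothesis D0 : 0 <= D.
Hypothesis hD : forall (j c : nat), (2 <= j)%N -> (j < k)%N -> (k - j < c)%N ->
  m%:R ^+ (k - j) * p ^+ c <= D.

(** Choices agreeing with [y] in at most one block contribute by independence.
    Those agreeing on [J] with [1 < #|J| < k] number at most [m ^ (k - #|J|)] and
    need more than [k - #|J|] new edges, which is what [D] controls. *)
Lemma overlap_sum y :
  \sum_(y' | y' != y) pr P (clique_event y `&` clique_event y') <=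
  (m%:R ^+ k * clique_prob + 2 ^+ k * D) * clique_prob.
Proof.
have c0 := clique_prob_ge0.
rewrite (bigID (fun y' => (#|agree y y'| <= 1)%N)) /= mulrDl; apply: lerD.
  rewrite (eq_bigr (fun=> clique_prob * clique_prob)) => [|y' /andP[_ h]]; last first.
    exact: pr_two_cliques_small.
  rewrite sumr_const -[X in X <= _]mulr_natl mulrA ler_wpM2r // ler_wpM2r // -natrX ler_nat.
  by apply: leq_trans (max_card _) _; rewrite card_ffun !card_ord.
rewrite (partition_big (agree y) (fun J => (1 < #|J|)%N && (#|J| < k)%N)) /=; last first.
  move=> y' /andP[yy]; rewrite -ltnNge => -> /=.
  rewrite ltn_neqAle; apply/andP; split; last by rewrite -[X in (_ <= X)%N]card_ord max_card.
  apply: contra yy => /eqP hk; have : agree y y' = [set: 'I_k]%SET.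
    by apply/eqP; rewrite finset.eqEcard finset.subsetT cardsT card_ord hk /=.
  move=> hT; apply/eqP/ffunP => i; have : i \in agree y y' by rewrite hT inE.
  by rewrite inE => /eqP.
apply: le_trans (_ : \sum_(J : {set 'I_k}) D * clique_prob <= _); last first.
  rewrite sumr_const -cardsT -powersetT card_powerset cardsT card_ord.
  by rewrite -[X in X <= _]mulr_natl mulrA natrX.
rewrite [X in X <= _]big_mkcond /=; apply: ler_sum => J _.
case: ifP => [/andP[J1 Jk]|_]; last exact: mulr_ge0.
have Jk' : (#|J| <= k)%N by exact: ltnW.
pose c := (#|upper_pairs k| - #|gedges (fun _ _ => true) J|)%N.
have hc : (k - #|J| < c)%N.
  have h1 := card_gedges_complete R J; have h2 := card_upper_pairs R k.
  have h3 : (2 * #|gedges (fun _ _ => true) J| + #|J| = #|J| * #|J|)%N.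
    apply/eqP; rewrite -(eqr_nat R) natrD !natrM h1; apply/eqP; ring.
  have h4 : (2 * #|upper_pairs k| + k = k * k)%N.
    apply/eqP; rewrite -(eqr_nat R) natrD !natrM h2; apply/eqP; ring.
  rewrite /c; move: h3 h4 J1 Jk; clear.
  move: #|gedges _ J| #|upper_pairs k| #|J| => a b j h3 h4 J1 Jk; nia.
apply: le_trans (_ : \sum_(y' | agree y y' == J) clique_prob * p ^+ c <= _).
  rewrite [X in X <= _]big_mkcond [X in _ <= X]big_mkcond /=; apply: ler_sum => y' _.
  case: ifP => [/andP[_ /eqP yJ]|_]; last first.
    by case: ifP => // _; rewrite mulr_ge0 // exprn_ge0.
  rewrite yJ eqxx; apply: le_trans (pr_two_cliques_le _ _ p1) _.
  have := card_new_edges kmn m0 y y'; rewrite yJ => e.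
  by rewrite /c -e addKn.
rewrite sumr_const -[X in X <= _]mulr_natl mulrCA mulrC ler_wpM2r //.
apply: le_trans (hD J1 Jk hc); rewrite ler_wpM2r ?exprn_ge0 // -natrX ler_nat.
apply: leq_trans (card_agree y J); apply: subset_leq_card.
by apply/fintype.subsetP => y'; rewrite inE.
Qed.

Lemma clique_union_ge (B : set T) : measurable B -> 
  (forall y w, clique_event y w -> B w) ->
  m%:R ^+ k * clique_prob + 2 ^+ k * D <= 2^-1 ->
  2^-1 * (m%:R ^+ k * clique_prob) <= pr P B.
Proof.
move=> mB AB half.
have h := half_union_bound measurable_clique_event (P := P).
have [mU _] := pr_bigU P (index_enum _) predT measurable_clique_event.
apply: le_trans (pr_le P mU mB _); last first.
  by move=> w; elim/big_ind: _ => // [A C hA hC [/hA|/hC]|y _ /AB].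
apply: le_trans (h _); last first.
  move=> y; rewrite pr_clique_event; apply: le_trans (overlap_sum y) _.
  by apply: ler_wpM2r => //; exact: clique_prob_ge0.
rewrite (eq_bigr (fun=> clique_prob)) => [|y _]; last exact: pr_clique_event.
by rewrite sumr_const -[X in _ <= _ * X]mulr_natl card_ffun !card_ord natrX.
Qed.

(** The test vector is [v] transported to the chosen vertices. *)
Lemma clique_event_top (v : 'I_k -> R) (t : R) y w : (0 < n)%N ->
  (forall i, 0 <= v i) -> sqn v = 1 ->
  t <= \sum_(i < k) \sum_(j < k | i != j) s (minn i j) (maxn i j) * (v i * v j) ->
  clique_event y w -> t <= lambda1 (sparse_mx G Y w).
Proof.
move=> n0 v0 v1 ht hw.
pose u (a : 'I_n) := \sum_i v i * (a == place kmn y i)%:R.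
have usum (F : 'I_n -> R) : \sum_a F a * u a = \sum_i F (place kmn y i) * v i.
  rewrite /u (eq_bigr (fun a => \sum_i F a * (v i * (a == place kmn y i)%:R))); last first.
    by move=> a _; rewrite mulr_sumr.
  rewrite exchange_big; apply: eq_bigr => i _ /=.
  rewrite (bigD1 (place kmn y i)) //= eqxx mulr1 big1 ?addr0 // => a /negPf ->.
  by rewrite !mulr0.
have uplace i : u (place kmn y i) = v i.
  rewrite /u (bigD1 i) //= eqxx mulr1 big1 ?addr0 // => j ji.
  rewrite (_ : (_ == _) = false) ?mulr0 //; apply/negbTE; apply: contra ji => /eqP.
  by move=> /(place_inj m0) ->.
have u1 : sqn u = 1.
  rewrite -v1 /sqn (eq_bigr (fun a => u a * u a)) => [|a _]; last exact: expr2.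
  by rewrite usum; apply: eq_bigr => i _; rewrite uplace -expr2.
apply/(lambda1_ge t n0 (sparse_mx_sym er iid w)); exists u; rewrite u1 ?mulr1 //.
apply: le_trans ht _.
have -> : qf (sparse_mx G Y w) u = \sum_i \sum_j
    sparse_mx G Y w (place kmn y i) (place kmn y j) * (v i * v j).
  rewrite /qf (eq_bigr (fun a => (\sum_b sparse_mx G Y w a b * u b) * u a)); last first.
    by move=> a _; rewrite mulr_suml; apply: eq_bigr => b _; ring.
  rewrite usum; apply: eq_bigr => i _; rewrite usum mulr_suml.
  by apply: eq_bigr => j _; ring.
have edge (i j : 'I_k) : (i < j)%N -> s i j <= sparse_mx G Y w (place kmn y i) (place kmn y j).
  move=> ij; have := hw (place kmn y i, place kmn y j).
  have -> : (place kmn y i, place kmn y j) \in clique_edges kmn y.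
    by apply/imsetP; exists (i, j); rewrite ?inE.
  move=> /(_ isT) [g]; rewrite /above !(place_div kmn m0) /= in_itv /= andbT => h.
  by rewrite sparse_mxE g.
apply: ler_sum => i _; rewrite big_mkcond /=; apply: ler_sum => j _.
case: (ltngtP i j) => [ij|ji|/val_inj ->].
- rewrite -val_eqE /= ltn_eqF // ler_wpM2r ?mulr_ge0 //; exact: edge.
- rewrite -val_eqE /= gtn_eqF // ler_wpM2r ?mulr_ge0 //.
  by rewrite -(sparse_mx_sym er iid w) mxE; exact: edge.
- by rewrite eqxx /= sparse_mxE (er_irrefl er) mul0r.
Qed.

End CliqueEvents.

Lemma near_le_expR (R : realType) (A c : R) : 0 < c -> \forall L \near +oo, A <= expR (c * L).
Proof.
move=> c0; near=> L.
have h : A / c <= L by near: L; apply: nbhs_pinfty_ge; exact: num_real.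
apply: le_trans (expR_ge1Dx _).
by move: h; rewrite ler_pdivrMr // mulrC => h; lra.
Unshelve. all: by end_near. Qed.

Lemma divn_ge_half (R : realType) n k : (0 < k)%N -> (2 * k <= n)%N ->
  n%:R / (2 * k%:R) <= (n %/ k)%:R :> R.
Proof.
move=> k0 kn; rewrite ler_pdivrMr ?mulr_gt0 ?ltr0n // -natrM -natrM ler_nat.
have := divn_eq n k; have := ltn_pmod n k0.
have : (2 <= n %/ k)%N by rewrite leq_divRL.
move: (n %/ k)%N (n %% k)%N => q r q2 rk e; nia.
Qed.

Section LowerProbability.
Context (R : realType) (disp : nat -> measure_display)
  (T : forall n : nat, measurableType (disp n))
  (P : forall n : nat, probability (T n) R)
  (d al de : R) (mu : probability R R)
  (G : forall n : nat, 'I_n * 'I_n -> {RV (P n) >-> bool})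
  (Y : forall n : nat, 'I_n * 'I_n -> {RV (P n) >-> R}).
Hypotheses (d0 : 0 < d) (al0 : 0 < al) (de0 : 0 < de).
Hypothesis wb : weibull al mu.
Hypothesis model : forall n : nat, d <= n%:R ->
    [/\ erdos_renyi (P n) (d / n%:R) (@G n),
        iid_symmetric (P n) mu (@Y n) &
        independent_families (P n) (@G n) (@Y n)].

Variables (k : nat) (v : 'I_k -> R) (b : nat -> nat -> R).
Hypothesis k2 : (2 <= k)%N.
Hypothesis v0 : forall i, 0 <= v i.
Hypothesis v1 : sqn v = 1.
Hypothesis b0 : forall i j, 0 <= b i j.
Hypothesis bv : 1 <= \sum_(i < k) \sum_(j < k | i != j) b (minn i j) (maxn i j) * (v i * v j).

(** Minus the exponent of n in the expected number of cliques on [k] vertices with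
    weights at least [b i j] times the target eigenvalue. *)
Definition clique_rate : R :=
  k%:R * (k%:R - 3) / 2 + (1 + de) `^ al * \sum_(e in upper_pairs k) b e.1 e.2 `^ al.

Let gam : R := (1 + de) `^ al * \sum_(e in upper_pairs k) b e.1 e.2 `^ al.

(** The Weibull tails at the thresholds [s i j] multiply to the exponential of minus the
    energy, up to constants. *)
Lemma clique_prob_bounds (c0 C0 p L : R) (s : nat -> nat -> R) : 0 < L -> 0 <= p ->
  0 <= c0 -> 0 <= C0 ->
  (forall s, 0 <= s -> c0 * expR (- (s `^ al)) <= fine (mu `[s, +oo[%classic)) ->
  (forall l, fine (mu (pow_ge al l)) <= C0 * expR (- l)) ->
  (forall i j, s i j = b i j * ((1 + de) * L `^ al^-1)) ->
  (p * c0) ^+ #|upper_pairs k| * expR (- (gam * L)) <= clique_prob p mu k s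
  <= (p * C0) ^+ #|upper_pairs k| * expR (- (gam * L)).
Proof.
move=> L0 p0 c00 C00 lo up sE.
have al0' := al0.
have d1 : 0 <= 1 + de by rewrite addr_ge0 // ltW.
have s0 i j : 0 <= s i j by rewrite sE !mulr_ge0 ?powR_ge0.
have gE : expR (- (gam * L)) = \prod_(e in upper_pairs k) expR (- (s e.1 e.2 `^ al)).
  rewrite -expR_sum sumrN; congr (expR (- _)).
  rewrite /gam -mulrA mulrC -mulrA mulr_suml; apply: eq_bigr => e _.
  rewrite sE !powRM ?mulr_ge0 ?powR_ge0 // -powRrM mulVf ?gt_eqF // powRr1 ?(ltW L0) //.
  ring.
rewrite gE -!prodr_const -!big_split /clique_prob /=.
apply/andP; split; apply: ler_prod => e _; apply/andP; split.
- by rewrite !mulr_ge0 ?expR_ge0.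
- by rewrite -mulrA ler_wpM2l // lo.
- by rewrite mulr_ge0 // fine_ge0.
- rewrite -mulrA ler_wpM2l //; apply: le_trans (up _).
  apply: (pr_le mu); [exact: measurable_itv|exact: measurable_pow_ge|].
  move=> y /=; rewrite in_itv /= andbT /pow_ge /= => sy.
  have y0 : 0 <= y by apply: le_trans sy.
  by rewrite ger0_norm // ge0_ler_powR ?nnegrE // ltW.
Qed.

(** The number of choices and the probability of the edges contribute
    [k - k (k - 1) / 2 = - k (k - 3) / 2] to the exponent of n. *)
Lemma pairs_exponent (L : R) : k%:R * L - #|upper_pairs k|%:R * L - gam * L = - clique_rate * L.
Proof.
have h := card_upper_pairs R k.
have -> : clique_rate = k%:R * (k%:R - 3) / 2 + gam by [].
have -> : #|upper_pairs k|%:R = k%:R * (k%:R - 1) / 2 :> R by lra.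
by field.
Qed.

(** The expected number of good choices is of order [n ^ - clique_rate], which
    tends to 0, so half of it survives in the Bonferroni inequality. *)
Lemma top_event_lower (eps : R) : 0 < clique_rate -> 0 < eps ->
  \forall n \near \oo, expR ((- clique_rate - eps) * ln n%:R) <= pr (P n) (@top_event R disp T P al de G Y n).
Proof.
move=> ka0 eps0.
have [C0 C00 up] := weibull_tail_le al0 wb.
have [c0 c00 lo] := weibull_tail_ge wb.
have kk : (0 < k)%N by apply: leq_trans k2.
have kR : 0 < k%:R :> R by rewrite ltr0n.
have [c cE] : {c | c = #|upper_pairs k|} by exists #|upper_pairs k|.
have [K KE] : {K : R | K = (2 * k%:R) ^- k * (d * c0) ^+ c} by exists ((2 * k%:R) ^- k * (d * c0) ^+ c).
have K0 : 0 < K.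
  by rewrite KE mulr_gt0 ?invr_gt0 ?exprn_gt0 ?mulr_gt0.
have e1 := near_ln (near_le_expR (4 * (d * C0) ^+ c) ka0).
have e2 := near_ln (near_le_expR (4 * (2 ^+ k * (1 + d) ^+ k)) (@ltr01 R)).
have e3 := near_ln (near_le_expR (2 / K) eps0).
near=> n.
have n0 : (0 < n)%N by near: n; exact: nbhs_infty_gt.
have nR : 0 < n%:R :> R by rewrite ltr0n.
have dn : d <= n%:R by near: n; exact: nbhs_infty_ger.
have n1 : 1 < n%:R :> R by near: n; exact: nbhs_infty_gtr.
have kn : (2 * k <= n)%N by near: n; exact: nbhs_infty_ge.
have [er iid ind] := model dn.
have E1 : 4 * (d * C0) ^+ c <= expR (clique_rate * ln n%:R) by near: n; exact: e1.
have E2 : 4 * (2 ^+ k * (1 + d) ^+ k) <= expR (1 * ln n%:R) by near: n; exact: e2.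
have E3 : 2 / K <= expR (eps * ln n%:R) by near: n; exact: e3.
set L := ln n%:R in E1 E2 E3 *.
have nL : n%:R = expR L by rewrite /L lnK.
have L0 : 0 < L by exact: ln_gt0.
clearbody L.
rewrite mul1r in E2.
set m := (n %/ k)%N.
have m0 : (0 < m)%N by rewrite /m divn_gt0 // (leq_trans _ kn) // leq_pmull.
have kmn : (k * m <= n)%N by rewrite /m mulnC leq_trunc_div.
pose s i j := b i j * ((1 + de) * L `^ al^-1).
have p0 : 0 <= d / n%:R by rewrite divr_ge0 // ltW.
have p1 : d / n%:R <= 1 by rewrite ler_pdivrMr // mul1r.
have /andP[lob upb] := clique_prob_bounds L0 p0 (ltW c00) (ltW C00) lo up (fun i j => erefl (s i j)).
have mn : m%:R <= n%:R :> R by rewrite ler_nat leq_div.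
have mh : n%:R / (2 * k%:R) <= m%:R :> R by apply: divn_ge_half.
have norm (x : R) : n%:R ^+ k * ((d / n%:R * x) ^+ c * expR (- (gam * L))) =
    (d * x) ^+ c * expR (- clique_rate * L).
  rewrite -pairs_exponent -cE nL !expRB !expRM_natl expRN !exprMn exprVn.
  ring.
have hi : m%:R ^+ k * clique_prob (d / n%:R) mu k s <= (d * C0) ^+ c * expR (- clique_rate * L).
  rewrite -norm cE; apply: ler_pM => //.
  - exact: clique_prob_ge0.
  - by rewrite lerXn2r ?nnegrE // ltW.
have low : K * expR (- clique_rate * L) <= m%:R ^+ k * clique_prob (d / n%:R) mu k s.
  rewrite KE -mulrA -norm mulrA -exprVn -exprMn cE; apply: ler_pM => //.
  - by rewrite mulr_ge0 ?expR_ge0 // exprn_ge0 // mulr_ge0 // ltW.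
  - by rewrite lerXn2r ?nnegrE // mulrC.
(* Choices sharing at least two vertices lose a factor 1 / n. *)
pose D : R := (1 + d) ^+ k / n%:R.
have D0 : 0 <= D by rewrite divr_ge0 ?exprn_ge0 ?addr_ge0 // ltW.
have hD (j c' : nat) : (2 <= j)%N -> (j < k)%N -> (k - j < c')%N ->
    m%:R ^+ (k - j) * (d / n%:R) ^+ c' <= D.
  move=> j2 jk jc.
  apply: le_trans (_ : m%:R ^+ (k - j) * (d / n%:R) ^+ (k - j).+1 <= _).
    by apply: ler_wpM2l; [exact: exprn_ge0 | exact: ler_wiXn2l].
  rewrite exprS mulrCA -exprMn.
  apply: le_trans (_ : d / n%:R * d ^+ (k - j) <= _).
    apply: ler_wpM2l => //; rewrite lerXn2r ?nnegrE ?mulr_ge0 ?(ltW d0) //.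
    by rewrite mulrCA ler_piMr ?(ltW d0) // ler_pdivrMr // mul1r.
  rewrite /D mulrAC -exprS ler_wpM2r ?invr_ge0 ?(ltW nR) //.
  apply: le_trans (_ : (1 + d) ^+ (k - j).+1 <= _).
    by rewrite lerXn2r ?nnegrE ?addr_ge0 ?(ltW d0) // lerDr.
  by apply: ler_weXn2l; rewrite ?lerDl ?(ltW d0) // ltn_subrL (ltnW j2) kk.
have half : m%:R ^+ k * clique_prob (d / n%:R) mu k s + 2 ^+ k * D <= 2^-1.
  have h1 : (d * C0) ^+ c * expR (- clique_rate * L) <= 4^-1.
    by rewrite mulNr expRN ler_pdivrMr ?expR_gt0 // ler_pdivlMl.
  have h2 : 2 ^+ k * D <= 4^-1.
    by rewrite /D mulrA nL ler_pdivrMr ?expR_gt0 // ler_pdivlMl.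
  have h3 := lerD (le_trans hi h1) h2; apply: le_trans h3 _; lra.
have mB : measurable (@top_event R disp T P al de G Y n).
  exact: (measurable_sparse_top er iid).
apply: le_trans (clique_union_ge (kmn := kmn) er iid ind p0 m0 p1 D0 hD mB _ half); last first.
  move=> y w hw; rewrite /top_event /= /heavy_scale.
  apply: (clique_event_top er iid m0 n0 v0 v1 _ hw).
  have -> : ln n%:R = L by rewrite nL expRK.
  have -> : \sum_(i < k) \sum_(j < k | i != j) s (minn i j) (maxn i j) * (v i * v j) =
     (\sum_(i < k) \sum_(j < k | i != j) b (minn i j) (maxn i j) * (v i * v j)) *
      ((1 + de) * L `^ al^-1).
    rewrite mulr_suml; apply: eq_bigr => i _; rewrite mulr_suml; apply: eq_bigr => j _.
    by rewrite /s; ring.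
  by rewrite ler_peMl // mulr_ge0 ?powR_ge0 // addr_ge0 // ltW.
apply: le_trans (_ : 2^-1 * (K * expR (- clique_rate * L)) <= _); last first.
  by rewrite ler_pM2l.
rewrite mulrBl expRB ler_pdivrMr ?expR_gt0 //.
have -> : 2^-1 * (K * expR (- clique_rate * L)) * expR (eps * L) =
  expR (- clique_rate * L) * (2^-1 * (expR (eps * L) * K)) by ring.
move: E3; rewrite ler_pdivrMr // => E3.
by rewrite ler_peMr ?expR_ge0 // -ler_pdivrMl ?invr_gt0 // invrK mulr1.
Unshelve. all: by end_near. Qed.

End LowerProbability.

(** * The rate function *)

Section PsiFacts.
Variable R : realType.

Lemma powR_anti (x y r : R) : 0 < x -> x <= y -> r <= 0 -> y `^ r <= x `^ r.
Proof.
move=> x0 xy r0; have y0 : 0 < y by apply: lt_le_trans xy.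
have [q q0 ->] : exists2 q, 0 <= q & r = - q by exists (- r); rewrite ?opprK ?oppr_ge0.
rewrite !powRN lef_pV2 ?posrE ?powR_gt0 //.
by apply: ge0_ler_powR; rewrite ?nnegrE // ltW.
Qed.

Lemma sum_off_diagonal k (F : 'I_k -> 'I_k -> R) : (forall i j, F i j = F j i) ->
  \sum_(i < k) \sum_(j < k | i != j) F i j = 2 * \sum_(e in upper_pairs k) F e.1 e.2.
Proof.
move=> Fs; transitivity (\sum_i \sum_j (if i != j then F i j else 0)).
  by apply: eq_bigr => i _; rewrite big_mkcond.
rewrite sum_sym_pairs => [|i j|i]; last by rewrite eqxx.
  congr (2 * _); apply: eq_bigr => e; rewrite inE => ij.
  by have -> : e.1 != e.2 by apply: contraTneq ij => ->; rewrite ltnn.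
by rewrite eq_sym Fs.
Qed.

Variables (al be de : R).
Hypotheses (al1 : 1 < al) (be2 : 2 < be) (conj : al^-1 + be^-1 = 1) (de0 : 0 < de).

Lemma conj_mul : al * be = al + be.
Proof.
have a0 : al != 0 by rewrite gt_eqF // (lt_trans ltr01 al1).
have b0 : be != 0 by rewrite gt_eqF // (lt_trans _ be2).
have : al * be * (al^-1 + be^-1) = al + be by field; exact/andP.
by rewrite conj mulr1.
Qed.

Let th1 : 1 <= be / 2. Proof. by rewrite ler_pdivlMr // mul1r ltW. Qed.

(** With two coordinates of sum 1 the product is at most 1 / 4. *)
Lemma phi2_le : phi (be / 2) 2 <= 2 `^ (1 - be).
Proof.
rewrite leNgt; apply/negP => /(phi_approx (ltn0Sn 1) th1) [v v1].
apply/negP; rewrite -leNgt.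
have hs : pairsum (be / 2) v = 2 * ((`|v 0 ord0| * `|v 0 ord_max|) `^ (be / 2)).
  rewrite /pairsum sum_off_diagonal; last by move=> i j; rewrite mulrC.
  congr (2 * _); rewrite (bigD1 (ord0, ord_max)) /= ?inE //.
  rewrite big1 ?addr0 ?powRM // => -[[i ii] [j jj]]; rewrite inE /= => /andP[ij].
  by case: i ii ij => [|[|]] //; case: j jj => [|[|]].
rewrite hs; move: v1; rewrite /norm1 big_ord_recl big_ord1.
have -> : lift ord0 ord0 = ord_max :> 'I_2 by apply/val_inj.
have x0 := normr_ge0 (v 0 ord0); have y0 := normr_ge0 (v 0 ord_max).
move: (`|v 0 ord0|) (`|v 0 ord_max|) x0 y0 => x y x0 y0 xy.
have h4 : x * y <= 2 `^ (- 2).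
  rewrite powRN powR_mulrn //; have -> : (2 ^+ 2)^-1 = 1 / 4 :> R by field.
  have := sqr_ge0 (x - y); have : (x + y) ^+ 2 = 1 by rewrite xy expr1n.
  lra.
have h0 : 0 <= be / 2 by apply: le_trans th1.
have := ge0_ler_powR h0 (mulr_ge0 x0 y0 : _ \in Num.nneg) (powR_ge0 _ _ : _ \in Num.nneg) h4.
rewrite -powRrM => h5.
have -> : 2 `^ (1 - be) = 2 * 2 `^ (- 2 * (be / 2)) :> R.
  rewrite -[X in X * _](powRr1 (ler0n R 2)) -powRD ?pnatr_eq0 ?implybT //.
  by congr (_ `^ _); field.
by rewrite ler_pM2l.
Qed.

(** At [k = 2] the power of [phi] is at least 2 because
    [(1 - be) * (1 - al) = 1] for conjugate exponents; the rate is the one of a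
    single large edge. *)
Lemma psi2_ge : (1 + de) `^ al - 1 <= psi al be de 2.
Proof.
have p0 := @phi_gt0 R (be / 2) 2 isT th1.
have al1' := al1.
have h := powR_anti p0 phi2_le (_ : 1 - al <= 0).
have {}h : 2 <= phi (be / 2) 2 `^ (1 - al).
  apply: le_trans (h _); last lra.
  rewrite -powRrM; have -> : (1 - be) * (1 - al) = 1.
    have := conj_mul; set z := al * be => zE.
    have -> : (1 - be) * (1 - al) = 1 - al - be + z by rewrite /z; ring.
    by rewrite zE; ring.
  by rewrite powRr1.
have pw := powR_ge0 (1 + de) al.
rewrite /psi; have := ler_wpM2l pw h; lra.
Qed.

Lemma psi_gt0 k : (2 <= k)%N -> 0 < psi al be de k.
Proof.
move=> k2; have al1' := al1; have de0' := de0.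
have d1 : 1 < (1 + de) `^ al.
  have := @gt0_ltr_powR R al (lt_trans ltr01 al1) 1 (1 + de).
  rewrite powR1 !nnegrE ler01 => h; apply: h => //; lra.
move: k2; rewrite leq_eqVlt => /predU1P[<-|k3].
  by apply: lt_le_trans psi2_ge; lra.
rewrite /psi; apply: ltr_wpDl; last first.
  apply: mulr_gt0; last by apply: powR_gt0; apply: phi_gt0 => //; exact: ltnW.
  by rewrite mulr_gt0 // powR_gt0; lra.
have : 3%:R <= k%:R :> R by rewrite ler_nat.
by move=> h; rewrite !mulr_ge0 // subr_ge0.
Qed.

(** The quadratic term of [psi] exceeds [psi 2] beyond some bound, so the minimum
    is over finitely many sizes. *)
Lemma psi_min : exists2 k0 : nat, (2 <= k0)%N &
  forall k, (2 <= k)%N -> psi al be de k0 <= psi al be de k.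
Proof.
have [N hN] : exists N : nat, psi al be de 2 <= N%:R.
  exists (Num.truncn `|psi al be de 2|).+1.
  have /andP[_ /ltW h] := truncn_itv (normr_ge0 (psi al be de 2)).
  by apply: le_trans h; exact: ler_norm.
have i2 : (2 < N + 5)%N by rewrite addnS ltnS addnS ltnS addnS.
pose i0 := Ordinal i2.
have := @arg_minP _ _ _ i0 (fun i : 'I_(N + 5) => (2 <= i)%N) (fun i => psi al be de i).
case=> // k0 k02 kmin.
exists k0 => // k k2; have [kN|Nk] := ltnP k (N + 5).
  exact: (kmin (Ordinal kN)).
apply: le_trans (kmin i0 isT) _; apply: le_trans hN _.
have h5 : (N%:R + 5 : R) <= k%:R by rewrite -(natrD R N 5) ler_nat.
have N0 : 0 <= N%:R :> R by [].
rewrite /psi; apply: le_trans (_ : k%:R * (k%:R - 3) / 2 <= _).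
  have h : 0 <= k%:R * (k%:R - 5) :> R by rewrite mulr_ge0 //; lra.
  lra.
by rewrite lerDl mulr_ge0 ?powR_ge0 // mulr_ge0 ?powR_ge0.
Qed.

(** Equality in Hoelder's inequality: for a near-maximiser of the pair sum [S],
    with square roots as test vector, the weights are proportional to
    [(v i * v j) `^ (be - 1)]. *)
Lemma clique_choice k eps : (2 <= k)%N -> 0 < eps ->
  exists (v : 'I_k -> R) (b : nat -> nat -> R),
  [/\ forall i, 0 <= v i, sqn v = 1, forall i j, 0 <= b i j,
   1 <= \sum_(i < k) \sum_(j < k | i != j) b (minn i j) (maxn i j) * (v i * v j) &
   psi al be de k <= clique_rate al de k b <= psi al be de k + eps].
Proof.
move=> k2 eps0; have k0 : (0 < k)%N by apply: leq_trans k2.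
have al1' := al1; have be2' := be2; have de0' := de0.
have al0 : 0 < al by lra.
pose th := be / 2.
have ph0 : 0 < phi th k by exact: phi_gt0.
have dp : 0 < 2^-1 * (1 + de) `^ al by rewrite mulr_gt0 // powR_gt0; lra.
have [e' e'E] : {e' | e' = eps / (2^-1 * (1 + de) `^ al)} by exists (eps / (2^-1 * (1 + de) `^ al)).
have e'0 : 0 < e' by rewrite e'E divr_gt0.
(* The function [S `^ (1 - al)] decreases and is [e'] larger at [x] than at [phi th k]. *)
pose x := (phi th k `^ (1 - al) + e') `^ (1 - al)^-1.
have q0 : 0 < phi th k `^ (1 - al) + e' by rewrite addr_gt0 // powR_gt0.
have x0 : 0 < x by exact: powR_gt0.
have aln : 1 - al != 0 by rewrite lt_eqF //; lra.
have aln0 : 1 - al <= 0 by lra.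
have xE : x `^ (1 - al) = phi th k `^ (1 - al) + e'.
  by rewrite /x -powRrM mulVf // powRr1 // ltW.
have xph : x < phi th k.
  rewrite ltNge; apply/negP => h; have := powR_anti ph0 h aln0.
  by rewrite xE leNgt ltrDl e'0.
have [v0 n1 xS] := phi_approx k0 th1 xph.
set S := pairsum th v0 in xS.
have S0 : 0 < S by exact: lt_trans xS.
have Sph : S <= phi th k by exact: pairsum_le_phi.
pose v i := `|v0 0 i| `^ 2^-1.
(* [v] extended by 0, since the weights are indexed by natural numbers *)
pose w (i : nat) := if insub i is Some i' then v i' else 0.
have wE (i : 'I_k) : w i = v i by rewrite /w valK.
have v_ge0 i : 0 <= v i by exact: powR_ge0.
have w_ge0 i : 0 <= w i by rewrite /w; case: insubP.
pose b i j := (w i * w j) `^ (be - 1) / S.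
have bE (i j : 'I_k) : b (minn i j) (maxn i j) = (v i * v j) `^ (be - 1) / S.
  rewrite /b; case: (leqP i j) => ij.
    by rewrite !wE.
  by rewrite !wE (mulrC (v j)).
have vb i j : (v i * v j) `^ be = `|v0 0 i| `^ th * `|v0 0 j| `^ th.
  by rewrite powRM // /v -!powRrM (mulrC 2^-1 be).
have SE : S = 2 * \sum_(e in upper_pairs k) (v e.1 * v e.2) `^ be.
  rewrite /S /pairsum sum_off_diagonal; last by move=> i j; rewrite mulrC.
  by congr (2 * _); apply: eq_bigr => e _; rewrite vb.
exists v, b; split=> //.
- rewrite -n1 /sqn /norm1; apply: eq_bigr => i _.
  by rewrite -powR_mulrn // /v -powRrM mulVf // powRr1.
- by move=> i j; rewrite divr_ge0 ?powR_ge0 // ltW.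
- rewrite le_eqVlt; apply/orP; left; apply/eqP.
  rewrite -[LHS](divff (lt0r_neq0 S0)) {1}/S /pairsum mulr_suml; apply: eq_bigr => i _.
  rewrite mulr_suml; apply: eq_bigr => j _; rewrite bE -vb.
  rewrite -(@mulr_powRB1 _ (v i * v j) be) ?mulr_ge0 //; [ring | lra].
have bs : \sum_(e in upper_pairs k) b e.1 e.2 `^ al = 2^-1 * S `^ (1 - al).
  have -> : \sum_(e in upper_pairs k) b e.1 e.2 `^ al =
     \sum_(e in upper_pairs k) (v e.1 * v e.2) `^ be / S `^ al.
    apply: eq_bigr => e _; rewrite /b !wE powRM ?powR_ge0 ?invr_ge0 ?(ltW S0) //.
    rewrite powRV_gt0 // -powRrM; congr (_ `^ _ / _).
    by have := conj_mul; lra.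
  rewrite -mulr_suml powRD; last by rewrite (gt_eqF S0) implybT.
  have -> : \sum_(e in upper_pairs k) (v e.1 * v e.2) `^ be = 2^-1 * S by rewrite SE mulKf.
  by rewrite powRr1 ?(ltW S0) // powRN mulrA.
have hS1 : phi th k `^ (1 - al) <= S `^ (1 - al) by exact: powR_anti.
have hS2 : S `^ (1 - al) <= phi th k `^ (1 - al) + e' by rewrite -xE; apply: powR_anti => //; exact: ltW.
rewrite /clique_rate bs /psi -/th.
have -> : (1 + de) `^ al * (2^-1 * S `^ (1 - al)) = 2^-1 * (1 + de) `^ al * S `^ (1 - al).
  by rewrite mulrA (mulrC 2^-1).
apply/andP; split; first by rewrite lerD2l ler_pM2l.
rewrite -addrA lerD2l.
have -> : eps = 2^-1 * (1 + de) `^ al * e' by rewrite e'E mulrC divfK ?gt_eqF.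
by rewrite -mulrDr ler_pM2l.
Qed.

End PsiFacts.

(** A single edge of weight 1 and the vector with equal entries on it. *)
Lemma edge_choice (R : realType) (al de : R) :
  exists (v : 'I_2 -> R) (b : nat -> nat -> R),
  [/\ forall i, 0 <= v i, sqn v = 1, forall i j, 0 <= b i j,
   1 <= \sum_(i < 2) \sum_(j < 2 | i != j) b (minn i j) (maxn i j) * (v i * v j) &
   clique_rate al de 2 b = (1 + de) `^ al - 1].
Proof.
pose v (i : 'I_2) : R := 2^-1 `^ 2^-1.
have v2 : (2^-1 `^ 2^-1) * (2^-1 `^ 2^-1) = 2^-1 :> R.
  by rewrite -expr2 -powR_mulrn ?powR_ge0 // -powRrM mulVf // powRr1.
have u1 : #|upper_pairs 2|%:R = 1 :> R by have := card_upper_pairs R 2; lra.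
exists v, (fun _ _ => 1); split=> //.
- by move=> i; exact: powR_ge0.
- by rewrite /sqn /v !big_ord_recl big_ord0 expr2 v2 addr0; lra.
- rewrite sum_off_diagonal // (eq_bigr (fun=> 2^-1)); last by move=> e _; rewrite mul1r.
  rewrite sumr_const -[X in _ <= 2 * X]mulr_natr u1.
  by rewrite mulr1 divff.
- rewrite /clique_rate (eq_bigr (fun=> 1)); last by move=> e _; rewrite powR1.
  rewrite sumr_const u1; lra.
Qed.

(** * The limit *)

Section RateLimit.
Context (R : realType) (disp : nat -> measure_display)
  (T : forall n : nat, measurableType (disp n))
  (P : forall n : nat, probability (T n) R).

(** Exponential bounds in ln n on both sides, with arbitrarily small errors,
    determine the logarithmic rate. *)
Lemma rate_limit (E : forall n, set (T n)) (r : R) :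
  (\forall n \near \oo, measurable (E n)) ->
  (forall eps, 0 < eps -> eps <= 1 ->
     \forall n \near \oo, pr (P n) (E n) <= expR ((- r + eps) * ln n%:R)) ->
  (forall eps, 0 < eps ->
     \forall n \near \oo, expR ((- r - eps) * ln n%:R) <= pr (P n) (E n)) ->
  (- (lne (P n (E n)) / (ln n%:R)%:E))%E @[n --> \oo] --> r%:E.
Proof.
move=> mE up lo.
pose f (n : nat) : R := - (ln (pr (P n) (E n)) / ln n%:R).
have fr : f n @[n --> \oo] --> r.
  apply/cvgrPdist_le => e e0.
  have m0 : 0 < Num.min e 1 by rewrite lt_min e0 ltr01.
  have m1 : Num.min e 1 <= 1 by rewrite ge_min lexx orbT.
  have me : Num.min e 1 <= e by rewrite ge_min lexx.
  have up' := up _ m0 m1; have lo' := lo _ m0.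
  near=> n.
  have n1 : 1 < n%:R :> R by near: n; exact: nbhs_infty_gtr.
  have L0 : 0 < ln n%:R :> R by exact: ln_gt0.
  have h1 : pr (P n) (E n) <= expR ((- r + Num.min e 1) * ln n%:R) by near: n; exact: up'.
  have h2 : expR ((- r - Num.min e 1) * ln n%:R) <= pr (P n) (E n) by near: n; exact: lo'.
  have p0 : 0 < pr (P n) (E n) by apply: lt_le_trans h2; exact: expR_gt0.
  have g1 : ln (pr (P n) (E n)) <= (- r + Num.min e 1) * ln n%:R.
    by rewrite -ler_expR lnK.
  have g2 : (- r - Num.min e 1) * ln n%:R <= ln (pr (P n) (E n)).
    by rewrite -ler_expR lnK.
  rewrite -ler_pdivrMr // in g1; rewrite -ler_pdivlMr // in g2.
  rewrite /f ler_norml; move: g1 g2 me.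
  set q := _ / _; set mm := Num.min e 1; move=> g1 g2 me; apply/andP; split; lra.
have : (f n)%:E @[n --> \oo] --> r%:E by apply: cvg_EFin => //; exact: nearW.
apply: cvg_trans; apply: near_eq_cvg.
have lo' := lo 1 ltr01.
near=> n.
have n1 : 1 < n%:R :> R by near: n; exact: nbhs_infty_gtr.
have L0 : 0 < ln n%:R :> R by exact: ln_gt0.
have mEn : measurable (E n) by near: n; exact: mE.
have h2 : expR ((- r - 1) * ln n%:R) <= pr (P n) (E n) by near: n; exact: lo'.
have p0 : 0 < pr (P n) (E n) by apply: lt_le_trans h2; exact: expR_gt0.
rewrite (prE (P n) mEn) lne_EFin // /f EFinN EFinM; congr (- (_ * _))%E.
by rewrite inver gt_eqF.
Unshelve. all: by end_near. Qed.

End RateLimit.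

Theorem theorem1p4 (R : realType)
  (disp : nat -> measure_display)
  (T : forall n : nat, measurableType (disp n))
  (P : forall n : nat, probability (T n) R)
  (d alpha delta : R) (mu : probability R R)
  (G : forall n : nat, 'I_n * 'I_n -> {RV (P n) >-> bool})
  (Y : forall n : nat, 'I_n * 'I_n -> {RV (P n) >-> R}) :
  0 < d -> 0 < alpha -> alpha < 2 -> 0 < delta ->
  weibull alpha mu ->
  (* [G_{n,d/n}] only makes sense when [d / n] is a probability *)
  (forall n : nat, d <= n%:R ->
    [/\ erdos_renyi (P n) (d / n%:R) (G n),
        iid_symmetric (P n) mu (Y n) &
        independent_families (P n) (G n) (Y n)]) ->
  (1 < alpha -> forall beta : R, 2 < beta -> alpha^-1 + beta^-1 = 1 ->
    exists k0 : nat,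
      [/\ (2 <= k0)%N,
          forall k : nat, (2 <= k)%N ->
            psi alpha beta delta k0 <= psi alpha beta delta k &
          upper_tail_rate (P n) alpha delta (sparse_mx (G n) (Y n))
            @[n --> \oo] --> (psi alpha beta delta k0)%:E])
  /\
  (alpha <= 1 ->
    upper_tail_rate (P n) alpha delta (sparse_mx (G n) (Y n))
      @[n --> \oo] --> ((1 + delta) `^ alpha - 1)%:E).
Proof.
move=> d0 al0 al2 de0 wb model.
have d1 : 1 < (1 + delta) `^ alpha.
  have := @gt0_ltr_powR R alpha al0 1 (1 + delta).
  rewrite powR1 !nnegrE ler01 => h; apply: h => //; lra.
have mE : \forall n \near \oo,
    measurable [set w | (1 + delta) * heavy_scale alpha n <= lambda1 (sparse_mx (G n) (Y n) w)].
  near=> n.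
  have n0 : (0 < n)%N by near: n; exact: nbhs_infty_gt.
  have dn : d <= n%:R by near: n; exact: nbhs_infty_ger.
  have [er iid _] := model n dn.
  exact: (measurable_sparse_top er iid).
split=> [al1 be be2 conj|al1].
  have [k0 k02 kmin] := psi_min alpha be delta.
  exists k0; split=> //.
  have ps0 : 0 < psi alpha be delta k0 by exact: psi_gt0.
  apply: rate_limit => // eps eps0.
    move=> eps1; apply: (top_event_upper d0 al0 al2 de0 wb model (ltW ps0) eps0 eps1).
    move=> n g C B u t gs gi Bs Bg uC u1 t0 tq cC.
    exact: (rate_cost_gt1 gs gi Bs Bg uC u1 t0 tq al0 cC be2 al1 conj de0 kmin).
  have e2 : 0 < eps / 2 by rewrite divr_gt0.
  have [v [b [v0 v1 b0 bv /andP[r1 r2]]]] := clique_choice al1 be2 conj de0 k02 e2.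
  have := top_event_lower d0 al0 de0 wb model k02 v0 v1 b0 bv (lt_le_trans ps0 r1) e2.
  apply: filter_app; near=> n.
  apply: le_trans; rewrite ler_expR ler_wpM2r //.
    by rewrite ln_ge0 // ler1n; near: n; exact: nbhs_infty_gt.
  lra.
apply: rate_limit => // eps eps0.
  move=> eps1; apply: (top_event_upper d0 al0 al2 de0 wb model _ eps0 eps1); first lra.
  move=> n g C B u t gs gi Bs Bg uC u1 t0 tq cC.
  exact: (rate_cost_le1 gs gi Bs Bg uC u1 t0 tq al0 cC al1 de0).
have [v [b [v0 v1 b0 bv rE]]] := edge_choice alpha delta.
have r0 : 0 < clique_rate alpha delta 2 b by rewrite rE; lra.
have := top_event_lower d0 al0 de0 wb model (leqnn 2) v0 v1 b0 bv r0 eps0.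
by rewrite rE.
Unshelve. all: by end_near. Qed.
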